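(* Let $r\in(1,\infty)$. The geodesic equation of the right-invariant Finsler metric $F$ (the homogeneous $W^{1,r}$-metric) on the Lie group $\mathrm{Diff}_{-\infty}(\mathbb R)$ is $$r\,\frac{d}{dt}\left(\frac{\varphi_{tx}}{\varphi_x}\left|\frac{\varphi_{tx}}{\varphi_x}\right|^{r-2}\right)+(r-1)\left|\frac{\varphi_{tx}}{\varphi_x}\right|^r=0 .$$ The corresponding Finsler--Euler--Arnold equation, i.e. the geodesic equation in Eulerian coordinates $u=\varphi_t\circ\varphi^{-1}$, is the $r$-Hunter--Saxton equation $$\left(u_x|u_x|^{r-2}\right)_{xt}+\left(u_x|u_x|^{r-2}\right)_x u_x+\left((u_x|u_x|^{r-2})_x\,u\right)_x=0 .$$ This equation is formally equivalent to the non-periodic generalized inviscid Proudman--Johnson equation $$u_{txx}+(1+2\lambda)u_xu_{xx}+uu_{xxx}=0,\qquad \lambda=r^{-1}\in(0,1),$$ in the sense that the latter is obtained from the former by integrating in $x$, dividing by $|u_x|^{r-2}$ and differentiating in $x$. On the smaller group $\mathrm{Diff}(\mathbb R)$ both the geodesic equation and the Finsler--Euler--Arnold equation do not exist.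
   Context: $W^{\infty,1}(\mathbb R)=\bigcap_{k\ge 0}W^{k,1}(\mathbb R)$. The group $\mathrm{Diff}_{-\infty}(\mathbb R)=\{\varphi=\mathrm{id}+f: f'\in W^{\infty,1}(\mathbb R),\ f'>-1,\ \lim_{x\to-\infty}f(x)=0\}$ is a Fréchet Lie group with Lie algebra $\mathfrak g_{-\infty}=\{u: u'\in W^{\infty,1}(\mathbb R),\ \lim_{x\to-\infty}u(x)=0\}$. The smaller group is $\mathrm{Diff}(\mathbb R)=\{\varphi=\mathrm{id}+f: f\in W^{\infty,1}(\mathbb R),\ f'>-1\}$, with Lie algebra $W^{\infty,1}(\mathbb R)$. The right-invariant Finsler metric $F$ is defined, for a tangent vector $h=X\circ\varphi$ at $\varphi$ with $X$ in the Lie algebra, by $$F_\varphi(h)=\left(\int_{\mathbb R}|(h\circ\varphi^{-1})'|^r\,dx\right)^{1/r}=\left(\int_{\mathbb R}|X'|^r\,dx\right)^{1/r}.$$ For a path $\varphi:[0,1]\to\mathrm{Diff}_{-\infty}(\mathbb R)$, $t\mapsto\varphi(t,\cdot)$, the length is $L(\varphi)=\int_0^1F_\varphi(\varphi_t)\,dt$. Geodesics are paths locally minimizing length and are taken with constant speed; equivalently they are local minimizers of the $r$-energy $E_r(\varphi)=\int_0^1F_\varphi(\varphi_t)^r\,dt=\int_0^1\int_{\mathbb R}\left|\frac{\varphi_{tx}}{\varphi_x}\right|^r\varphi_x\,dx\,dt$ with fixed endpoints. The geodesic equation is the Euler--Lagrange equation of $E_r$. Subscripts $t,x$ denote partial derivatives.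 The non-existence on $\mathrm{Diff}(\mathbb R)$ means that the equation is not consistent with two-sided decay, so that it is not even locally well-defined there: for any non-trivial initial condition $u_0\in W^{\infty,1}(\mathbb R)$, the corresponding solution $u(t,\cdot)$ does not belong to $W^{\infty,1}(\mathbb R)$ for $t>0$. *)

(* Defs.v *)
(* MathComp-Analysis; the reals are an arbitrary R : realType. *)
From HB Require Import structures.
From mathcomp Require Export all_boot all_order all_algebra.
From mathcomp Require Export all_classical all_reals all_analysis.

Set Implicit Arguments.
Unset Strict Implicit.
Unset Printing Implicit Defensive.

Export Order.TTheory GRing.Theory Num.Theory.
Export numFieldNormedType.Exports.

Local Open Scope classical_set_scope.
Local Open Scope ring_scope.

Section Spaces.
Context {R : realType}.
Local Notation mu := (@lebesgue_measure R).

Definition L1 (f : R -> R) : Prop := mu.-integrable setT (EFin \o f).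

Definition C1c (eta : R -> R) : Prop :=
  [/\ forall x, derivable eta x 1,
      continuous (derive1 eta) &
      exists M : R, forall x, M < `|x| -> eta x = 0].

(* Test functions of class C^1_c determine the same first-order weak derivative
   as those of class C^infty_c. *)
Definition weak_derivative (f g : R -> R) : Prop :=
  forall eta, C1c eta ->
    \int[mu]_x (f x * derive1 eta x) = - \int[mu]_x (g x * eta x).

(* W^{k,1}(R) *)
Fixpoint sobolev1 (k : nat) (f : R -> R) : Prop :=
  L1 f /\
  if k is k'.+1 then exists2 g, weak_derivative f g & sobolev1 k' g else True.

(* The intersection of the W^{k,1}(R).  Its elements are classes modulo
   a.e. equality; [continuous f] selects the continuous representative. *)
Definition Winf1 (f : R -> R) : Prop :=
  continuous f /\ forall k, sobolev1 k f.

(* The Lie algebra g_{-oo}. *)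
Definition gminf (u : R -> R) : Prop :=
  [/\ forall x, derivable u x 1,
      Winf1 (derive1 u) &
      u x @[x --> -oo] --> (0 : R)].

(* The group Diff_{-oo}(R). *)
Definition Diff_minf (phi : R -> R) : Prop :=
  let f := fun x => phi x - x in
  gminf f /\ forall x, -1 < derive1 f x.

(* The group Diff(R). *)
Definition Diff (phi : R -> R) : Prop :=
  let f := fun x => phi x - x in
  Winf1 f /\ forall x, -1 < derive1 f x.

End Spaces.

Section Curves.
Context {R : realType}.
Local Notation mu := (@lebesgue_measure R).

(* Time-dependent functions are written c t x; only times in [0, T] matter, and
   time derivatives at 0 and at T are one-sided. *)
Definition time_quotient (c : R -> R -> R) (t : R) (x : R) (s : R) : R :=
  (s - t)^-1 * (c s x - c t x).

Definition derivable_t (T : R) (c : R -> R -> R) (t x : R) : Prop :=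
  cvg (time_quotient c t x s @[s --> within `[0, T] t^']).

Definition Dt (T : R) (c : R -> R -> R) (t x : R) : R :=
  lim (time_quotient c t x s @[s --> within `[0, T] t^']).

Definition Dx (c : R -> R -> R) (t : R) : R -> R := derive1 (c t).

(* The seminorms || u' ||_{\dot W^{k,1}}, k >= 0, define the Frechet topology
   of g_{-oo}: the limit condition at -oo makes them separating. *)
Definition seminorm (k : nat) (u : R -> R) : \bar R :=
  (\int[mu]_x (`|derive1n k.+1 u x|)%:E)%E.

Definition curve_derivative (T : R) (c d : R -> R -> R) : Prop :=
  forall t, t \in `[0, T] -> forall k,
    seminorm k (fun x => time_quotient c t x s - d t x)
      @[s --> within `[0, T] t^'] --> 0%E.

(* C^infty curves [0, T] -> g_{-oo}; C n is the n-th derivative of c. *)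
Definition smooth_curve (T : R) (c : R -> R -> R) : Prop :=
  exists C : nat -> R -> R -> R,
    [/\ C 0%N = c,
        forall n t, t \in `[0, T] -> gminf (C n t) &
        forall n, curve_derivative T (C n) (C n.+1)].

(* C^infty paths [0, T] -> Diff_{-oo}(R), in the global chart phi |-> phi - id. *)
Definition diffeo_path (T : R) (phi : R -> R -> R) : Prop :=
  (forall t, t \in `[0, T] -> Diff_minf (phi t)) /\
  smooth_curve T (fun t x => phi t x - x).

Definition continuous_on (T : R) (c : R -> R -> R) : Prop :=
  {within [set p : R * R | p.1 \in `[0, T]],
     continuous (fun p : R * R => c p.1 p.2)}.

Definition C1_on (T : R) (c : R -> R -> R) : Prop :=
  [/\ forall t x, t \in `[0, T] -> derivable_t T c t x /\ derivable (c t) x 1,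
      continuous_on T (Dt T c) & continuous_on T (Dx c)].

Definition C2_on (T : R) (c : R -> R -> R) : Prop :=
  [/\ C1_on T c, C1_on T (Dt T c) & C1_on T (Dx c)].

(* Functions of class C^2 with compact support in ]0, T[ x R. *)
Definition C2c (T : R) (eta : R -> R -> R) : Prop :=
  C2_on T eta /\
  exists a b M : R, [/\ 0 < a, b < T &
    forall t x, [|| t < a, b < t | M < `|x|] -> eta t x = 0].

End Curves.

Section Equations.
Context {R : realType}.
Local Notation mu := (@lebesgue_measure R).

(* z |z|^{r-2}; the value at z = 0 is 0 for every r. *)
Definition signed_pow (r z : R) : R := z * `|z| `^ (r - 2).

(* F_phi(h) *)
Definition finsler (r : R) (phi h : R -> R) : \bar R :=
  ((\int[mu]_x (`|derive1 (h \o pinv setT phi) x| `^ r)%:E) `^ r^-1)%E.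

(* E_r *)
Definition energy (r : R) (phi : R -> R -> R) : \bar R :=
  (\int[mu]_(t in `[0%R, 1%R]) (finsler r (phi t) (Dt 1 phi t) `^ r))%E.

(* The Euler--Lagrange equation of the energy with fixed endpoints: all
   directional derivatives vanish.  In the chart phi |-> phi - id the group is
   an open subset of g_{-oo}, so phi + s eta is again a path for small s. *)
Definition euler_lagrange (r : R) (phi : R -> R -> R) : Prop :=
  forall eta : R -> R -> R, smooth_curve 1 eta ->
    (forall x, eta 0 x = 0) -> (forall x, eta 1 x = 0) ->
    is_derive (0 : R) (1 : R)
      (fun s : R => fine (energy r (fun t x => phi t x + s * eta t x))) 0.

Definition geodesic_equation (T r : R) (phi : R -> R -> R) : Prop :=
  let z := fun t x => Dx (Dt T phi) t x / Dx phi t x in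
  let m := fun t x => signed_pow r (z t x) in
  forall t x, t \in `[0, T] ->
    derivable_t T m t x /\
    r * Dt T m t x + (r - 1) * `|z t x| `^ r = 0.

(* u = phi_t o phi^-1 *)
Definition velocity (T : R) (phi : R -> R -> R) (t : R) : R -> R :=
  Dt T phi t \o pinv setT (phi t).

(* u_x |u_x|^{r-2} *)
Definition momentum (r : R) (u : R -> R -> R) (t x : R) : R :=
  signed_pow r (Dx u t x).

(* The left-hand side of the r-Hunter--Saxton equation. *)
Definition rHS (T r : R) (u : R -> R -> R) (t x : R) : R :=
  let m := momentum r u in
  Dt T (Dx m) t x + Dx m t x * Dx u t x + derive1 (fun y => Dx m t y * u t y) x.

(* All derivatives in [rHS] exist at (t, x). *)
Definition rHS_defined (T r : R) (u : R -> R -> R) (t x : R) : Prop :=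
  let m := momentum r u in
  [/\ \forall s \near within `[0, T] (nbhs t), derivable (m s) x 1,
      derivable_t T (Dx m) t x,
      \forall y \near x, derivable (m t) y 1 &
      derivable (fun y => Dx m t y * u t y) x 1].

(* The r-Hunter--Saxton equation in the sense of distributions on ]0, T[ x R.
   For r < 3, r <> 2, the function u_x |u_x|^{r-2} need not be twice differentiable where
   u_x = 0; since u is smooth, the products m_x u_x and m_x u are products of a
   distribution with a smooth function:
     <m_xt, eta> = <m, eta_xt>,   <m_x u_x, eta> = - <m, (u_x eta)_x>,
     <(m_x u)_x, eta> = <m, (u eta_x)_x>. *)
Definition rHS_weak (T r : R) (u : R -> R -> R) : Prop :=
  forall eta, C2c T eta ->
    \int[mu]_(t in `[0, T]) \int[mu]_x
      (momentum r u t x *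
        (Dt T (Dx eta) t x - derive1 (fun y => Dx u t y * eta t y) x
         + derive1 (fun y => u t y * Dx eta t y) x)) = 0.

(* The primitive in x of the left-hand side of the r-Hunter--Saxton equation,
   u_x (u_x |u_x|^{r-2})_x being (1 - 1/r) (|u_x|^r)_x. *)
Definition rHS_integrated (T r : R) (u : R -> R -> R) (t x : R) : R :=
  let m := momentum r u in
  Dt T m t x + Dx m t x * u t x + (1 - r^-1) * `|Dx u t x| `^ r.

(* The left-hand side of the generalized inviscid Proudman--Johnson equation. *)
Definition proudman_johnson (T lambda : R) (u : R -> R -> R) (t x : R) : R :=
  derive1n 2 (Dt T u t) x + (1 + 2 * lambda) * Dx u t x * derive1n 2 (u t) x
  + u t x * derive1n 3 (u t) x.

End Equations.

(* Main.v *)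
(** Put z = phi_tx / phi_x, that is z(t, y) = u_x(t, phi(t, y)).  The Euler--Lagrange
    equation, the r-Hunter--Saxton equation and the Proudman--Johnson equation are all
    equivalent to the pointwise Riccati equation z_t + z^2 / r = 0.

    Changing variables x = phi(t, y) turns the energy into the integral of |z|^r phi_y, whose
    first variation is the integral of r m eta_ty - (r - 1) |z|^r eta_y with m = z |z|^{r-2}.
    Testing with eta_y = a(t) b(y), which is admissible because only decay at -oo is
    required, gives m_t = - (1 - 1/r) |z|^r wherever z <> 0, which is the Riccati equation
    there; where z = 0 it says z_t = 0, which follows because a zero with z_t <> 0 is isolated
    in time.  The weak r-Hunter--Saxton equation is treated in the same way in Eulerian
    coordinates, up to a function of t that vanishes by decay at -oo; the Proudman--Johnson
    equation is the x-derivative of u_xt + u u_xx + u_x^2 / r = 0.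

    The Riccati equation says that phi_y^{1/r} is affine in t, so that
    phi_y(t) = phi_y(0) (1 + t z_0 / r)^r.  For phi(0) = id this is an explicit solution.
    Conversely u(t, phi(t, y)) - u_0(phi(0, y)) has derivative
    phi_y(0) z_0 ((1 + t z_0 / r)^{r-1} - 1) >= 0, and
    phi(t, y) - phi(0, y) - t u_0(phi(0, y)) has derivative
    phi_y(0) ((1 + t z_0 / r)^r - 1 - t z_0) >= 0.  If one of these functions tends to 0 at both
    ends it is constant, hence z_0 = 0 and u_0 = 0. *)
Require Import Defs.
From mathcomp Require Import measurable_realfun.
From mathcomp Require Import ring lra.

Set Implicit Arguments.
Unset Strict Implicit.
Unset Printing Implicit Defensive.

Local Open Scope classical_set_scope.
Local Open Scope ring_scope.

(** * Calculus on the line *)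

(** The statement speaks of weak derivatives, seminorm limits and one-sided time derivatives,
    whereas the argument is pointwise calculus. Three translations bridge the gap. Lebesgue points
    upgrade weak derivatives to classical ones, so that [Winf1] amounts to [nice]. Vanishing at -oo
    bounds the sup norm by the L^1 norm of the derivative, so that seminorm derivatives of a path
    are jointly continuous mixed partial derivatives. Extension beyond [0, T] by a tangent line
    makes the ordinary rules available at the end times. The recurring obstacle is that z |z|^{r-2}
    is not differentiable at 0 when r < 2. It is differentiated only where z <> 0, and the zero set
    is reached through z itself, which is C^1 in time. Conversely, the Riccati equation makes z
    phi_y^{1/r} constant in time, so a zero of z persists and the equation for z |z|^{r-2} holds
    trivially along it. The explicit solution needs more than a formula: it must be a smooth curve
    for the Frechet topology, which is why its mixed derivatives are organised in a class with
    integrable coefficients. *)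

Section Calculus.
Context {R : realType}.
Implicit Types (f g : R -> R) (x l : R).

Lemma is_derive1_eq f g x (a b : R) :
  is_derive x 1 f a -> f =1 g -> a = b -> is_derive x 1 g b.
Proof. by move=> h /funext <- <-. Qed.

Lemma is_derive1_derive1 f x (l : R) : is_derive x 1 f l -> derive1 f x = l.
Proof. by move=> h; rewrite derive1E derive_val. Qed.

Lemma is_derive1_derivable f x (l : R) : is_derive x 1 f l -> derivable f x 1.
Proof. by case. Qed.

Lemma derivable_is_derive1 f x : derivable f x 1 -> is_derive x 1 f (derive1 f x).
Proof. by move=> h; rewrite derive1E; exact: derivableP. Qed.

Lemma is_derive1_continuous f x (l : R) : is_derive x 1 f l -> {for x, continuous f}.
Proof. by move=> [h _]; apply: differentiable_continuous; exact/derivable1_diffP. Qed.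

Lemma is_derive1_fun f g : (forall x, is_derive x 1 f (g x)) -> derive1 f = g.
Proof. by move=> h; apply/funext => x; exact: is_derive1_derive1. Qed.

Lemma is_derive1D f g x (a b : R) :
  is_derive x 1 f a -> is_derive x 1 g b -> is_derive x 1 (fun y => f y + g y) (a + b).
Proof. exact: is_deriveD. Qed.

Lemma is_derive1B f g x (a b : R) :
  is_derive x 1 f a -> is_derive x 1 g b -> is_derive x 1 (fun y => f y - g y) (a - b).
Proof. exact: is_deriveB. Qed.

Lemma is_derive1N f x (a : R) :
  is_derive x 1 f a -> is_derive x 1 (fun y => - f y) (- a).
Proof. exact: is_deriveN. Qed.

Lemma is_derive1M f g x (a b : R) :
  is_derive x 1 f a -> is_derive x 1 g b ->
  is_derive x 1 (fun y => f y * g y) (f x * b + g x * a).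
Proof. by move=> hf hg; have := is_deriveM hf hg. Qed.

Lemma is_derive1_cst (c : R) x : is_derive x 1 (fun=> c) 0.
Proof. exact: is_derive_cst. Qed.

Lemma is_derive1_id x : is_derive x 1 (fun y : R => y) 1.
Proof. exact: is_derive_id. Qed.

Lemma is_derive1Z f x (c a : R) :
  is_derive x 1 f a -> is_derive x 1 (fun y => c * f y) (c * a).
Proof.
move=> hf; apply: is_derive1_eq (is_derive1M (is_derive1_cst c x) hf) _ _ => //.
by ring.
Qed.

Lemma is_derive1_chain f g x (a b : R) :
  is_derive x 1 f a -> is_derive (f x) 1 g b -> is_derive x 1 (fun y => g (f y)) (b * a).
Proof. by move=> hf hg; have := is_derive1_comp hg hf; rewrite /GRing.scale/=. Qed.

Lemma is_derive1V f x (a : R) : f x != 0 ->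
  is_derive x 1 f a -> is_derive x 1 (fun y => (f y)^-1) (- a / f x ^+ 2).
Proof.
move=> fx0 hf; apply: is_derive1_eq (is_deriveV fx0 hf) _ _ => //.
by rewrite /GRing.scale/= mulNr mulrC mulNr.
Qed.

Lemma is_derive1_affine (c d x : R) : is_derive x 1 (fun y => c * y + d) c.
Proof.
apply: is_derive1_eq (is_derive1D (is_derive1Z c (is_derive1_id x)) (is_derive1_cst d x)) _ _ => //.
by ring.
Qed.

Lemma is_derive1_near f g x (a : R) :
  (\forall y \near x, f y = g y) -> is_derive x 1 f a -> is_derive x 1 g a.
Proof.
move=> fg [df dfa].
have fgx : f x = g x by exact: nbhs_singleton fg.
have dg : h^-1 *: (g (h *: 1 + x) - g x) @[h --> (0:R)^'] --> a.
  rewrite -dfa; apply: cvg_trans df; apply: near_eq_cvg.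
  have : \forall h \near (0:R), f (h *: 1 + x) = g (h *: 1 + x).
    have : (fun h : R => h *: (1:R) + x) h @[h --> (0:R)] --> x.
      rewrite -[X in _ --> X]add0r; apply: cvgD; last exact: cvg_cst.
      by rewrite -[X in _ --> X](scale0r (1:R)); apply: cvgZr_tmp; exact: cvg_id.
    by move=> /(_ _ fg).
  move=> /nbhs_dnbhs; apply: filterS => h /= ->; by rewrite fgx.
split; first by apply/cvg_ex; exists a.
by apply/cvg_lim.
Qed.

(** [time_quotient] is written with a moving point [s], the library derivative with an increment;
    translation by [x] carries each punctured filter to the other. *)
Lemma is_derive1P f x (l : R) :
  is_derive x 1 f l <-> (s - x)^-1 * (f s - f x) @[s --> x^'] --> l.
Proof.
have E : ((s - x)^-1 * (f s - f x) @[s --> x^'] --> l) =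
  (h^-1 *: (f (h *: 1 + x) - f x) @[h --> (0:R)^'] --> l).
  apply/propext; split => h.
  - have c : h *: (1 : R) + x @[h --> (0:R)^'] --> x^'.
      move=> A /= [e e0 eA]; exists e => //= z; rewrite /= sub0r normrN => ze z0.
      apply: eA => /=; last by rewrite /GRing.scale/= mulr1 -subr_eq0 addrK.
      by rewrite /GRing.scale/= mulr1 opprD addrCA subrr addr0 normrN.
    have := cvg_comp _ _ c h.
    by apply: cvg_trans; apply: near_eq_cvg; near=> z; rewrite /= /GRing.scale/= mulr1 addrK.
  - have c : s - x @[s --> x^'] --> (0:R)^'.
      move=> A /= [e e0 eA]; exists e => //= z ze z0.
      by apply: eA => /=; rewrite ?subr_eq0 // sub0r normrN distrC.
    have := cvg_comp _ _ c h.
    apply: cvg_trans; apply: near_eq_cvg; near=> z.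
    by rewrite /= /GRing.scale/= mulr1 subrK.
rewrite E; split; last by move=> h; split; [apply/cvg_ex; exists l|apply/cvg_lim].
by move=> [h1 <-].
Unshelve. all: by end_near. Qed.

End Calculus.

(** * Integrable functions and the fundamental theorem of calculus on the line *)

Section Integrals.
Context {R : realType}.
Local Notation mu := (@lebesgue_measure R).
Implicit Types (f g h : R -> R).

Lemma L1_measurable f : L1 f -> measurable_fun setT f.
Proof. by move=> /integrableP[/measurable_EFinP]. Qed.

Lemma L1S f (A : set R) : measurable A -> L1 f -> mu.-integrable A (EFin \o f).
Proof. by move=> mA; apply: integrableS => //. Qed.

Lemma L1_dominated f g : measurable_fun setT f -> (forall x, `|f x| <= g x) -> L1 g -> L1 f.
Proof.
move=> mf fg; apply: le_integrable => //.
- exact/measurable_EFinP.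
- by move=> x _ /=; rewrite lee_fin (le_trans (fg x)) // ler_norm.
Qed.

Lemma L1D f g : L1 f -> L1 g -> L1 (fun x => f x + g x).
Proof. by move=> hf hg; have := integrableD measurableT hf hg. Qed.

Lemma L1Z (c : R) f : L1 f -> L1 (fun x => c * f x).
Proof. by move=> hf; have := integrableZl measurableT c hf. Qed.

Lemma L1N f : L1 f -> L1 (fun x => - f x).
Proof.
move=> /(L1Z (-1)); congr L1; by apply/funext => x; rewrite mulN1r.
Qed.

Lemma L1B f g : L1 f -> L1 g -> L1 (fun x => f x - g x).
Proof. by move=> hf /L1N; exact: L1D. Qed.

Lemma L1_norm f : L1 f -> L1 (fun x => `|f x|).
Proof.
move=> hf; apply: (@L1_dominated _ (fun x => `|f x|)) => //.
- by apply: measurableT_comp => //; exact: L1_measurable.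
- by move=> x; rewrite normr_id.
- rewrite /L1; have := integrable_norm hf; exact.
Qed.

Lemma L10 : L1 (fun=> 0 : R).
Proof. exact: integrable0. Qed.

Lemma L1M_bounded (M : R) f h : measurable_fun setT h -> (forall x, `|h x| <= M) ->
  L1 f -> L1 (fun x => h x * f x).
Proof.
move=> mh hM hf; apply: (@L1_dominated _ (fun x => M * `|f x|)).
- by apply: measurable_funM => //; exact: L1_measurable.
- by move=> x; rewrite normrM ler_wpM2r.
- by apply: L1Z; exact: L1_norm.
Qed.

Lemma int_D f g : L1 f -> L1 g ->
  \int[mu]_x (f x + g x) = \int[mu]_x f x + \int[mu]_x g x.
Proof. by move=> hf hg; rewrite RintegralD. Qed.

Lemma int_B f g : L1 f -> L1 g ->
  \int[mu]_x (f x - g x) = \int[mu]_x f x - \int[mu]_x g x.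
Proof. by move=> hf hg; rewrite RintegralB. Qed.

Lemma int_Z (c : R) f : L1 f -> \int[mu]_x (c * f x) = c * \int[mu]_x f x.
Proof. by move=> hf; rewrite RintegralZl. Qed.

Lemma int_le f g : L1 f -> L1 g -> (forall x, f x <= g x) ->
  \int[mu]_x f x <= \int[mu]_x g x.
Proof. by move=> hf hg fg; apply: le_Rintegral. Qed.

Lemma int_norm f : L1 f -> `|\int[mu]_x f x| <= \int[mu]_x `|f x|.
Proof. by move=> hf; apply: le_normr_Rintegral. Qed.

Lemma int_ge0 f : (forall x, 0 <= f x) -> 0 <= \int[mu]_x f x.
Proof. by move=> h; apply: Rintegral_ge0. Qed.

Lemma int_norm_EFin f : L1 f -> (\int[mu]_x `|f x|)%:E = (\int[mu]_x (`|f x|)%:E)%E.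
Proof.
move=> hf; rewrite /Rintegral fineK //.
by have := integrable_fin_num measurableT (L1_norm hf).
Qed.

Lemma int_indic f (A : set R) : measurable A ->
  \int[mu]_(x in A) f x = \int[mu]_x (\1_A x * f x).
Proof.
move=> mA; rewrite Rintegral_mkcond; apply: eq_Rintegral => x _.
by rewrite patchE indicE; case: ifP => _ /=; rewrite ?mul1r ?mul0r.
Qed.

Lemma int_dct (f_ : nat -> R -> R) f g :
  (forall n, measurable_fun setT (f_ n)) -> measurable_fun setT f -> L1 g ->
  (forall n x, `|f_ n x| <= g x) ->
  {ae mu, forall x, f_ n x @[n --> \oo] --> f x} ->
  \int[mu]_x (f_ n x) @[n --> \oo] --> \int[mu]_x f x.
Proof.
move=> mf_ mf hg fg cf.
have [|||||i1 _ i3] := @dominated_convergence _ _ _ mu setT measurableT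
  (fun n x => (f_ n x)%:E) (EFin \o f) (EFin \o g) => //.
- by move=> n; apply/measurable_EFinP; exact: mf_.
- by apply/measurable_EFinP.
- case: cf => N [mN N0 subN]; exists N; split => //.
  apply: subset_trans subN; apply: subsetC => x /= h _.
  by apply/fine_cvgP; split => //; apply: nearW.
- by apply: aeW => x n _ /=; rewrite lee_fin.
apply: fine_cvg; rewrite fineK; first exact: i3.
exact: (integrable_fin_num measurableT i1).
Qed.

Lemma within_itv_continuous f (a b : R) : continuous f -> {within `[a, b], continuous f}.
Proof. by move=> cf; apply: continuous_subspaceT. Qed.

Lemma derivable_oo_LR f (df : R -> R) (a b : R) :
  (forall x : R, is_derive x 1 f (df x)) -> derivable_oo_LRcontinuous f a b.
Proof.
move=> h; have cf x : {for x, continuous f} by exact: is_derive1_continuous (h x).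
split; first by move=> x _; case: (h x).
- by apply: cvg_at_right_filter; exact: cf.
- by apply: cvg_at_left_filter; exact: cf.
Qed.

Lemma int_FTC f (df : R -> R) (a b : R) : a <= b ->
  (forall x : R, is_derive x 1 f (df x)) -> continuous df ->
  \int[mu]_(x in `[a, b]) df x = f b - f a.
Proof.
rewrite le_eqVlt => /orP[/eqP <- h cf|ab h cf].
  by rewrite set_itv1 Rintegral_set1 subrr.
rewrite /Rintegral (@continuous_FTC2 _ df f) //=.
- exact: within_itv_continuous.
- exact: derivable_oo_LR h.
- by move=> x _; exact: is_derive1_derive1.
Qed.

Lemma itv_integrable f (a b : R) : continuous f -> mu.-integrable `[a, b] (EFin \o f).
Proof.
move=> cf; apply: continuous_compact_integrable; first exact: segment_compact.
exact: within_itv_continuous.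
Qed.

Lemma int_support f (a b : R) : (forall x, x \notin `[a, b] -> f x = 0) ->
  \int[mu]_x f x = \int[mu]_(x in `[a, b]) f x.
Proof.
move=> h; rewrite [RHS]Rintegral_mkcond; apply: eq_Rintegral => x _.
by rewrite patchE; case: ifPn => // xab; apply: h; move: xab; rewrite mem_setE.
Qed.

Lemma L1_support f (a b : R) : continuous f -> (forall x, x \notin `[a, b] -> f x = 0) -> L1 f.
Proof.
move=> cf h; have := itv_integrable a b cf.
rewrite integrable_mkcond //; congr (_.-integrable _ _).
apply/funext => x; rewrite patchE /=; case: ifPn => // xab.
by rewrite h //; move: xab; rewrite mem_setE.
Qed.

Lemma MVT_le f (df : R -> R) (a b : R) : a <= b ->
  (forall x : R, x \in `[a, b] -> is_derive x 1 f (df x)) ->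
  exists2 c, c \in `[a, b] & f b - f a = df c * (b - a).
Proof.
rewrite le_eqVlt => /predU1P[<- h|ab h].
  exists a; first by rewrite bound_itvE.
  by rewrite !subrr mulr0.
have cf : {within `[a, b], continuous f}.
  apply: derivable_within_continuous => x xab.
  by have [] := h _ xab.
have df' (x : R) : x \in `]a, b[ -> is_derive x 1 f (df x).
  by move=> xab; apply: h; exact: subset_itv_oo_cc.
have [c cab e] := MVT ab df' cf.
by exists c => //; exact: subset_itv_oo_cc.
Qed.

End Integrals.

(** * Primitives and weak derivatives *)

Section Primitive.
Context {R : realType}.
Local Notation mu := (@lebesgue_measure R).
Implicit Types (f g h : R -> R).

(** Integrating from -oo selects the primitive that vanishes there, which is the normalisation built
    into [gminf]. *)
Definition prim h (x : R) : R := \int[mu]_(y in `]-oo, x]) h y.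

Lemma prim_indic h x : prim h x = \int[mu]_y (\1_(`]-oo, x]) y * h y).
Proof. by rewrite /prim int_indic. Qed.

Lemma indic_le1 (A : set R) (y : R) : `|\1_A y : R| <= 1.
Proof. by rewrite indicE; case: (_ \in _); rewrite ?normr1 ?normr0. Qed.

Lemma L1_indic (A : set R) h : measurable A -> L1 h -> L1 (fun y => \1_A y * h y).
Proof. by move=> mA; apply: (@L1M_bounded _ 1) => // x; exact: indic_le1. Qed.

Lemma prim_le_norm h x : L1 h -> `|prim h x| <= \int[mu]_y `|h y|.
Proof.
move=> hh; rewrite prim_indic; apply: (le_trans (int_norm (L1_indic _ hh))) => //.
apply: int_le; [exact/L1_norm/L1_indic|exact: L1_norm|] => y.
by rewrite normrM -[leRHS]mul1r ler_wpM2r// indic_le1.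
Qed.

Lemma ae_neq (a : R) : {ae mu, forall y, y != a}.
Proof.
exists [set a]; split => //; first exact: lebesgue_measure_set1.
by move=> y /= /negP; rewrite negbK => /eqP.
Qed.

Lemma ae_mono (P Q : R -> Prop) :
  {ae mu, forall y, P y} -> (forall y, P y -> Q y) -> {ae mu, forall y, Q y}.
Proof.
move=> [N [mN N0 subN]] PQ; exists N; split => //.
by apply: subset_trans subN; apply: subsetC => y /= /PQ.
Qed.

Lemma cvg_near_cst (u : nat -> R) (l : R) : (\forall n \near \oo, u n = l) -> u n @[n --> \oo] --> l.
Proof. by move=> h; apply: cvg_near_cst; apply: filterS h => n ->. Qed.

(** Along a sequence tending to [x] the indicators of []-oo, u n]] converge except possibly at [x],
    a null set, and [|h|] dominates. *)
Lemma prim_continuous h : L1 h -> continuous (prim h).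
Proof.
move=> hh x; apply/(@cvg_nbhsP _ R^o) => u ux.
rewrite (_ : (fun n => prim h (u n)) = fun n => \int[mu]_y (\1_(`]-oo, u n]) y * h y)); last first.
  by apply/funext => n; rewrite prim_indic.
rewrite prim_indic; apply: (@int_dct _ _ _ (fun y => `|h y|)).
- by move=> n; apply: L1_measurable; exact: L1_indic.
- by apply: L1_measurable; exact: L1_indic.
- exact: L1_norm.
- by move=> n y; rewrite normrM -[leRHS]mul1r ler_wpM2r// indic_le1.
apply: ae_mono (ae_neq x) _ => y yx.
apply: cvgMr_tmp; apply: cvg_near_cst.
move: yx; rewrite neq_lt => /orP[yx|xy].
- have : \forall n \near \oo, y < u n by exact: (cvgr_gt _ ux).
  by apply: filterS => n yn; rewrite !indicE !mem_setE !in_itv/= (ltW yn) (ltW yx).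
- have : \forall n \near \oo, u n < y by exact: (cvgr_lt _ ux).
  by apply: filterS => n yn; rewrite !indicE !mem_setE !in_itv/= !leNgt yn xy.
Qed.

Lemma prim_Ny h : L1 h -> prim h x @[x --> -oo] --> (0 : R).
Proof.
move=> hh; apply/cvg_ninftyP => u ux.
rewrite (_ : (fun n => prim h (u n)) = fun n => \int[mu]_y (\1_(`]-oo, u n]) y * h y)); last first.
  by apply/funext => n; rewrite prim_indic.
rewrite -[X in _ --> X](Rintegral_set0 mu h) int_indic//.
apply: (@int_dct _ _ _ (fun y => `|h y|)).
- by move=> n; apply: L1_measurable; exact: L1_indic.
- by apply: L1_measurable; exact: L1_indic.
- exact: L1_norm.
- by move=> n y; rewrite normrM -[leRHS]mul1r ler_wpM2r// indic_le1.
apply: aeW => y; apply: cvgMr_tmp; apply: cvg_near_cst.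
move/cvgrNyPlt : ux => /(_ y); apply: filterS => n yn.
by rewrite !indicE !mem_setE !in_itv/= !leNgt yn in_set0.
Qed.

Lemma prim_y h : L1 h -> prim h x @[x --> +oo] --> \int[mu]_x h x.
Proof.
move=> hh; apply/cvg_pinftyP => u ux.
rewrite (_ : (fun n => prim h (u n)) = fun n => \int[mu]_y (\1_(`]-oo, u n]) y * h y)); last first.
  by apply/funext => n; rewrite prim_indic.
apply: (@int_dct _ _ _ (fun y => `|h y|)).
- by move=> n; apply: L1_measurable; exact: L1_indic.
- exact: L1_measurable.
- exact: L1_norm.
- by move=> n y; rewrite normrM -[leRHS]mul1r ler_wpM2r// indic_le1.
apply: aeW => y; rewrite -[X in _ --> X]mul1r; apply: cvgMr_tmp; apply: cvg_near_cst.
move/cvgryPge : ux => /(_ y); apply: filterS => n yn.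
by rewrite !indicE !mem_setE !in_itv/= yn.
Qed.

Lemma prim_derive h (x : R) : L1 h -> {for x, continuous h} -> is_derive x 1 (prim h) (h x).
Proof.
move=> hh ch; have xx1 : x < x + 1 by rewrite ltrDl.
have i1 : mu.-integrable `]-oo, (x + 1)] (EFin \o h) by exact: L1S.
have [d e] := continuous_FTC1 xx1 i1 (ltNyr _) ch.
rewrite -[h x]e derive1E; exact: derivableP.
Qed.

End Primitive.

(** * Weak derivatives tested at Lebesgue points *)

Section TestFunctions.
Context {R : realType}.
Local Notation mu := (@lebesgue_measure R).
Implicit Types (f g h : R -> R).

Lemma is_derive_mul_norm (x : R) : is_derive x 1 (fun y => y * `|y|) (2 * `|x|).
Proof.
have [x0|x0|->] := ltrgt0P x.
- apply: (@is_derive1_near _ (fun y => y * y)).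
    near=> y; rewrite ger0_norm//; apply: ltW; near: y; exact: lt_nbhsr.
  apply: is_derive1_eq (is_derive1M (is_derive1_id x) (is_derive1_id x)) _ _ => //.
  by ring.
- apply: (@is_derive1_near _ (fun y => - (y * y))).
    near=> y; rewrite ltr0_norm ?mulrN//; near: y; exact: lt_nbhsl.
  apply: is_derive1_eq (is_derive1N (is_derive1M (is_derive1_id x) (is_derive1_id x))) _ _ => //.
  by ring.
apply/is_derive1P; rewrite normr0.
apply: (@cvg_trans _ (`|s| @[s --> (0:R)^'])).
  apply: near_eq_cvg; near=> s.
  by rewrite mul0r !subr0 mulKf//; near: s; exact: nbhs_dnbhs_neq.
rewrite mulr0.
apply: cvg_within_filter.
by have := @norm_continuous R R^o 0; rewrite /continuous_at normr0.
Unshelve. all: by end_near. Qed.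

(** [tent] is the hat function on [-1, 1] of integral 1, a second difference of [|y|], and [ramp] is
    its primitive rising from 0 to 1. The terms [y * |y|] make [ramp] C^1 through a single formula,
    and C^1 is all that the test functions of [weak_derivative] need. *)
Definition ramp (y : R) : R :=
  ((y + 1) * `|y + 1| + (y - 1) * `|y - 1| - 2 * (y * `|y|)) / 4 + 1 / 2.
Definition tent (y : R) : R := (`|y + 1| + `|y - 1| - 2 * `|y|) / 2.

Lemma tent_cases (y : R) : [/\ y <= -1 -> tent y = 0 /\ ramp y = 0,
   -1 <= y <= 0 -> tent y = y + 1 /\ ramp y = (y + 1) ^+ 2 / 2,
   0 <= y <= 1 -> tent y = 1 - y /\ ramp y = 1 - (1 - y) ^+ 2 / 2 &
   1 <= y -> tent y = 0 /\ ramp y = 1].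
Proof.
rewrite /tent /ramp; split => h.
- rewrite (@ler0_norm _ (y + 1)); last by lra.
  rewrite (@ler0_norm _ (y - 1)); last by lra.
  rewrite (@ler0_norm _ y); last by lra.
  by split; field.
- rewrite (@ger0_norm _ (y + 1)); last by lra.
  rewrite (@ler0_norm _ (y - 1)); last by lra.
  rewrite (@ler0_norm _ y); last by lra.
  by split; field.
- rewrite (@ger0_norm _ (y + 1)); last by lra.
  rewrite (@ler0_norm _ (y - 1)); last by lra.
  rewrite (@ger0_norm _ y); last by lra.
  by split; field.
- rewrite (@ger0_norm _ (y + 1)); last by lra.
  rewrite (@ger0_norm _ (y - 1)); last by lra.
  rewrite (@ger0_norm _ y); last by lra.
  by split; field.
Qed.

Lemma tent_bounds (y : R) : [/\ 0 <= tent y <= 1, 0 <= ramp y <= 1 &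
   1 <= `|y| -> tent y = 0].
Proof.
have [h1 h2 h3 h4] := tent_cases y.
have [y1|y1] := leP y (-1).
  by have [-> ->] := h1 y1; split => //; lra.
have [y2|y2] := leP y 0.
  have [|-> ->] := h2; first by lra.
  split; [by lra| |]; first by nra.
  by rewrite ler0_norm // => ?; lra.
have [y3|y3] := leP y 1.
  have [|-> ->] := h3; first by lra.
  split; [by lra| |]; first by nra.
  by rewrite gtr0_norm // => ?; lra.
have [|-> ->] := h4; first by lra.
by split => //; lra.
Qed.

Lemma is_derive_ramp (y : R) : is_derive y 1 ramp (tent y).
Proof.
have hq (c : R) : is_derive y 1 (fun z => (z + c) * `|z + c|) (2 * `|y + c|).
  have h1 : is_derive y 1 (fun z => z + c) 1.
    by apply: is_derive1_eq (is_derive1_affine 1 c y) _ _ => // z; rewrite mul1r.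
  apply: is_derive1_eq (is_derive1_chain h1 (is_derive_mul_norm _)) _ _ => //.
  by rewrite mulr1.
have h0 := is_derive_mul_norm y.
apply: is_derive1_eq (is_derive1D (is_derive1Z 4^-1 (is_derive1B (is_derive1D (hq 1) (hq (-1))) (is_derive1Z 2 h0))) (is_derive1_cst (1/2) y)) _ _.
  by move=> z; rewrite /ramp mulrC.
by rewrite /tent; field.
Qed.

Lemma tent_continuous : continuous tent.
Proof.
move=> y; rewrite /tent; apply: cvgMr_tmp; apply: cvgB; first apply: cvgD.
- by apply: cvg_norm; apply: cvgD; [exact: cvg_id|exact: cvg_cst].
- by apply: cvg_norm; apply: cvgB; [exact: cvg_id|exact: cvg_cst].
- by apply: cvgMl_tmp; apply: cvg_norm; exact: cvg_id.
Qed.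

(** As [n] grows, [tent_at] approximates the Dirac mass at [a] and [ramp_at] the unit step at
    [a]. *)
Definition ramp_at (n : nat) (a x : R) : R := ramp (n.+1%:R * (x - a)).
Definition tent_at (n : nat) (a x : R) : R := n.+1%:R * tent (n.+1%:R * (x - a)).

Lemma is_derive_ramp_at n (a x : R) : is_derive x 1 (ramp_at n a) (tent_at n a x).
Proof.
have h : is_derive x 1 (fun z => n.+1%:R * (z - a)) n.+1%:R.
  apply: is_derive1_eq (is_derive1_affine n.+1%:R (- (n.+1%:R * a)) x) _ _ => // z.
  by rewrite mulrBr.
apply: is_derive1_eq (is_derive1_chain h (is_derive_ramp _)) _ _ => //.
by rewrite /tent_at mulrC.
Qed.

Lemma tent_at_continuous n a : continuous (tent_at n a).
Proof.
move=> x; rewrite /tent_at; apply: cvgMl_tmp.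
apply: (cvg_comp _ tent); last exact: tent_continuous.
by apply: cvgMl_tmp; apply: cvgB; [exact: cvg_id|exact: cvg_cst].
Qed.

Lemma tent_at_ge0 n a x : 0 <= tent_at n a x <= n.+1%:R.
Proof.
have [/andP[h1 h2] _ _] := tent_bounds (n.+1%:R * (x - a)).
rewrite /tent_at mulr_ge0 //=; rewrite -[leRHS]mulr1; exact: ler_wpM2l.
Qed.

Lemma tent_at_out n a x : n.+1%:R^-1 <= `|x - a| -> tent_at n a x = 0.
Proof.
move=> h; have [_ _ h0] := tent_bounds (n.+1%:R * (x - a)).
rewrite /tent_at h0 ?mulr0// normrM ger0_norm//.
by rewrite -ler_pdivrMl // mulr1.
Qed.

Lemma int_tent_at n a : L1 (tent_at n a) /\ \int[mu]_x tent_at n a x = 1.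
Proof.
set k := n.+1%:R : R.
have k0 : 0 < k by rewrite /k.
have kk : 0 < k^-1 by rewrite invr_gt0.
have out x : x \notin `[a - k^-1, a + k^-1] -> tent_at n a x = 0.
  rewrite in_itv/= => h; apply: tent_at_out; rewrite -/k leNgt; apply: contra h.
  by rewrite ltr_distl => /andP[h1 h2]; rewrite !ltW.
split; first by apply: (L1_support _ out); exact: tent_at_continuous.
rewrite (int_support out) (int_FTC _ (is_derive_ramp_at n a)); last 2 first.
- by rewrite lerD2l ge0_cp // ltW.
- exact: tent_at_continuous.
rewrite /ramp_at -/k (_ : k * (a + k^-1 - a) = 1); last by field; rewrite gt_eqF.
rewrite (_ : k * (a - k^-1 - a) = -1); last by field; rewrite gt_eqF.
have [_ _ _ /(_ (lexx _))[_ ->]] := tent_cases 1.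
by have [/(_ (lexx _))[_ ->] _ _ _] := tent_cases (-1); rewrite subr0.
Qed.

Lemma tent_at_cvg g a : L1 g -> lebesgue_pt g a ->
  \int[mu]_x (tent_at n a x * g x) @[n --> \oo] --> g a.
Proof.
move=> hg ha.
have bnd n x : `|tent_at n a x| <= n.+1%:R.
  by have /andP[h1 h2] := tent_at_ge0 n a x; rewrite ger0_norm.
have mt n : measurable_fun setT (tent_at n a).
  by apply: continuous_measurable_fun; exact: tent_at_continuous.
have Lt n : L1 (fun x => tent_at n a x * g x) by exact: (@L1M_bounded _ n.+1%:R).
have E n : \int[mu]_x (tent_at n a x * g x) - g a = \int[mu]_x (tent_at n a x * (g x - g a)).
  have [i1 i2] := int_tent_at n a.
  have -> : \int[mu]_x (tent_at n a x * (g x - g a)) =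
     \int[mu]_x (tent_at n a x * g x - g a * tent_at n a x).
    by apply: eq_Rintegral => x _; rewrite mulrBr (mulrC (g a)).
  by rewrite int_B; [rewrite int_Z// i2 mulr1|exact: Lt|exact: L1Z].
have Lt' n : L1 (fun x => tent_at n a x * (g x - g a)).
  have [i1 i2] := int_tent_at n a.
  rewrite (_ : (fun x => _) = (fun x => tent_at n a x * g x - g a * tent_at n a x)).
    by apply: L1B => //; exact: L1Z.
  by apply/funext => x; rewrite mulrBr (mulrC (g a)).
(* The tent is at most n+1 and lives on the ball of radius 1/(n+1), whose length is 2/(n+1); hence
   the factor 2 in front of the mean deviation, which tends to 0 at a Lebesgue point. *)
have B n : ((`|\int[mu]_x (tent_at n a x * g x) - g a|)%:E <= 2%:E * davg g a n.+1%:R^-1)%E.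
  have k0 : 0 < (n.+1%:R^-1 : R) by rewrite invr_gt0.
  rewrite E; apply: (@le_trans _ _ (\int[mu]_x `|tent_at n a x * (g x - g a)|)%:E).
    by rewrite lee_fin; exact: int_norm.
  rewrite int_norm_EFin // /davg /iavg.
  rewrite lebesgue_measure_ball ?(ltW k0)//.
  rewrite inver ifF; last by rewrite mulrn_eq0 /= gt_eqF.
  rewrite muleA -EFinM (_ : 2 * _ = n.+1%:R); last first.
    have : n.+1%:R != 0 :> R by rewrite pnatr_eq0.
    rewrite -(mulr_natr _ 2); move: (n.+1%:R : R) => k kn0; by field.
  have mg : measurable_fun setT (fun x => g x - g a).
    by apply: measurable_funB => //; exact: L1_measurable.
  rewrite -ge0_integralZl//; last first.
    apply/measurable_EFinP; apply: measurableT_comp => //.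
    by apply: measurable_funS mg.
    exact: measurable_ball.
  rewrite [leRHS]integral_mkcond; apply: ge0_le_integral => //.
  - by apply/measurable_EFinP; apply: L1_measurable; exact: L1_norm.
  - apply/(measurable_restrictT _ _).1 => //; first exact: measurable_ball.
    apply/measurable_EFinP; apply: measurable_funM => //; apply: measurableT_comp => //.
    by apply: measurable_funS mg.
  move=> x _; rewrite patchE; case: ifPn => [|] xb.
  - by rewrite /= -EFinM lee_fin normrM ler_wpM2r.
  - rewrite tent_at_out ?mul0r ?normr0 //.
    rewrite leNgt; apply: contra xb => h.
    by rewrite inE /ball/= distrC.
apply/cvgrPdist_le => e e0.
have e20 : 0 < e / 2 by rewrite divr_gt0.
have : \forall r \near 0^'+, (2%:E * davg g a r <= e%:E)%E.
  move/fine_cvgP : ha => [fin /cvgrPdist_lt/(_ _ e20)].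
  move: fin; apply: filterS2 => r fr.
  rewrite sub0r normrN => h; rewrite -(fineK fr) -EFinM lee_fin.
  by rewrite mulrC -ler_pdivlMr // (le_trans (ler_norm _)) // ltW.
move=> [d /= d0 hd].
near=> n; rewrite distrC -lee_fin; apply: (le_trans (B n)).
apply: hd; last by rewrite invr_gt0.
rewrite /= sub0r normrN ger0_norm ?invr_ge0 //.
by near: n; exact: near_infty_natSinv_lt (PosNum d0).
Unshelve. all: by end_near. Qed.

Lemma ramp_at_cvg h a : L1 h ->
  \int[mu]_x (ramp_at n a x * h x) @[n --> \oo] --> \int[mu]_x h x - prim h a.
Proof.
move=> hh.
have mr n : measurable_fun setT (ramp_at n a).
  apply: continuous_measurable_fun => x; exact: is_derive1_continuous (is_derive_ramp_at n a x).
have bnd n x : `|ramp_at n a x| <= 1.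
  by have [_ /andP[h1 h2] _] := tent_bounds (n.+1%:R * (x - a)); rewrite ger0_norm.
have iL := L1_indic (measurable_itv `]-oo, a]) hh.
rewrite prim_indic -int_B//.
apply: (@int_dct _ _ _ (fun y => `|h y|)).
- by move=> n; apply: L1_measurable; exact: (@L1M_bounded _ 1).
- by apply: L1_measurable; exact: L1B.
- exact: L1_norm.
- by move=> n y; rewrite normrM -[leRHS]mul1r ler_wpM2r.
apply: ae_mono (ae_neq a) _ => y ya.
rewrite (_ : h y - _ = (1 - \1_(`]-oo, a]) y) * h y); last by rewrite mulrBl mul1r.
apply: cvgMr_tmp; apply: cvg_near_cst.
have d0 : 0 < `|y - a| by rewrite normr_gt0 subr_eq0.
near=> n.
have hn : n.+1%:R^-1 <= `|y - a|.
  by apply: ltW; near: n; exact: near_infty_natSinv_lt (PosNum d0).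
have n0 : 0 < (n.+1%:R : R) by [].
rewrite /ramp_at; have [h1 _ _ h4] := tent_cases (n.+1%:R * (y - a)).
move: hn; rewrite -(ler_pM2l n0) divff ?gt_eqF// => hn.
rewrite indicE mem_setE in_itv/=.
move: ya; rewrite neq_lt => /orP[ya|ay].
- rewrite ltW//= subrr (h1 _).2//.
  by move: hn; rewrite ltr0_norm ?subr_lt0// mulrN => hn; rewrite lerNr.
- rewrite leNgt ay/= subr0 (h4 _).2//.
  by move: hn; rewrite gtr0_norm ?subr_gt0.
Unshelve. all: by end_near. Qed.

(** A single ramp equals 1 near +oo and is no test function; in the difference of two the constants
    cancel. *)
Lemma ramp_diff_C1c n (a b : R) : C1c (fun x => ramp_at n a x - ramp_at n b x).
Proof.
have d x := is_derive1B (is_derive_ramp_at n a x) (is_derive_ramp_at n b x).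
split.
- by move=> x; exact: is_derive1_derivable (d x).
- rewrite (is_derive1_fun d) => x.
  by apply: cvgB; exact: tent_at_continuous.
- exists (`|a| + `|b| + 1) => x hx.
  have n1 : 1 <= (n.+1%:R : R) by rewrite ler1n.
  rewrite /ramp_at.
  have [a1 _ _ a4] := tent_cases (n.+1%:R * (x - a)).
  have [b1 _ _ b4] := tent_cases (n.+1%:R * (x - b)).
  have [x0|x0] := leP 0 x.
    rewrite (a4 _).2 ?(b4 _).2 ?subrr//.
    + rewrite -[leLHS]mul1r ler_pM //; move: hx; rewrite (ger0_norm x0); have := ler_norm b; have := normr_ge0 a; lra.
    + rewrite -[leLHS]mul1r ler_pM //; move: hx; rewrite (ger0_norm x0); have := ler_norm a; have := normr_ge0 b; lra.
  move: hx; rewrite (ltr0_norm x0) => hx.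
  have ha := ler_norm (- a); have hb := ler_norm (- b); rewrite !normrN in ha hb.
  have ha0 := normr_ge0 a; have hb0 := normr_ge0 b.
  rewrite (a1 _).2 ?(b1 _).2 ?subrr//.
  + rewrite lerNr -mulrN -[leLHS]mul1r ler_pM //; lra.
  + rewrite lerNr -mulrN -[leLHS]mul1r ler_pM //; lra.
Qed.

(** In the limit of the test functions [ramp_at n a - ramp_at n b], the side of [g] becomes a
    difference of Dirac masses and the side of [h] an integral between the two points. *)
Lemma weak_derivative_lebesgue g h a b : L1 g -> L1 h -> weak_derivative g h ->
  lebesgue_pt g a -> lebesgue_pt g b -> g a - g b = prim h a - prim h b.
Proof.
move=> hg hh w la lb.
have mb n c : L1 (fun x => ramp_at n c x * h x).
  apply: (@L1M_bounded _ 1) => //.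
    apply: continuous_measurable_fun => x; exact: is_derive1_continuous (is_derive_ramp_at n c x).
  by move=> x; have [_ /andP[h1 h2] _] := tent_bounds (n.+1%:R * (x - c)); rewrite ger0_norm.
have mt n c : L1 (fun x => tent_at n c x * g x).
  apply: (@L1M_bounded _ n.+1%:R) => //.
    by apply: continuous_measurable_fun; exact: tent_at_continuous.
  by move=> x; have /andP[h1 h2] := tent_at_ge0 n c x; rewrite ger0_norm.
have E n : \int[mu]_x (tent_at n a x * g x) - \int[mu]_x (tent_at n b x * g x) =
   - (\int[mu]_x (ramp_at n a x * h x) - \int[mu]_x (ramp_at n b x * h x)).
  have d x := is_derive1B (is_derive_ramp_at n a x) (is_derive_ramp_at n b x).
  have := w _ (ramp_diff_C1c n a b).
  rewrite (is_derive1_fun d) -!int_B// => e.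
  transitivity (\int[mu]_x (g x * (tent_at n a x - tent_at n b x))).
    by apply: eq_Rintegral => x _; rewrite mulrBr ![g x * _]mulrC.
  rewrite e; congr (- _).
  by apply: eq_Rintegral => x _; rewrite mulrBr ![h x * _]mulrC.
have l1 : \int[mu]_x (tent_at n a x * g x) - \int[mu]_x (tent_at n b x * g x)
    @[n --> \oo] --> g a - g b.
  by apply: cvgB; exact: tent_at_cvg.
have l2 : - (\int[mu]_x (ramp_at n a x * h x) - \int[mu]_x (ramp_at n b x * h x))
    @[n --> \oo] --> - (\int[mu]_x h x - prim h a - (\int[mu]_x h x - prim h b)).
  by apply: cvgN; apply: cvgB; exact: ramp_at_cvg.
rewrite (_ : prim h a - prim h b = - (\int[mu]_x h x - prim h a - (\int[mu]_x h x - prim h b))); last by ring.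
apply: (cvg_unique _ l1 _) => //.
by apply: cvg_trans l2; apply: near_eq_cvg; apply: nearW => n; rewrite E.
Qed.

End TestFunctions.

(** * The space W^{oo,1}: weak and classical derivatives agree *)

Section Sobolev.
Context {R : realType}.
Local Notation mu := (@lebesgue_measure R).
Implicit Types (f g h : R -> R).

Lemma L1_locally_integrable f : L1 f -> locally_integrable [set: R] f.
Proof. by move=> hf; apply: open_integrable_locally => //; exact: openT. Qed.

Lemma ae_ex (P : R -> Prop) : {ae mu, forall y, P y} -> exists y, P y.
Proof.
move=> [N [mN N0 subN]]; apply: contrapT => /forallNP nP.
have : (mu `[0%R, 1%R] <= mu N)%E.
  by apply: le_measure; rewrite ?inE// => y _; apply: subN => /=.
rewrite N0 lebesgue_measure_itv /= lte_fin ltr01 oppr0 adde0 lee_fin.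
by rewrite leNgt ltr01.
Qed.

Lemma ae_int_eq f g : measurable_fun setT f -> measurable_fun setT g ->
  {ae mu, forall y, f y = g y} -> \int[mu]_x f x = \int[mu]_x g x.
Proof.
move=> mf mg fg; rewrite /Rintegral; congr fine.
apply: ae_eq_integral => //; [exact/measurable_EFinP|exact/measurable_EFinP|].
by apply: ae_mono fg _ => y -> _.
Qed.

Lemma ae_L1 f g : L1 f -> measurable_fun setT g ->
  {ae mu, forall y, f y = g y} -> L1 g.
Proof.
move=> hf mg fg; apply/integrableP; split; first exact/measurable_EFinP.
have /integrableP[mf] := hf; congr (_ < _)%E.
apply: ae_eq_integral => //.
- exact: measurableT_comp.
- by apply: measurableT_comp => //; exact/measurable_EFinP.
- by apply: ae_mono fg _ => y /= -> _.
Qed.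

Lemma weak_derivative_prim g h : L1 g -> L1 h -> weak_derivative g h ->
  exists c : R, {ae mu, forall x, g x = c + prim h x}.
Proof.
move=> hg hh w.
have ae := lebesgue_differentiation (L1_locally_integrable hg).
have [a la] := ae_ex ae; exists (g a - prim h a).
apply: ae_mono ae _ => x lx.
have := weak_derivative_lebesgue hg hh w lx la; lra.
Qed.

Lemma weak_derivative_continuous f g : continuous f -> L1 f -> L1 g ->
  weak_derivative f g -> exists c : R, forall x, f x = c + prim g x.
Proof.
move=> cf hf hg w; exists (f 0 - prim g 0) => x.
have lp y : lebesgue_pt f y.
  apply: (@continuous_lebesgue_pt _ f y setT) => //.
  - exact: open_nbhsT.
  - exact: continuous_measurable_fun.
  - exact: cf.
by have := weak_derivative_lebesgue hf hg w (lp x) (lp 0); lra.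
Qed.

Lemma ae_prim g h : {ae mu, forall x, g x = h x} -> L1 g -> L1 h -> prim g = prim h.
Proof.
move=> gh hg hh; apply/funext => x; rewrite !prim_indic; apply: ae_int_eq.
- by apply: L1_measurable; exact: L1_indic.
- by apply: L1_measurable; exact: L1_indic.
- by apply: ae_mono gh _ => y ->.
Qed.

Lemma prim_ae_derive h : L1 h -> {ae mu, forall x : R, is_derive x 1 (prim h) (h x)}.
Proof.
move=> hh; have := FTC1Ny (fun y => L1S (measurable_itv _) hh) (L1_locally_integrable hh).
move=> ae; apply: ae_mono ae _ => x [d e].
by rewrite -[h x]e derive1E; exact: derivableP.
Qed.

Lemma sobolev1_ae k f g : sobolev1 k f -> measurable_fun setT g ->
  {ae mu, forall y, f y = g y} -> sobolev1 k g.
Proof.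
case: k => [|k] /= [hf H] mg fg; split => //; try exact: (ae_L1 hf).
have [g' w s] := H; exists g' => // eta heta; rewrite -w//.
have [_ c _] := heta.
apply: ae_int_eq.
- apply: measurable_funM => //; exact: continuous_measurable_fun.
- apply: measurable_funM => //; first exact: L1_measurable.
  exact: continuous_measurable_fun.
- by apply: ae_mono fg _ => y ->.
Qed.

Lemma sobolev1_L1 k f : sobolev1 k f -> L1 f.
Proof. by case: k => [|k] []. Qed.

(** Two weak derivatives are spent to gain one classical derivative: the second makes the first a.e.
    equal to the continuous function [G], and [f], a primitive of the first, is then a primitive of
    [G]. *)
Lemma Winf1_step f : Winf1 f -> (forall x, derivable f x 1) /\ Winf1 (derive1 f).
Proof.
move=> [cf sf].
have [hf [g w [hg [h wh sh]]]] := sf 2%N.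
have hh : L1 h by case: sh.
have [c gc] := weak_derivative_prim hg hh wh.
pose G x := c + prim h x.
have cG : continuous G.
  by move=> x; apply: cvgD; [exact: cvg_cst|exact: prim_continuous].
have mG := continuous_measurable_fun cG.
have hG : L1 G by exact: (ae_L1 hg).
have [d fd] := weak_derivative_continuous cf hf hg w.
have df (x : R) : is_derive x 1 f (G x).
  apply: is_derive1_eq (is_derive1D (is_derive1_cst d x) (prim_derive hG (cG x))) _ _.
  - by move=> y; rewrite fd (ae_prim gc hg hG).
  - by rewrite add0r.
have e : derive1 f = G by apply/funext => x; exact: is_derive1_derive1.
rewrite e; split; first by move=> x; exact: is_derive1_derivable (df x).
split => // k.
(* Each order comes with its own weak derivative [gk]. All are a.e. equal to [G], because [f] is up
   to a constant a primitive of each, and a primitive is a.e. differentiable. *)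
have [_ [gk wk sk]] := sf k.+1.
have hk := sobolev1_L1 sk.
apply: (sobolev1_ae sk mG).
have [dk fk] := weak_derivative_continuous cf hf hk wk.
apply: ae_mono (prim_ae_derive hk) _ => x dx.
rewrite -(is_derive1_derive1 dx) -(is_derive1_derive1 (df x)).
apply: (@is_derive1_derive1 _ _ _ _); apply: is_derive1_eq (is_derive1B (df x) (is_derive1_cst dk x)) _ _.
- by move=> y; rewrite fk addrC addKr.
- by rewrite subr0 e.
Qed.

Definition nice f := forall k,
  (forall x, derivable (derive1n k f) x 1) /\ L1 (derive1n k f).

Lemma derive1nSr k f : derive1n k (derive1 f) = derive1n k.+1 f.
Proof. by rewrite /derive1n -iterSr. Qed.

Lemma Winf1_nice f : Winf1 f -> nice f.
Proof.
move=> hf k; elim: k f hf => [|k IH] f hf.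
  have [d _] := Winf1_step hf; split => //.
  exact: (sobolev1_L1 (hf.2 0%N)).
have [_ hf'] := Winf1_step hf.
by have := IH _ hf'; rewrite derive1nSr.
Qed.

Lemma nice_derive f : nice f -> nice (derive1 f).
Proof. by move=> hf k; rewrite derive1nSr. Qed.

Lemma nice_is_derive f k (x : R) : nice f -> is_derive x 1 (derive1n k f) (derive1n k.+1 f x).
Proof. by move=> hf; have := derivable_is_derive1 ((hf k).1 x). Qed.

Lemma nice_continuous f k : nice f -> continuous (derive1n k f).
Proof. by move=> hf x; exact: is_derive1_continuous (nice_is_derive k x hf). Qed.

Lemma nice_L1 f k : nice f -> L1 (derive1n k f).
Proof. by move=> /(_ k)[]. Qed.

Lemma nice_weak_derivative f : nice f -> weak_derivative f (derive1 f).
Proof.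
move=> hf eta [de ce [M hM]].
have c0 := nice_continuous (k := 0) hf; have c1 := nice_continuous (k := 1) hf.
have d0 x := nice_is_derive 0 x hf.
have dE (x : R) : is_derive x 1 eta (derive1 eta x) by exact: derivable_is_derive1.
have d x := is_derive1M (d0 x) (dE x).
have cE : continuous eta by move=> x; exact: is_derive1_continuous (dE x).
pose N : R := `|M| + 1.
have N0 : 0 < N by rewrite ltr_wpDl.
have outN (x : R) : x \notin `[- N, N] -> M < `|x|.
  rewrite in_itv /= -ler_norml -ltNge; apply: le_lt_trans.
  by rewrite /N (le_trans (ler_norm _)) // lerDl.
have eta0 (x : R) : x \notin `[- N, N] -> eta x = 0 by move/outN/hM.
have deta0 (x : R) : x \notin `[- N, N] -> derive1 eta x = 0.
  move=> /outN hx; apply: is_derive1_derive1.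
  apply: is_derive1_near (is_derive1_cst 0 x).
  have : \forall y \near x, M < `|y|.
    by apply: (cvgr_gt _ (@norm_continuous R R^o x)); exact: hx.
  by apply: filterS => y /hM.
have cc1 : continuous (fun x => f x * derive1 eta x).
  by move=> x; apply: cvgM; [exact: c0|exact: ce].
have cc2 : continuous (fun x => derive1 f x * eta x).
  by move=> x; apply: cvgM; [exact: c1|exact: cE].
have s1 (x : R) : x \notin `[- N, N] -> f x * derive1 eta x = 0 by move=> hx; rewrite deta0 // mulr0.
have s2 (x : R) : x \notin `[- N, N] -> derive1 f x * eta x = 0 by move=> hx; rewrite eta0 // mulr0.
apply/eqP; rewrite -addr_eq0 -int_D; [|exact: L1_support s1|exact: L1_support s2].
rewrite (@int_support _ _ (- N) N); last first.
  by move=> x hx; rewrite s1 // s2 // addr0.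
have := @int_FTC _ _ _ (- N) N _ d.
rewrite (_ : (fun x => _) = (fun x => f x * derive1 eta x + derive1 f x * eta x)); last first.
  by apply/funext => x /=; rewrite [eta x * _]mulrC.
move=> ->; last 2 first.
- by rewrite ge0_cp // ltW.
- by move=> x; apply: cvgD; [exact: cc1|exact: cc2].
have e0 (x : R) : N <= `|x| -> eta x = 0.
  by move=> hx; apply: hM; rewrite (lt_le_trans _ hx) // /N ltr_pwDr // ler_norm.
by rewrite !e0 ?mulr0 ?subrr // ?normrN ger0_norm // ltW.
Qed.

Lemma nice_Winf1 f : nice f -> Winf1 f.
Proof.
move=> hf; split; first exact: (nice_continuous (k := 0) hf).
move=> k; elim: k f hf => [|k IH] f hf /=.
  by split => //; exact: (nice_L1 0 hf).
split; first exact: (nice_L1 0 hf).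
by exists (derive1 f); [exact: nice_weak_derivative|exact/IH/nice_derive].
Qed.

End Sobolev.

(** * Smooth functions and decay at infinity *)

Section Decay.
Context {R : realType}.
Local Notation mu := (@lebesgue_measure R).
Implicit Types (f g h u v : R -> R).

Lemma primB h (a b : R) : L1 h -> a <= b -> prim h b - prim h a = \int[mu]_(x in `]a, b]) h x.
Proof.
move=> hh ab; rewrite /prim Rintegral_itvB//; first exact: L1S.
Qed.

Lemma prim_repr f (df : R -> R) : (forall x : R, is_derive x 1 f (df x)) ->
  continuous df -> L1 df -> forall x y, f x - f y = prim df x - prim df y.
Proof.
move=> d c i x y.
have h0 (z : R) : is_derive z 1 (fun y => f y - prim df y) 0.
  by apply: is_derive1_eq (is_derive1B (d z) (prim_derive i (c z))) _ _ => //; rewrite subrr.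
have := @is_derive_0_is_cst R (fun y => f y - prim df y) x y h0; lra.
Qed.

Lemma prim_repr0 f (df : R -> R) : (forall x : R, is_derive x 1 f (df x)) ->
  continuous df -> L1 df -> f x @[x --> -oo] --> (0 : R) -> f = prim df.
Proof.
move=> d c i f0; apply/funext => x.
have e : (fun y => f y - prim df y) = cst (f x - prim df x).
  by apply/funext => y /=; have := prim_repr d c i x y; lra.
have l1 : f y - prim df y @[y --> -oo] --> (0 - 0 : R) by apply: cvgB => //; exact: prim_Ny.
rewrite e subr0 in l1.
have /subr0_eq : f x - prim df x = 0 by apply: (cvg_unique _ (cvg_cst _) l1).
by [].
Qed.

(** Vanishing at -oo makes [f] the primitive of its derivative. This inequality is what converts L^1
    seminorms into uniform bounds. *)
Lemma sup_bound f (df : R -> R) : (forall x : R, is_derive x 1 f (df x)) ->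
  continuous df -> L1 df -> f x @[x --> -oo] --> (0 : R) ->
  forall x, `|f x| <= \int[mu]_y `|df y|.
Proof. by move=> d c i f0 x; rewrite (prim_repr0 d c i f0) prim_le_norm. Qed.

(** Compare [f x] with [f y] for [y] in the unit interval after [x], where they differ by at most
    the integral of [|df|], and average over [y]. *)
Lemma L1_local_bound f (df : R -> R) (x : R) : (forall x : R, is_derive x 1 f (df x)) ->
  continuous df -> L1 df -> L1 f ->
  `|f x| <= \int[mu]_(y in `]x, (x + 1)]) (`|f y| + `|df y|).
Proof.
move=> d c i jf.
have x1 : x <= x + 1 by rewrite lerDl.
have m1 : lebesgue_measure (`]x, (x + 1)]%classic : set R) = 1%:E.
  by rewrite lebesgue_measure_itv /= lte_fin ltrDl ltr01 -EFinB addrAC subrr add0r.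
have cst1 (c0 : R) : \int[mu]_(y in `]x, (x + 1)]) c0 = c0.
  by rewrite Rintegral_cst//= [X in fine X]m1 mulr1.
pose D := \int[mu]_(y in `]x, (x + 1)]) `|df y|.
have D_ y : y \in `]x, (x + 1)] -> `|f x| <= `|f y| + D.
  rewrite in_itv /= => /andP[xy yx1].
  have e : f x = f y - (prim df y - prim df x) by have := prim_repr d c i x y; lra.
  rewrite {1}e (le_trans (ler_normB _ _))// lerD2l primB //; last exact: ltW.
  apply: (le_trans (le_normr_Rintegral _ _)) => //; first exact: L1S.
  rewrite /D int_indic // [leRHS]int_indic //; apply: int_le.
  - by apply: L1_indic => //; exact: L1_norm.
  - by apply: L1_indic => //; exact: L1_norm.
  move=> z; apply: ler_wpM2r => //; rewrite !indicE !mem_setE !in_itv /= ler_nat.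
  by case: (x < z) => //=; case: leP => // zy; rewrite (le_trans zy yx1).
have -> : `|f x| = \int[mu]_(y in `]x, (x + 1)]) `|f x|.
  by rewrite cst1.
have iF : mu.-integrable `]x, (x + 1)] (EFin \o (fun y => `|f y|)) by apply: L1S => //; exact: L1_norm.
have iD : mu.-integrable `]x, (x + 1)] (EFin \o (fun y => `|df y|)) by apply: L1S => //; exact: L1_norm.
have icst (r : R) : mu.-integrable `]x, (x + 1)] (EFin \o (fun=> r)).
  apply/integrableP; split; first exact: measurable_cst.
  by rewrite integral_cst //= [X in (_ * X)%E]m1 mule1 ltry.
rewrite RintegralD // -/D.
have -> : D = \int[mu]_(y in `]x, (x + 1)]) D by rewrite cst1.
rewrite -RintegralD //; apply: le_Rintegral => //.
- exact: (integrableD _ iF (icst D)).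
Qed.

(** The local bound is an increment over length 1 of the primitive of [|f| + |df|]; that primitive
    has finite limits at both ends, so its increments tend to 0. *)
Lemma L1_cvg0 f (df : R -> R) : (forall x : R, is_derive x 1 f (df x)) ->
  continuous df -> L1 df -> L1 f ->
  f x @[x --> -oo] --> (0 : R) /\ f x @[x --> +oo] --> (0 : R).
Proof.
move=> d c i jf.
pose w y := `|f y| + `|df y|.
have iw : L1 w by apply: L1D; exact: L1_norm.
have b x : `|f x| <= prim w (x + 1) - prim w x.
  by rewrite primB ?lerDl //; exact: L1_local_bound.
split; apply: norm_cvg0; apply: (@squeeze_cvgr _ _ _ _ (cst 0) (fun x => prim w (x + 1) - prim w x)).
- by apply: nearW => x; rewrite normr_ge0 b.
- exact: cvg_cst.
- rewrite -[X in _ --> X](subrr (0 : R)); apply: cvgB; last exact: prim_Ny.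
  apply: (cvg_comp _ (prim w)); last exact: prim_Ny.
  by apply/cvgrNyPlt => M; near=> x; rewrite -ltrBrDr; near: x; by apply: nbhs_ninfty_lt; rewrite num_real.
- by apply: nearW => x; rewrite normr_ge0 b.
- exact: cvg_cst.
- rewrite -[X in _ --> X](subrr (\int[mu]_y w y)); apply: cvgB; last exact: prim_y.
  apply: (cvg_comp _ (prim w)); last exact: prim_y.
  by apply/cvgryPgt => M; near=> x; rewrite -ltrBlDr; near: x; by apply: nbhs_pinfty_gt; rewrite num_real.
Unshelve. all: by end_near. Qed.

Lemma nice_cvg0 f : nice f -> f x @[x --> -oo] --> (0 : R) /\ f x @[x --> +oo] --> (0 : R).
Proof.
move=> hf; apply: (L1_cvg0 (fun x => nice_is_derive 0 x hf)).
- exact: (nice_continuous (k := 1) hf).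
- exact: (nice_L1 1 hf).
- exact: (nice_L1 0 hf).
Qed.

Lemma nice_bound f x : nice f -> `|f x| <= \int[mu]_y `|derive1 f y|.
Proof.
move=> hf; apply: (sup_bound (fun x => nice_is_derive 0 x hf)).
- exact: (nice_continuous (k := 1) hf).
- exact: (nice_L1 1 hf).
- by have [] := nice_cvg0 hf.
Qed.

End Decay.

(** * Closure properties of smooth functions and of the Lie algebra *)

Section Smooth.
Context {R : realType}.
Local Notation mu := (@lebesgue_measure R).
Implicit Types (f g h u v : R -> R) (B C : (R -> R) -> Prop).

(** A finite-order form of the statement that all derivatives satisfy [B], suited to induction on
    the order while the function varies. *)
Fixpoint jet B (n : nat) f : Prop :=
  B f /\ if n is n'.+1 then jet B n' (derive1 f) else True.

Lemma jetP B f : (forall n, jet B n f) <-> forall k, B (derive1n k f).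
Proof.
split => [h k|h n].
  have : forall n m f, jet B (n + m)%N f -> jet B m (derive1n n f).
    elim=> [|n IH] m g //= [_ /IH].
    by rewrite derive1nSr.
  by move=> /(_ k 0%N f); rewrite addn0 => /(_ (h k))[].
elim: n f h => [|n IH] f h /=; first by split => //; exact: (h 0%N).
by split; [exact: (h 0%N)|apply: IH => k; rewrite derive1nSr].
Qed.

Definition der f := forall x, derivable f x 1.

Lemma derive1_D f g : der f -> der g ->
  derive1 (fun x => f x + g x) = fun x => derive1 f x + derive1 g x.
Proof.
by move=> df dg; apply: is_derive1_fun => x; apply: is_derive1D; exact: derivable_is_derive1.
Qed.

Lemma derive1_Z (c : R) f : der f ->
  derive1 (fun x => c * f x) = fun x => c * derive1 f x.
Proof.
by move=> df; apply: is_derive1_fun => x; apply: is_derive1Z; exact: derivable_is_derive1.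
Qed.

Lemma derive1_M f g : der f -> der g ->
  derive1 (fun x => f x * g x) = fun x => f x * derive1 g x + derive1 f x * g x.
Proof.
move=> df dg; apply: is_derive1_fun => x.
rewrite [derive1 f x * _]mulrC.
by apply: is_derive1M; exact: derivable_is_derive1.
Qed.

Lemma jetD B n f g : (forall f, B f -> der f) ->
  (forall f g, B f -> B g -> B (fun x => f x + g x)) ->
  jet B n f -> jet B n g -> jet B n (fun x => f x + g x).
Proof.
move=> Bd BD; elim: n f g => [|n IH] f g /=; first by move=> [bf _] [bg _]; split => //; exact: BD.
move=> [bf jf] [bg jg]; split; first exact: BD.
by rewrite derive1_D; [exact: IH|exact: Bd|exact: Bd].
Qed.

Lemma jetZ B n (c : R) f : (forall f, B f -> der f) ->
  (forall f, B f -> B (fun x => c * f x)) ->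
  jet B n f -> jet B n (fun x => c * f x).
Proof.
move=> Bd BZ; elim: n f => [|n IH] f /=; first by move=> [bf _]; split => //; exact: BZ.
move=> [bf jf]; split; first exact: BZ.
by rewrite derive1_Z; [exact: IH|exact: Bd].
Qed.

(** The Leibniz rule turns the derivative of a product into a sum of products of the same two kinds,
    so [B] need only be stable under sums and contain the products of [C] by [D]. *)
Lemma jetM B C D n f g : (forall f, B f -> der f) ->
  (forall f g, B f -> B g -> B (fun x => f x + g x)) ->
  (forall f, C f -> der f /\ C (derive1 f)) ->
  (forall f, D f -> der f /\ D (derive1 f)) ->
  (forall f g, C f -> D g -> B (fun x => f x * g x)) ->
  C f -> D g -> jet B n (fun x => f x * g x).
Proof.
move=> Bd BD Cd Dd BM; elim: n f g => [|n IH] f g hf hg /=.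
  by split => //; exact: BM.
have [df cf] := Cd _ hf; have [dg cg] := Dd _ hg.
split; first exact: BM.
by rewrite derive1_M //; apply: jetD => //; exact: IH.
Qed.

Definition smooth f := forall k, der (derive1n k f).

Lemma derD f g : der f -> der g -> der (fun x => f x + g x).
Proof. by move=> df dg x; exact: derivableD (df x) (dg x). Qed.

Lemma derZ (c : R) f : der f -> der (fun x => c * f x).
Proof.
move=> df x; apply: is_derive1_derivable (is_derive1Z c (derivable_is_derive1 (df x))).
Qed.

Lemma derM f g : der f -> der g -> der (fun x => f x * g x).
Proof. by move=> df dg x; exact: derivableM (df x) (dg x). Qed.

Lemma smooth_derive f : smooth f -> der f /\ smooth (derive1 f).
Proof. by move=> h; split; [exact: (h 0%N)|move=> k; rewrite derive1nSr]. Qed.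

Lemma smoothM f g : smooth f -> smooth g -> smooth (fun x => f x * g x).
Proof.
move=> hf hg; apply/jetP => n.
apply: (@jetM der smooth smooth n f g _ _ _ _ _ hf hg);
  [by move=> ?|exact: derD|exact: smooth_derive|exact: smooth_derive|].
by move=> f' g' /smooth_derive[df _] /smooth_derive[dg _]; exact: derM.
Qed.

Lemma smoothD f g : smooth f -> smooth g -> smooth (fun x => f x + g x).
Proof.
move=> hf hg; apply/jetP => n.
apply: (@jetD der n f g _ _ ((jetP der f).2 hf n) ((jetP der g).2 hg n)).
- by move=> ?.
- exact: derD.
Qed.

Lemma smoothZ (c : R) f : smooth f -> smooth (fun x => c * f x).
Proof.
move=> hf; apply/jetP => n.
apply: (@jetZ der n c f _ _ ((jetP der f).2 hf n)); first by move=> ?.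
exact: derZ.
Qed.

Lemma smooth_is_derive f k (x : R) : smooth f -> is_derive x 1 (derive1n k f) (derive1n k.+1 f x).
Proof. by move=> hf; have := derivable_is_derive1 (hf k x). Qed.

Lemma smooth_continuous f k : smooth f -> continuous (derive1n k f).
Proof. by move=> hf x; exact: is_derive1_continuous (smooth_is_derive k x hf). Qed.

Lemma derive1nD k f g : smooth f -> smooth g ->
  derive1n k (fun x => f x + g x) = fun x => derive1n k f x + derive1n k g x.
Proof.
elim: k f g => [|k IH] f g hf hg //.
have [df sf] := smooth_derive hf; have [dg sg] := smooth_derive hg.
by rewrite -!derive1nSr derive1_D // IH.
Qed.

Lemma derive1nZ k (c : R) f : smooth f ->
  derive1n k (fun x => c * f x) = fun x => c * derive1n k f x.
Proof.
elim: k f => [|k IH] f hf //.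
have [df sf] := smooth_derive hf.
by rewrite -!derive1nSr derive1_Z // IH.
Qed.

Lemma nice_smooth f : nice f -> smooth f.
Proof. by move=> h k; have [] := h k. Qed.

Lemma nice_der f : nice f -> der f /\ nice (derive1 f).
Proof. by move=> h; split; [exact: (h 0%N).1|exact: nice_derive]. Qed.

Lemma niceD f g : nice f -> nice g -> nice (fun x => f x + g x).
Proof.
move=> hf hg; apply/(jetP (fun f => der f /\ L1 f)) => n; apply: jetD.
- by move=> ? [].
- by move=> ? ? [? ?] [? ?]; split; [exact: derD|exact: L1D].
- exact: (jetP (fun f => der f /\ L1 f) _).2.
- exact: (jetP (fun f => der f /\ L1 f) _).2.
Qed.

Lemma niceZ (c : R) f : nice f -> nice (fun x => c * f x).
Proof.
move=> hf; apply/(jetP (fun f => der f /\ L1 f)) => n; apply: jetZ.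
- by move=> ? [].
- by move=> ? [? ?]; split; [exact: derZ|exact: L1Z].
- exact: (jetP (fun f => der f /\ L1 f) _).2.
Qed.

Lemma niceM f g : nice f -> nice g -> nice (fun x => f x * g x).
Proof.
move=> hf hg; apply/(jetP (fun f => der f /\ L1 f)) => n.
apply: (jetM (C := nice) (D := nice)) => //.
- by move=> ? [].
- by move=> ? ? [? ?] [? ?]; split; [exact: derD|exact: L1D].
- exact: nice_der.
- exact: nice_der.
move=> f1 g1 h1 h2; split; first by apply: derM; [case: (nice_der h1)|case: (nice_der h2)].
apply: (@L1M_bounded _ (\int[mu]_y `|derive1 f1 y|)).
- by apply: continuous_measurable_fun; exact: (nice_continuous (k := 0) h1).
- by move=> x; exact: nice_bound.
- exact: (nice_L1 0 h2).
Qed.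

Lemma gminf_nice u : gminf u -> [/\ smooth u, nice (derive1 u) & u x @[x --> -oo] --> (0 : R)].
Proof.
move=> [d w l]; have n := Winf1_nice w; split; [|exact: n|exact: l].
by case => [|k]; [exact: d|rewrite -derive1nSr; exact: nice_smooth].
Qed.

Lemma nice_gminf u : smooth u -> nice (derive1 u) -> u x @[x --> -oo] --> (0 : R) -> gminf u.
Proof. by move=> s n l; split => //; [exact: (s 0%N)|exact: nice_Winf1]. Qed.

Lemma gminfL1 u k : gminf u -> L1 (derive1n k.+1 u).
Proof. by move=> /gminf_nice[_ n _]; rewrite -derive1nSr; exact: nice_L1. Qed.

Lemma gminf_Ny u k : gminf u -> derive1n k u x @[x --> -oo] --> (0 : R).
Proof.
move=> /gminf_nice[_ n l]; case: k => [//|k].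
rewrite -derive1nSr; have nk : nice (derive1n k (derive1 u)).
  by elim: k => [|k IH] //; exact: nice_derive.
by have [] := nice_cvg0 nk.
Qed.

Lemma gminf_bound u k x : gminf u -> `|derive1n k u x| <= \int[mu]_y `|derive1n k.+1 u y|.
Proof.
move=> hu; have [s n l] := gminf_nice hu.
apply: (sup_bound (fun x => smooth_is_derive k x s)).
- exact: smooth_continuous.
- exact: gminfL1.
- exact: gminf_Ny.
Qed.

Lemma gminfD u v : gminf u -> gminf v -> gminf (fun x => u x + v x).
Proof.
move=> /gminf_nice[su nu lu] /gminf_nice[sv nv lv]; apply: nice_gminf.
- exact: smoothD.
- by rewrite derive1_D; [exact: niceD|exact: (su 0%N)|exact: (sv 0%N)].
- by rewrite -[X in _ --> X](addr0 (0 : R)); exact: cvgD.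
Qed.

Lemma gminfZ (c : R) u : gminf u -> gminf (fun x => c * u x).
Proof.
move=> /gminf_nice[su nu lu]; apply: nice_gminf.
- exact: smoothZ.
- by rewrite derive1_Z; [exact: niceZ|exact: (su 0%N)].
- by rewrite -[X in _ --> X](mulr0 c); exact: cvgMl_tmp.
Qed.

Lemma nice_prim_gminf h : nice h -> gminf (prim h) /\ derive1 (prim h) = h.
Proof.
move=> hh; have L := nice_L1 0 hh; have c := nice_continuous (k := 0) hh.
have d (x : R) : is_derive x 1 (prim h) (h x) by apply: prim_derive => //; exact: c.
have e : derive1 (prim h) = h by apply: is_derive1_fun.
split=> //; apply: nice_gminf.
- by case=> [x|k]; [exact: is_derive1_derivable (d x)|rewrite -derive1nSr e; exact: nice_smooth].
- by rewrite e.
- exact: prim_Ny.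
Qed.

(** This is the expression whose seminorms define [curve_derivative]; as it stays in [gminf], the
    sup-norm bound applies to it. *)
Lemma gminf_quotient (f h w : R -> R) (q : R) : gminf f -> gminf h -> gminf w ->
  gminf (fun x => q * (f x - h x) - w x) /\
  forall k, derive1n k (fun x => q * (f x - h x) - w x) =
    fun x => q * (derive1n k f x - derive1n k h x) - derive1n k w x.
Proof.
move=> gf gh gw.
have -> : (fun x => q * (f x - h x) - w x) = fun x => q * (f x + (-1) * h x) + (-1) * w x.
  by apply/funext => x; rewrite !mulN1r.
have g1 : gminf (fun x => f x + (-1) * h x) by apply: gminfD => //; exact: gminfZ.
have g2 : gminf (fun x => q * (f x + (-1) * h x)) by exact: gminfZ.
split=> [|k]; first by apply: gminfD => //; exact: gminfZ.
have [s1 _ _] := gminf_nice gf; have [s2 _ _] := gminf_nice gh; have [s3 _ _] := gminf_nice gw.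
have s4 : smooth (fun x => (-1) * h x) by exact: smoothZ.
have s5 : smooth (fun x => (-1) * w x) by exact: smoothZ.
have s6 : smooth (fun x => f x + (-1) * h x) by exact: smoothD.
have s7 : smooth (fun x => q * (f x + (-1) * h x)) by exact: smoothZ.
rewrite (derive1nD k s7 s5) (derive1nZ k (-1) s3) (derive1nZ k q s6) (derive1nD k s1 s4).
by rewrite (derive1nZ k (-1) s2); apply/funext => x; rewrite !mulN1r.
Qed.

End Smooth.

(** * One-sided time derivatives *)

Section OneSided.
Context {R : realType}.
Local Notation mu := (@lebesgue_measure R).
Implicit Types (f g h : R -> R) (T t l : R).

Definition has_dt T f t l : Prop :=
  (s - t)^-1 * (f s - f t) @[s --> within `[0, T] t^'] --> l.

Lemma near_within_dnbhs T t (P : R -> Prop) :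
  (\forall s \near within `[0, T] t^', P s) <->
  exists2 d : R, 0 < d & forall s : R, `|s - t| < d -> s \in `[0, T] -> s != t -> P s.
Proof.
split.
  move=> [d /= d0 h]; exists d => // s st sT sneq.
  by apply: h => //=; rewrite distrC.
move=> [d d0 h]; exists d => //= s; rewrite /= distrC => st sneq sT.
exact: h.
Qed.

Lemma has_dt_derive T f h t l : t \in `[0, T] -> (forall s, s \in `[0, T] -> h s = f s) ->
  is_derive t 1 h l -> has_dt T f t l.
Proof.
move=> tT hf /is_derive1P dh.
have : (s - t)^-1 * (h s - h t) @[s --> within `[0, T] t^'] --> l.
  by apply: cvg_within_filter.
apply: cvg_trans; apply: near_eq_cvg; apply/near_within_dnbhs; exists 1 => // s _ sT _.
by rewrite !hf.
Qed.

(** Continuing [f] outside [0, T] by its tangent line at [t] produces a two-sided derivative at [t],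
    so every differentiation rule on the line transfers to one-sided time derivatives. *)
Lemma has_dt_ext T f t l : t \in `[0, T] -> has_dt T f t l ->
  exists h, is_derive t 1 h l /\ forall s, s \in `[0, T] -> h s = f s.
Proof.
move=> tT df; pose h s := if s \in `[0, T] then f s else f t + l * (s - t).
exists h; split; last by move=> s sT; rewrite /h sT.
apply/is_derive1P; apply/cvgrPdist_le => e e0.
move/cvgrPdist_le : df => /(_ _ e0)/near_within_dnbhs[d d0 H].
exists d => //= s /= ; rewrite distrC => sd st.
rewrite /h tT; case: ifPn => sT; first exact: H.
by rewrite addrAC subrr add0r mulrCA mulVf ?mulr1 ?subrr ?normr0 ?ltW// subr_eq0.
Qed.

(** Uniqueness of one-sided limits, hence the meaning of [Dt], rests on this: even at an end time
    there are other points of [0, T] arbitrarily close. *)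
Lemma within_dnbhs_proper T t : 0 < T -> t \in `[0, T] -> ProperFilter (within `[0, T] t^').
Proof.
move=> T0; rewrite in_itv /= => /andP[t0 tT]; apply: Build_ProperFilter_ex => P /near_within_dnbhs[d d0 H].
have [tT'|tT'] := ltP t T.
  pose e := Num.min (d / 2) (T - t).
  have e0 : 0 < e by rewrite lt_min divr_gt0 //= subr_gt0.
  have ed : e <= d / 2 by rewrite ge_min lexx.
  have eT : e <= T - t by rewrite ge_min lexx orbT.
  exists (t + e); apply: H; rewrite ?in_itv /=; first by rewrite addrAC subrr add0r gtr0_norm //; lra.
  - by apply/andP; split; lra.
  - by rewrite gt_eqF // ltrDl.
have {tT'} tE : t = T by lra.
pose e := Num.min (d / 2) T.
have e0 : 0 < e by rewrite lt_min divr_gt0.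
have ed : e <= d / 2 by rewrite ge_min lexx.
have eT : e <= T by rewrite ge_min lexx orbT.
exists (t - e); apply: H; rewrite ?in_itv /=.
- by rewrite addrAC subrr add0r normrN gtr0_norm //; lra.
- by apply/andP; split; lra.
- by rewrite lt_eqF // ltrBlDr ltrDl.
Qed.

Lemma has_dt_unique T f t (l l' : R) : 0 < T -> t \in `[0, T] ->
  has_dt T f t l -> has_dt T f t l' -> l = l'.
Proof.
move=> T0 tT h h'; have P := within_dnbhs_proper T0 tT.
exact: (cvg_unique _ h h').
Qed.

Lemma has_dt_Dt T (c : R -> R -> R) t x l : 0 < T -> t \in `[0, T] ->
  has_dt T (fun s => c s x) t l -> derivable_t T c t x /\ Dt T c t x = l.
Proof.
move=> T0 tT h; have P := within_dnbhs_proper T0 tT; split.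
  by apply/cvg_ex; exists l.
exact: cvg_lim h.
Qed.

Lemma derivable_t_has_dt T (c : R -> R -> R) t x :
  derivable_t T c t x -> has_dt T (fun s => c s x) t (Dt T c t x).
Proof. by move=> h; rewrite /has_dt. Qed.

Lemma has_dt_eq T f g t l l' : t \in `[0, T] -> has_dt T f t l ->
  (forall s, s \in `[0, T] -> f s = g s) -> l = l' -> has_dt T g t l'.
Proof.
move=> tT /(has_dt_ext tT)[h [dh hf]] fg <-; apply: (has_dt_derive tT _ dh) => s sT.
by rewrite hf // fg.
Qed.

Lemma has_dt_interior T f t l : t \in `]0, T[ -> has_dt T f t l -> is_derive t 1 f l.
Proof.
move=> tT df; have tT' : t \in `[0, T] by exact: subset_itv_oo_cc.
have [h [dh hf]] := has_dt_ext tT' df.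
apply: (is_derive1_near _ dh).
have : \forall s \near t, s \in `]0, T[ by exact: near_in_itvoo.
by apply: filterS => s sT; rewrite hf //; exact: subset_itv_oo_cc.
Qed.

Lemma has_dtD T f g t (a b : R) : t \in `[0, T] ->
  has_dt T f t a -> has_dt T g t b -> has_dt T (fun s => f s + g s) t (a + b).
Proof.
move=> tT /(has_dt_ext tT)[f' [df ff]] /(has_dt_ext tT)[g' [dg gg]].
by apply: (has_dt_derive tT _ (is_derive1D df dg)) => s sT; rewrite ff ?gg.
Qed.

Lemma has_dtB T f g t (a b : R) : t \in `[0, T] ->
  has_dt T f t a -> has_dt T g t b -> has_dt T (fun s => f s - g s) t (a - b).
Proof.
move=> tT /(has_dt_ext tT)[f' [df ff]] /(has_dt_ext tT)[g' [dg gg]].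
by apply: (has_dt_derive tT _ (is_derive1B df dg)) => s sT; rewrite ff ?gg.
Qed.

Lemma has_dtM T f g t (a b : R) : t \in `[0, T] ->
  has_dt T f t a -> has_dt T g t b -> has_dt T (fun s => f s * g s) t (f t * b + g t * a).
Proof.
move=> tT /(has_dt_ext tT)[f' [df ff]] /(has_dt_ext tT)[g' [dg gg]].
rewrite -(ff _ tT) -(gg _ tT).
by apply: (has_dt_derive tT _ (is_derive1M df dg)) => s sT; rewrite ff ?gg.
Qed.

Lemma has_dtV T f t (a : R) : t \in `[0, T] -> f t != 0 ->
  has_dt T f t a -> has_dt T (fun s => (f s)^-1) t (- a / f t ^+ 2).
Proof.
move=> tT ft /(has_dt_ext tT)[f' [df ff]].
rewrite -(ff _ tT) in ft *.
by apply: (has_dt_derive tT _ (is_derive1V ft df)) => s sT; rewrite ff.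
Qed.

Lemma has_dt_cst T t (c : R) : t \in `[0, T] -> has_dt T (fun=> c) t 0.
Proof. by move=> tT; apply: (has_dt_derive tT _ (is_derive1_cst c t)). Qed.

Lemma has_dtZ T f t (c a : R) : t \in `[0, T] ->
  has_dt T f t a -> has_dt T (fun s => c * f s) t (c * a).
Proof.
move=> tT /(has_dt_ext tT)[f' [df ff]].
by apply: (has_dt_derive tT _ (is_derive1Z c df)) => s sT; rewrite ff.
Qed.

Lemma has_dt_comp T f g t (a b : R) : t \in `[0, T] ->
  has_dt T f t a -> is_derive (f t) 1 g b -> has_dt T (fun s => g (f s)) t (b * a).
Proof.
move=> tT /(has_dt_ext tT)[f' [df ff]] dg.
rewrite -(ff _ tT) in dg.
by apply: (has_dt_derive tT _ (is_derive1_chain df dg)) => s sT; rewrite ff.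
Qed.

(** Freezing time outside [0, T] lets continuity be stated on the whole line or plane. *)
Definition clamp T t : R := if t < 0 then 0 else if T < t then T else t.

Lemma clamp_in T t : 0 < T -> clamp T t \in `[0, T].
Proof.
move=> T0; rewrite /clamp in_itv /=; case: ltP => h1; first by rewrite lexx ltW.
by case: ltP => h2; rewrite ?lexx ?h1 ?h2 ?ltW.
Qed.

Lemma clamp_id T t : t \in `[0, T] -> clamp T t = t.
Proof.
by rewrite in_itv /= /clamp => /andP[t0 tT]; rewrite ltNge t0 /= ltNge tT.
Qed.

Lemma clamp_lip T (s t : R) : 0 < T -> `|clamp T s - clamp T t| <= `|s - t|.
Proof.
move=> T0; have h1 := ler_norm (s - t); have h2 := ler_norm (t - s); rewrite distrC in h2.
rewrite ler_norml /clamp; case: (ltP s 0) => s0; case: (ltP t 0) => t0;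
 try case: (ltP T s) => sT; try case: (ltP T t) => tT; apply/andP; split; lra.
Qed.

Lemma clamp_continuous T : 0 < T -> continuous (clamp T).
Proof.
move=> T0 t; apply/cvgrPdist_le => e e0.
near=> s; apply: (le_trans (clamp_lip _ _ T0)).
by near: s; move/cvgrPdist_le : (@cvg_id _ (nbhs t)) => /(_ _ e0).
Unshelve. all: by end_near. Qed.

Lemma has_dt_continuous T f t l : 0 < T -> t \in `[0, T] -> has_dt T f t l ->
  {for t, continuous (fun s => f (clamp T s))}.
Proof.
move=> T0 tT /(has_dt_ext tT)[h [dh hf]].
rewrite (_ : (fun s => _) = h \o clamp T); last first.
  by apply/funext => s /=; rewrite hf // clamp_in.
apply: continuous_comp; first exact: clamp_continuous.
rewrite clamp_id //; exact: is_derive1_continuous dh.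
Qed.

Lemma has_dt_continuousT T f (df : R -> R) : 0 < T ->
  (forall t, t \in `[0, T] -> has_dt T f t (df t)) -> continuous (fun s => f (clamp T s)).
Proof.
move=> T0 h t; have c := has_dt_continuous T0 (clamp_in t T0) (h _ (clamp_in t T0)).
have := @continuous_comp _ _ _ (clamp T) (fun s => f (clamp T s)) t (clamp_continuous T0 (x := t)) c.
rewrite (_ : _ \o clamp T = (fun s => f (clamp T s))) //.
by apply/funext => s /=; rewrite (clamp_id (clamp_in s T0)).
Qed.

Lemma has_dt_MVT T f (df : R -> R) (a b : R) : 0 < T ->
  (forall t, t \in `[0, T] -> has_dt T f t (df t)) -> a \in `[0, T] -> b \in `[0, T] -> a <= b ->
  exists2 c, c \in `[a, b] & f b - f a = df c * (b - a).
Proof.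
move=> T0 h aT bT; rewrite le_eqVlt => /predU1P[<-|ab].
  by exists a; rewrite ?bound_itvE // !subrr mulr0.
have cc := has_dt_continuousT T0 h.
have cf : {within `[a, b], continuous (fun s => f (clamp T s))} by exact: within_itv_continuous.
have sub (x : R) : x \in `]a, b[ -> x \in `]0, T[.
  move: aT bT; rewrite !in_itv /= => /andP[a0 aT] /andP[b0 bT] /andP[ax xb].
  by rewrite (le_lt_trans a0 ax) (lt_le_trans xb bT).
have df' (x : R) : x \in `]a, b[ -> is_derive x 1 (fun s => f (clamp T s)) (df x).
  move=> xab; have xT := sub _ xab.
  have xT' := subset_itv_oo_cc xT.
  apply: (is_derive1_near _ (has_dt_interior xT (h _ xT'))).
  have : \forall s \near x, s \in `]0, T[ by exact: near_in_itvoo.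
  by apply: filterS => s sT; rewrite clamp_id //; exact: subset_itv_oo_cc.
have [c cab] := MVT ab df' cf; rewrite !clamp_id // => e.
by exists c => //; exact: subset_itv_oo_cc.
Qed.

Lemma has_dt0_cst T f : 0 < T -> (forall t, t \in `[0, T] -> has_dt T f t 0) ->
  forall t, t \in `[0, T] -> f t = f 0.
Proof.
move=> T0 h t tT; have z0 : 0 \in `[0, T] by rewrite bound_itvE ltW.
have t0 : 0 <= t by move: tT; rewrite in_itv /= => /andP[].
have [c _] := has_dt_MVT T0 h z0 tT t0.
by rewrite mul0r => /subr0_eq.
Qed.

Lemma interior_near T t (d : R) : 0 < T -> t \in `[0, T] -> 0 < d ->
  exists s, [/\ s \in `]0, T[, s != t & `|s - t| < d].
Proof.
move=> T0; rewrite in_itv /= => /andP[t0 tT] d0.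
have [tT'|tT'] := ltP t T.
  pose e := Num.min d (T - t).
  have e0 : 0 < e by rewrite lt_min d0 subr_gt0.
  have ed : e <= d by rewrite ge_min lexx.
  have eT : e <= T - t by rewrite ge_min lexx orbT.
  exists (t + e / 2); split.
  - by rewrite in_itv /=; apply/andP; split; lra.
  - by rewrite gt_eqF // ltrDl; lra.
  - by rewrite addrAC subrr add0r gtr0_norm; lra.
pose e := Num.min d T.
have e0 : 0 < e by rewrite lt_min d0.
have ed : e <= d by rewrite ge_min lexx.
have eT : e <= T by rewrite ge_min lexx orbT.
exists (t - e / 2); split.
- by rewrite in_itv /=; apply/andP; split; lra.
- by rewrite lt_eqF // ltrBlDr ltrDl; lra.
- by rewrite addrAC subrr add0r normrN gtr0_norm; lra.
Qed.

(* Where [z] has a zero with nonzero derivative the zero is isolated, and where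
   the derivative vanishes too so does [dz + c z^2]. *)
Lemma riccati_dense T (z dz : R -> R) (c : R) : 0 < T ->
  (forall t, t \in `[0, T] -> has_dt T z t (dz t)) -> continuous (fun s => dz (clamp T s)) ->
  (forall t, t \in `]0, T[ -> z t != 0 -> dz t + c * z t ^+ 2 = 0) ->
  forall t, t \in `[0, T] -> dz t + c * z t ^+ 2 = 0.
Proof.
move=> T0 dZ cdz H t tT; apply/eqP/negP => /negP q0.
have cz := has_dt_continuousT T0 dZ.
have cq : {for t, continuous (fun s => dz (clamp T s) + c * z (clamp T s) ^+ 2)}.
  by apply: cvgD; [exact: cdz|apply: cvgMl_tmp; apply: cvgM; exact: cz].
have nq : \forall s \near t, dz (clamp T s) + c * z (clamp T s) ^+ 2 != 0.
  by apply: (cvgr_neq0 _ cq); rewrite /= clamp_id.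
have [d d0 Hz] : exists2 d : R, 0 < d & forall s : R, `|s - t| < d -> s \in `[0, T] -> s != t -> z s != 0.
  have [zt0|zt0] := eqVneq (z t) 0.
    have dzt : dz t != 0 by apply: contra q0 => /eqP ->; rewrite zt0 expr0n mulr0 addr0.
    have /near_within_dnbhs[d d0 Hd] :
        \forall s \near within `[0, T] t^', (s - t)^-1 * (z s - z t) != 0.
      exact: cvgr_neq0 _ (dZ _ tT) dzt.
    exists d => // s sd sT st.
    have := Hd _ sd sT st; rewrite zt0 subr0; apply: contra => /eqP ->.
    by rewrite mulr0.
  have : {for t, continuous (fun s => z (clamp T s))} by exact: cz.
  move=> /cvgr_neq0; rewrite clamp_id // => /(_ zt0)[d /= d0 Hd].
  exists d => // s sd sT st; have := Hd s; rewrite /= distrC clamp_id //; exact.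
have [d' /= d'0 Hq] := nq.
have dd : 0 < Num.min d d' by rewrite lt_min d0.
have [s [sT st sd]] := interior_near T0 tT dd.
have sT' := subset_itv_oo_cc sT.
have sd1 : `|s - t| < d by rewrite (lt_le_trans sd) // ge_min lexx.
have sd2 : `|s - t| < d' by rewrite (lt_le_trans sd) // ge_min lexx orbT.
have := Hq s; rewrite /= distrC clamp_id // => /(_ sd2)/eqP; apply.
by apply: H => //; exact: Hz.
Qed.

End OneSided.

(** * Smooth curves in the Lie algebra *)

Section UniformContinuity.
Context {R : realType}.
Local Notation mu := (@lebesgue_measure R).
Implicit Types (F G : R -> R -> R) (T t : R).

(** Local in time and uniform in space, which is the mode of continuity that the seminorms of
    [gminf] provide. *)
Definition unif_cont F : Prop :=
  forall t (e : R), 0 < e -> \forall s \near t, forall x, `|F s x - F t x| <= e.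

Definition joint_cont F : Prop := continuous (fun p : R * R => F p.1 p.2).

Lemma unif_cont_joint F : unif_cont F -> (forall t, continuous (F t)) -> joint_cont F.
Proof.
move=> uF cF [t x]; apply/cvgrPdist_le => e e0.
have e2 : 0 < e / 2 by rewrite divr_gt0.
have h1 := uF t _ e2.
have h2 : \forall y \near x, `|F t x - F t y| <= e / 2.
  by have /cvgrPdist_le/(_ _ e2) := cF t x.
exists ([set s | forall x, `|F s x - F t x| <= e / 2], [set y | `|F t x - F t y| <= e / 2]).
  by split; [exact: h1|exact: h2].
move=> [s y] /= [hs hy].
rewrite (_ : F t x - F s y = (F t x - F t y) - (F s y - F t y)); last by ring.
by rewrite (le_trans (ler_normB _ _)) // [leRHS](splitr e) lerD.
Qed.

(** Compactness of [0, T] with a parameter tending to +oo: thresholds valid near each time are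
    replaced by one threshold for all times. *)
Lemma segment_bound T (P : R -> R -> Prop) :
  (forall t, t \in `[0, T] ->
     exists M : R, \forall s \near t, forall N, M <= N -> P s N) ->
  exists M : R, 0 < M /\ forall t, t \in `[0, T] -> P t M.
Proof.
move=> H.
have /compact_near_coveringP cpt := @segment_compact R 0 T.
have [|M [Mr HM]] := cpt R (pinfty_nbhs R) (fun N s => P s N) _.
  move=> t tT; have [M HM] := H t tT.
  exists ([set s | forall N, M <= N -> P s N], [set N | M < N]).
    split => //=; exists M; split => //; exact: num_real.
  by move=> [s N] /= [h1 h2]; apply: h1; exact: ltW.
exists (Num.max M 0 + 1); split; first by rewrite ltr_pwDr // le_max lexx orbT.
by move=> t tT; apply: HM => //; rewrite ltr_pwDr // le_max lexx.
Qed.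

Lemma unif_cont_bound T F : 0 < T -> unif_cont F -> (forall t, F t = F (clamp T t)) ->
  (forall t, exists M : R, forall x, `|F t x| <= M) ->
  exists M : R, 0 < M /\ forall t x, `|F t x| <= M.
Proof.
move=> T0 uF cF bF.
have [t _|M [M0 HM]] := @segment_bound T (fun t M => forall x, `|F t x| <= M).
  have [M HM] := bF t; exists (M + 1).
  have := uF t 1 ltr01; apply: filterS => s h N MN x.
  rewrite (_ : F s x = F t x + (F s x - F t x)); last by ring.
  by rewrite (le_trans (ler_normD _ _)) // (le_trans _ MN) // lerD.
by exists M; split => // t x; rewrite cF; apply: HM; exact: clamp_in.
Qed.

(** Near a given time the decay of the single function [F t] is inherited up to [e / 2]; compactness
    makes the threshold common to all times. *)
Lemma unif_cont_decay T F : 0 < T -> unif_cont F -> (forall t, F t = F (clamp T t)) ->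
  (forall t, F t x @[x --> -oo] --> (0 : R)) ->
  forall e : R, 0 < e -> exists A : R, 0 < A /\ forall t x, x <= - A -> `|F t x| <= e.
Proof.
move=> T0 uF cF lF e e0.
have e2 : 0 < e / 2 by rewrite divr_gt0.
have [t _|M [M0 HM]] := @segment_bound T (fun t A => forall x, x <= - A -> `|F t x| <= e).
  have /cvgrPdist_le/(_ _ e2)[M [_ HM]] := lF t.
  exists (- M + 1).
  have := uF t _ e2; apply: filterS => s h N MN x xN.
  rewrite (_ : F s x = (F s x - F t x) - (0 - F t x)); last by ring.
  rewrite (le_trans (ler_normB _ _)) // [leRHS](splitr e) lerD // HM //.
  by rewrite (le_lt_trans xN) //; lra.
by exists M; split => // t x; rewrite cF; apply: HM; exact: clamp_in.
Qed.

Lemma continuous_clamp_joint T F : 0 < T -> continuous_on T F ->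
  joint_cont (fun t x => F (clamp T t) x).
Proof.
move=> T0 /subspace_continuousP cF [t x].
have := cF (clamp T t, x); rewrite /= => /(_ (clamp_in t T0)) h.
apply: (cvg_comp (fun p : R * R => (clamp T p.1, p.2)) (fun p : R * R => F p.1 p.2) _ h).
move=> A [[B1 B2] [/= h1 h2] hB].
have h1' : \forall s \near t, B1 (clamp T s) by have := clamp_continuous T0 h1.
exists ([set s | B1 (clamp T s)], B2); first by split.
move=> [s y] /= [b1 b2]; have := hB (clamp T s, y); apply => //=.
exact: clamp_in.
Qed.

Lemma joint_continuous_on T F G : (forall t x, t \in `[0, T] -> F t x = G t x) ->
  joint_cont G -> continuous_on T F.
Proof.
move=> FG cG; apply/subspace_continuousP => -[t x] /= tT.
have := cG (t, x); rewrite /continuous_at /= -FG // => h.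
have : G p.1 p.2 @[p --> within [set p | p.1 \in `[0, T]] (nbhs (t, x))] --> F t x.
  exact: cvg_within_filter.
apply: cvg_trans; apply: near_eq_cvg.
rewrite near_withinE; apply: nearW => -[s y] /= sT; by rewrite -FG.
Qed.

Lemma joint_contD F G : joint_cont F -> joint_cont G -> joint_cont (fun t x => F t x + G t x).
Proof.
by move=> cF cG p; apply: (@cvgD _ _ _ (nbhs p) _ _ _ _ _ (cF p) (cG p)).
Qed.

Lemma joint_contM F G : joint_cont F -> joint_cont G -> joint_cont (fun t x => F t x * G t x).
Proof.
by move=> cF cG p; apply: (@cvgM _ _ (nbhs p) _ _ _ _ _ (cF p) (cG p)).
Qed.

Lemma joint_cont_comp (h : R -> R) F : continuous h -> joint_cont F -> joint_cont (fun t x => h (F t x)).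
Proof.
move=> ch cF p; exact: (cvg_comp (fun p : R * R => F p.1 p.2) h (cF p) (ch _)).
Qed.

Lemma joint_contN F : joint_cont F -> joint_cont (fun t x => - F t x).
Proof. by apply: joint_cont_comp => x; apply: cvgN; exact: cvg_id. Qed.

Lemma joint_contB F G : joint_cont F -> joint_cont G -> joint_cont (fun t x => F t x - G t x).
Proof. by move=> cF /joint_contN; exact: joint_contD. Qed.

Lemma joint_contZ (c : R) F : joint_cont F -> joint_cont (fun t x => c * F t x).
Proof. by apply: joint_cont_comp => x; apply: cvgMl_tmp; exact: cvg_id. Qed.

Lemma joint_contV F : (forall t x, F t x != 0) -> joint_cont F -> joint_cont (fun t x => (F t x)^-1).
Proof.
move=> F0 cF p; exact: (@cvgV _ _ (nbhs p) _ _ _ (F0 _ _) (cF p)).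
Qed.

Lemma joint_cont_cst (c : R) : joint_cont (fun _ _ => c).
Proof. by move=> p; exact: cvg_cst. Qed.

Lemma joint_cont_fst (h : R -> R) : continuous h -> joint_cont (fun t _ => h t).
Proof. by move=> ch p; apply: (cvg_comp fst h _ (ch p.1)); exact: cvg_fst. Qed.

Lemma joint_cont_snd (h : R -> R) : continuous h -> joint_cont (fun _ x => h x).
Proof. by move=> ch p; apply: (cvg_comp snd h _ (ch p.2)); exact: cvg_snd. Qed.

Lemma joint_cont_pair F (a b : R -> R -> R) : joint_cont F -> joint_cont a -> joint_cont b ->
  joint_cont (fun t x => F (a t x) (b t x)).
Proof.
move=> cF ca cb p.
apply: (cvg_comp (fun p : R * R => (a p.1 p.2, b p.1 p.2)) (fun p : R * R => F p.1 p.2) _ (cF (a p.1 p.2, b p.1 p.2))).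
move=> A [[B1 B2] [/= b1 b2] hB].
have h1 : \forall q \near p, B1 (a q.1 q.2) by exact: (ca p _ b1).
have h2 : \forall q \near p, B2 (b q.1 q.2) by exact: (cb p _ b2).
have h3 : \forall q \near p, A (a q.1 q.2, b q.1 q.2).
  by near=> q; apply: hB; split => /=; near: q.
exact: h3.
Unshelve. all: by end_near. Qed.

Lemma joint_cont_x F t : joint_cont F -> continuous (F t).
Proof.
move=> cF x; apply: (cvg_comp (fun y => (t, y)) (fun p : R * R => F p.1 p.2) _ (cF (t, x))).
move=> A [[B1 B2] [/= b1 b2] hB].
by apply: filterS b2 => y By; apply: (hB (t, y)); split => //; exact: nbhs_singleton b1.
Qed.

Lemma joint_cont_t F x : joint_cont F -> continuous (F ^~ x).
Proof.
move=> cF t; apply: (cvg_comp (fun s => (s, x)) (fun p : R * R => F p.1 p.2) _ (cF (t, x))).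
move=> A [[B1 B2] [/= b1 b2] hB].
by apply: filterS b1 => y By; apply: (hB (y, x)); split => //; exact: nbhs_singleton b2.
Qed.

Lemma joint_cont_near F t x (P : R -> Prop) : joint_cont F -> (\forall y \near F t x, P y) ->
  exists2 d : R, 0 < d & forall s y, `|s - t| < d -> `|y - x| < d -> P (F s y).
Proof.
move=> cF h; have [[B1 B2] [/= [d1 /= d10 h1] [d2 /= d20 h2]] hB] := cF (t, x) _ h.
exists (Num.min d1 d2); first by rewrite lt_min d10.
move=> s y; rewrite !lt_min => /andP[s1 s2] /andP[y1 y2].
by apply: (hB (s, y)); split => /=; [apply: h1|apply: h2]; rewrite /= distrC.
Qed.

End UniformContinuity.

(** * Differentiation along a moving point *)

Section Chain.
Context {R : realType}.
Implicit Types (T t : R).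

(** No joint differentiability of [g] is available, so the increment is split. At the fixed point
    [gamma t] it is a time increment; the remaining space increment is handled by the mean value
    theorem at a point [xi s] between [gamma t] and [gamma s], where joint continuity of [gx] gives
    the limit. *)
Lemma has_dt_chain T (g gx : R -> R -> R) (gamma : R -> R) t (gt dgamma : R) :
  0 < T -> t \in `[0, T] ->
  has_dt T gamma t dgamma -> has_dt T (fun s => g s (gamma t)) t gt ->
  (forall (s x : R), s \in `[0, T] -> is_derive x 1 (g s) (gx s x)) ->
  joint_cont (fun s x => gx (clamp T s) x) ->
  has_dt T (fun s => g s (gamma s)) t (gt + gx t (gamma t) * dgamma).
Proof.
move=> T0 tT hgam hg dg cgx.
have ex (s : R) : exists xi, s \in `[0, T] ->
   `|xi - gamma t| <= `|gamma s - gamma t| /\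
   g s (gamma s) - g s (gamma t) = gx s xi * (gamma s - gamma t).
  have [sT|_] := boolP (s \in `[0, T]); last by exists 0.
  have [le|le] := leP (gamma t) (gamma s).
    have [c cab e] := MVT_le le (fun x _ => dg s x sT); exists c => _; split => //.
    move: cab; rewrite in_itv /= => /andP[h1 h2].
    by rewrite ger0_norm ?ger0_norm ?subr_ge0 // lerD2r.
  have [c cab e] := MVT_le (ltW le) (fun x _ => dg s x sT); exists c => _; split; last first.
    by rewrite -[LHS]opprB e -mulrN opprB.
  move: cab; rewrite in_itv /= => /andP[h1 h2].
  by rewrite ler0_norm ?ler0_norm ?subr_le0 // ?(ltW le) // lerN2 lerD2r.
have [xi Hxi] := choice ex.
have P := within_dnbhs_proper T0 tT.
have [h [dh hh]] := has_dt_ext tT hgam.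
have ch : h s @[s --> within `[0, T] t^'] --> gamma t.
  rewrite -(hh _ tT); apply: cvg_within_filter; apply: cvg_within_filter.
  exact: is_derive1_continuous dh.
have cgam : gamma s @[s --> within `[0, T] t^'] --> gamma t.
  apply: cvg_trans ch; apply: near_eq_cvg; apply/near_within_dnbhs; exists 1 => // s _ sT _.
  by rewrite hh.
have cxi : xi s @[s --> within `[0, T] t^'] --> gamma t.
  apply/cvgrPdist_le => e e0; move/cvgrPdist_le : cgam => /(_ _ e0).
  move=> /near_within_dnbhs[d d0 Hd]; apply/near_within_dnbhs; exists d => // s sd sT st.
  rewrite distrC (le_trans (Hxi _ sT).1) // distrC; exact: Hd.
have cs : s @[s --> within `[0, T] t^'] --> t.
  by apply: cvg_within_filter; apply: cvg_within_filter; exact: cvg_id.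
have cgxi : gx (clamp T s) (xi s) @[s --> within `[0, T] t^'] --> gx t (gamma t).
  have := cgx (t, gamma t); rewrite /continuous_at /= clamp_id // => H.
  apply: (cvg_comp (fun s => (s, xi s)) (fun p : R * R => gx (clamp T p.1) p.2) _ H).
  move=> A [[B1 B2] /= [b1 b2] hB].
  have h1 := cs _ b1; have h2 := cxi _ b2.
  by move: h1 h2; apply: filterS2 => s h1 h2; apply: (hB (s, xi s)).
have : (s - t)^-1 * (g s (gamma t) - g t (gamma t)) +
   gx (clamp T s) (xi s) * ((s - t)^-1 * (gamma s - gamma t))
   @[s --> within `[0, T] t^'] --> gt + gx t (gamma t) * dgamma.
  by apply: cvgD => //; apply: cvgM.
apply: cvg_trans; apply: near_eq_cvg; apply/near_within_dnbhs; exists 1 => // s _ sT _.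
have [_ e] := Hxi _ sT.
rewrite clamp_id // mulrCA -e; ring.
Qed.

End Chain.

(** * Mixed derivatives of a smooth curve *)

Section Jets.
Context {R : realType}.
Local Notation mu := (@lebesgue_measure R).
Context (T : R) (T0 : 0 < T) (C : nat -> R -> R -> R).
Context (gC : forall n t, t \in `[0, T] -> gminf (C n t)).
Context (dC : forall n, curve_derivative T (C n) (C n.+1)).

Lemma quotient_pt (h p q w e : R) : h != 0 -> `|h^-1 * (p - q) - w| <= 1 ->
  `|h| * (1 + `|w|) <= e -> `|p - q| <= e.
Proof.
move=> h0 h1; apply: le_trans.
have {1}-> : p - q = h * ((h^-1 * (p - q) - w) + w).
  by rewrite subrK mulrA divff ?mul1r.
by rewrite normrM ler_wpM2l // (le_trans (ler_normD _ _)) // lerD2r.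
Qed.

Lemma quotient_L1 (h e : R) (f g w : R -> R) : h != 0 -> L1 f -> L1 g -> L1 w ->
  \int[mu]_x `|h^-1 * (f x - g x) - w x| <= 1 ->
  `|h| * (1 + \int[mu]_x `|w x|) <= e -> \int[mu]_x `|f x - g x| <= e.
Proof.
move=> h0 Lf Lg Lw h1; apply: le_trans.
have L : L1 (fun x => h^-1 * (f x - g x) - w x) by apply: L1B => //; apply: L1Z; exact: L1B.
apply: (@le_trans _ _ (\int[mu]_x (`|h| * (`|h^-1 * (f x - g x) - w x| + `|w x|)))).
  apply: int_le.
  - by apply: L1_norm; exact: L1B.
  - by apply: L1Z; apply: L1D; exact: L1_norm.
  move=> x; have {1}-> : f x - g x = h * ((h^-1 * (f x - g x) - w x) + w x).
    by rewrite subrK mulrA divff ?mul1r.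
  by rewrite normrM ler_wpM2l // ler_normD.
rewrite int_Z; last by apply: L1D; exact: L1_norm.
by rewrite int_D; [rewrite ler_wpM2l // lerD2r|exact: L1_norm|exact: L1_norm].
Qed.

Definition cjet_def (n k : nat) (t : R) : R -> R := derive1n k (C n (clamp T t)).
Fact cjet_key : unit. Proof. by []. Qed.
(* [C n] being the n-th time derivative of a curve, [cjet n k] is a mixed derivative, constant
   in time outside [0, T]; locked, so that [ring] and [field] do not unfold it. *)
Definition cjet := locked_with cjet_key cjet_def.

Lemma cjetE n k t : cjet n k t = derive1n k (C n (clamp T t)).
Proof. by rewrite /cjet unlock. Qed.

Lemma cjet_clamp n k t : cjet n k t = cjet n k (clamp T t).
Proof. by rewrite !cjetE (clamp_id (clamp_in t T0)). Qed.

Let gCc n t : gminf (C n (clamp T t)).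
Proof. exact/gC/clamp_in. Qed.

Lemma cjet_dx n k t (x : R) : is_derive x 1 (cjet n k t) (cjet n k.+1 t x).
Proof. by rewrite !cjetE; have [s _ _] := gminf_nice (gCc n t); exact: smooth_is_derive. Qed.

Lemma cjet_cont n k t : continuous (cjet n k t).
Proof. by move=> x; exact: is_derive1_continuous (cjet_dx n k t x). Qed.

Lemma cjet_L1 n k t : L1 (cjet n k.+1 t).
Proof. by rewrite cjetE; exact: gminfL1. Qed.

Lemma cjet_Ny n k t : cjet n k t x @[x --> -oo] --> (0 : R).
Proof. by rewrite cjetE; exact: gminf_Ny. Qed.

Lemma cjet_le n k t x : `|cjet n k t x| <= \int[mu]_y `|cjet n k.+1 t y|.
Proof. by rewrite !cjetE; exact: gminf_bound. Qed.

(** The seminorm of order [k] is the L^1 norm of the derivative of order k+1. Since the difference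
    quotient vanishes at -oo with all its derivatives, the same number bounds its derivative of
    order [k] uniformly in [x]. *)
Lemma cjet_quotient n t (e : R) k : t \in `[0, T] -> 0 < e ->
  exists2 d : R, 0 < d & forall s, `|s - t| < d -> s \in `[0, T] -> s != t ->
   (\int[mu]_x `|(s - t)^-1 * (cjet n k.+1 s x - cjet n k.+1 t x) - cjet n.+1 k.+1 t x| <= e) /\
   (forall x, `|(s - t)^-1 * (cjet n k s x - cjet n k t x) - cjet n.+1 k t x| <= e).
Proof.
move=> tT e0.
pose v s x := (s - t)^-1 * (C n s x - C n t x) - C n.+1 t x.
have vE s : (fun x => time_quotient (C n) t x s - C n.+1 t x) = v s by [].
have Hv s (sT : s \in `[0, T]) := gminf_quotient (s - t)^-1 (gC n sT) (gC n tT) (gC n.+1 tT).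
have gv s : s \in `[0, T] -> gminf (v s) by move=> sT; have [] := Hv s sT.
have dv s j x : s \in `[0, T] -> derive1n j (v s) x =
    (s - t)^-1 * (cjet n j s x - cjet n j t x) - cjet n.+1 j t x.
  by move=> sT; have [_ E] := Hv s sT; rewrite E !cjetE !clamp_id.
have := @dC n t tT k; rewrite (_ : (fun s => _) = fun s => seminorm k (v s)); last first.
  by apply/funext => s; rewrite vE.
move=> /fine_cvgP[_ /cvgrPdist_le/(_ _ e0)/near_within_dnbhs[d d0 Hd]].
exists d => // s sd sT st.
have := Hd _ sd sT st; rewrite sub0r normrN => {}Hd.
have H1 : \int[mu]_x `|derive1n k.+1 (v s) x| <= e by rewrite (le_trans (ler_norm _)).
split => [|x].
  apply: le_trans H1; rewrite le_eqVlt; apply/orP; left; apply/eqP.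
  by apply: eq_Rintegral => x _; rewrite dv.
by rewrite -dv // (le_trans (gminf_bound _ _ (gv _ sT))).
Qed.

Lemma cjet_dt n k t x : t \in `[0, T] ->
  has_dt T (fun s => cjet n k s x) t (cjet n.+1 k t x).
Proof.
move=> tT; apply/cvgrPdist_le => e e0; apply/near_within_dnbhs.
have [d d0 Hd] := cjet_quotient n k tT e0.
by exists d => // s sd sT st; rewrite distrC; have [_] := Hd _ sd sT st; exact.
Qed.

(** A difference quotient within distance 1 of the time derivative makes the increment at most
    [|s - t|] times 1 plus the norm of that derivative, in the L^1 and in the sup norm alike. *)
Lemma cjet_near n k t (e : R) : 0 < e ->
  \forall s \near t, (\int[mu]_x `|cjet n k.+1 s x - cjet n k.+1 t x| <= e) /\
    forall x, `|cjet n k s x - cjet n k t x| <= e.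
Proof.
move=> e0; have tT := clamp_in t T0.
have [d d0 Hd] := cjet_quotient n k tT ltr01.
have i0 : 0 <= \int[mu]_y `|cjet n.+1 k.+1 t y| by exact: int_ge0.
pose B := 1 + \int[mu]_y `|cjet n.+1 k.+1 t y|.
have B0 : 0 < B by apply: ltr_pwDl.
have dd : 0 < Num.min d (e / B) by rewrite lt_min d0 divr_gt0.
have : \forall s \near t, `|clamp T s - clamp T t| < Num.min d (e / B).
  near=> s; apply: le_lt_trans (clamp_lip _ _ T0) _.
  by near: s; move/cvgrPdist_lt : (@cvg_id _ (nbhs t)) => /(_ _ dd); apply: filterS => s; rewrite distrC.
apply: filterS => s; rewrite lt_min => /andP[sd se].
have seB : `|clamp T s - clamp T t| * B <= e by rewrite -ler_pdivlMr // ltW.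
have -> : cjet n k.+1 s = cjet n k.+1 (clamp T s) by exact: cjet_clamp.
have -> : cjet n k s = cjet n k (clamp T s) by exact: cjet_clamp.
have -> : cjet n k.+1 t = cjet n k.+1 (clamp T t) by exact: cjet_clamp.
have -> : cjet n k t = cjet n k (clamp T t) by exact: cjet_clamp.
have sT := clamp_in s T0.
have [->|st] := eqVneq (clamp T s) (clamp T t).
  split=> [|x]; last by rewrite subrr normr0 ltW.
  apply: (@le_trans _ _ 0); last exact: ltW.
  rewrite le_eqVlt; apply/orP; left; apply/eqP.
  transitivity (\int[mu]_(x in setT) (0 : R)); last by rewrite /Rintegral integral0.
  by apply: eq_Rintegral => x _; rewrite subrr normr0.
have [h1 h2] := Hd _ sd sT st.
have st0 : clamp T s - clamp T t != 0 by rewrite subr_eq0.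
split=> [|x].
  apply: (quotient_L1 st0 (cjet_L1 _ _ _) (cjet_L1 _ _ _) (cjet_L1 n.+1 k _) h1).
  by rewrite -cjet_clamp.
apply: (quotient_pt st0 (h2 x)).
apply: le_trans seB; apply: ler_wpM2l => //; rewrite /B lerD2l -cjet_clamp.
exact: cjet_le.
Unshelve. all: by end_near. Qed.

Lemma cjet_unif n k : unif_cont (cjet n k).
Proof. by move=> t e e0; have := cjet_near n k t e0; apply: filterS => s []. Qed.

Lemma cjet_joint n k : joint_cont (cjet n k).
Proof. apply: unif_cont_joint; [exact: cjet_unif|exact: cjet_cont]. Qed.

Lemma cjet_bound n k : exists M : R, 0 < M /\ forall t x, `|cjet n k t x| <= M.
Proof.
apply: (unif_cont_bound T0); first exact: cjet_unif.
- exact: cjet_clamp.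
- by move=> t; eexists => x; exact: cjet_le.
Qed.

Lemma cjet_decay n k (e : R) : 0 < e ->
  exists A : R, 0 < A /\ forall t x, x <= - A -> `|cjet n k t x| <= e.
Proof.
apply: (unif_cont_decay T0); first exact: cjet_unif.
- exact: cjet_clamp.
- exact: cjet_Ny.
Qed.

Lemma cjet_L1_bound n k : exists M : R, 0 < M /\ forall t, \int[mu]_x `|cjet n k.+1 t x| <= M.
Proof.
have [t _|M [M0 HM]] := @segment_bound R T (fun t M => \int[mu]_x `|cjet n k.+1 t x| <= M).
  exists (1 + \int[mu]_x `|cjet n k.+1 t x|).
  have := cjet_near n k t ltr01; apply: filterS => s [h _] N MN.
  apply: le_trans MN; apply: (@le_trans _ _ (\int[mu]_x (`|cjet n k.+1 s x - cjet n k.+1 t x| + `|cjet n k.+1 t x|))).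
    apply: int_le.
    - by apply: L1_norm; exact: cjet_L1.
    - by apply: L1D; apply: L1_norm; [apply: L1B; exact: cjet_L1|exact: cjet_L1].
    - by move=> x; rewrite -{1}(subrK (cjet n k.+1 t x) (cjet n k.+1 s x)) ler_normD.
  rewrite int_D; [by rewrite lerD|by apply: L1_norm; apply: L1B; exact: cjet_L1|by apply: L1_norm; exact: cjet_L1].
by exists M; split => // t; rewrite cjet_clamp; apply: HM; exact: clamp_in.
Qed.

End Jets.

(** * Diffeomorphisms of the line *)

Section LineDiffeo.
Context {R : realType}.
Local Notation mu := (@lebesgue_measure R).
Context (X P : R -> R) (d K : R).
Context (dX : forall y : R, is_derive y 1 X (P y)) (cP : continuous P).
Context (d0 : 0 < d) (dP : forall y, d <= P y) (XK : forall y, `|X y - y| <= K).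

Local Notation Xi := (pinv setT X).

Lemma ldiff_expand (x y : R) : x <= y -> d * (y - x) <= X y - X x.
Proof.
move=> xy; have [c _ ->] := MVT_le xy (fun z _ => dX z).
by rewrite ler_wpM2r // subr_ge0.
Qed.

Lemma ldiff_incr (x y : R) : x < y -> X x < X y.
Proof.
move=> xy; rewrite -subr_gt0; apply: lt_le_trans (ldiff_expand (ltW xy)).
by rewrite mulr_gt0 // subr_gt0.
Qed.

Lemma ldiff_inj : injective X.
Proof.
by move=> x y e; case: (ltgtP x y) => // /ldiff_incr; rewrite e ltxx.
Qed.

Lemma ldiff_cont : continuous X.
Proof. by move=> y; exact: is_derive1_continuous (dX y). Qed.

(** Since [X] moves points by at most [K], the value [x] lies between those of [X] at [x - K] and
    [x + K]. *)
Lemma ldiff_surj : set_surj setT setT X.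
Proof.
move=> x _.
have K0 : 0 <= K by apply: le_trans (XK 0).
have le1 : x - K <= x + K by lra.
have h1 := XK (x - K); have h2 := XK (x + K).
have h : Num.min (X (x - K)) (X (x + K)) <= x <= Num.max (X (x - K)) (X (x + K)).
  rewrite ge_min le_max; move: h1 h2; rewrite !ler_norml => /andP[_ h1] /andP[h2 _].
  apply/andP; split; apply/orP; [left|right]; lra.
have cX : {within `[x - K, x + K], continuous X}.
  by apply: within_itv_continuous; exact: ldiff_cont.
have [c _ e] := IVT le1 cX h.
by exists c.
Qed.

Lemma ldiffK x : X (Xi x) = x.
Proof. by rewrite (surjpK _ ldiff_surj) // inE. Qed.

Lemma ldiffVK y : Xi (X y) = y.
Proof. by apply: ldiff_inj; rewrite ldiffK. Qed.

Lemma ldiffV_lip x y : `|Xi x - Xi y| <= d^-1 * `|x - y|.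
Proof.
wlog : x y / Xi x <= Xi y.
  move=> H; case: (leP (Xi x) (Xi y)) => [|/ltW]; first exact: H.
  by rewrite distrC [`|x - y|]distrC; exact: H.
move=> xy; have := ldiff_expand xy; rewrite !ldiffK => h.
rewrite ler_pdivlMl // distrC ger0_norm ?subr_ge0 //.
by rewrite (le_trans h) // distrC ler_norm.
Qed.

Lemma ldiffV_cont : continuous Xi.
Proof.
move=> x; apply/cvgrPdist_le => e e0.
have de : 0 < d * e by rewrite mulr_gt0.
have /cvgrPdist_le/(_ _ de) : id y @[y --> x] --> x by exact: cvg_id.
apply: filterS => y h; rewrite (le_trans (ldiffV_lip _ _)) //.
by rewrite ler_pdivrMl.
Qed.

(** A difference quotient of the inverse is the reciprocal of a difference quotient of [X], whose
    base point moves continuously. *)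
Lemma ldiffV_derive (x : R) : is_derive x 1 Xi (P (Xi x))^-1.
Proof.
apply/is_derive1P.
have P0 : P (Xi x) != 0 by rewrite gt_eqF // (lt_le_trans d0).
have /is_derive1P h := dX (Xi x).
have c : Xi s @[s --> x^'] --> (Xi x)^'.
  move=> A [e /= e0 eA].
  have /cvgrPdist_lt/(_ _ e0)[r /= r0 Hr] := @ldiffV_cont x.
  exists r => //= s sr sx; apply: eA => /=; first exact: Hr.
  by apply: contra sx => /eqP e1; rewrite -(ldiffK s) e1 ldiffK.
have : ((Xi s - Xi x)^-1 * (X (Xi s) - X (Xi x)))^-1 @[s --> x^'] --> (P (Xi x))^-1.
  by apply: cvgV => //; exact: (cvg_comp _ _ c h).
apply: cvg_trans; apply: near_eq_cvg; near=> s.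
by rewrite /= !ldiffK invfM invrK mulrC.
Unshelve. all: by end_near. Qed.

Lemma ldiff_derive1 : derive1 X = P.
Proof. exact: is_derive1_fun. Qed.

Lemma ldiff_cov (G : R -> R) (a b : R) : a <= b -> continuous G ->
  \int[mu]_(x in `[X a, X b]) G x = \int[mu]_(y in `[a, b]) (G (X y) * P y).
Proof.
move=> ab cG; rewrite /Rintegral (integration_by_substitution_increasing ab) //.
- by rewrite ldiff_derive1.
- by move=> x y _ _; exact: ldiff_incr.
- by rewrite ldiff_derive1 => x _; exact: cP.
- by rewrite ldiff_derive1; apply/cvg_ex; exists (P a); apply: cvg_at_right_filter; exact: cP.
- by rewrite ldiff_derive1; apply/cvg_ex; exists (P b); apply: cvg_at_left_filter; exact: cP.
- exact: derivable_oo_LR dX.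
- exact: within_itv_continuous.
Qed.

Lemma ldiff_Ny : X y @[y --> -oo] --> -oo.
Proof.
apply/cvgrNyPle => M; near=> y.
have := XK y; rewrite ler_norml => /andP[_ h].
have : y <= M - K by apply: ltW; near: y; apply: nbhs_ninfty_lt; rewrite num_real.
lra.
Unshelve. all: by end_near. Qed.

Lemma ldiff_y : X y @[y --> +oo] --> +oo.
Proof.
apply/cvgryPge => M; near=> y.
have := XK y; rewrite ler_norml => /andP[h _].
have : M + K <= y by apply: ltW; near: y; apply: nbhs_pinfty_gt; rewrite num_real.
lra.
Unshelve. all: by end_near. Qed.

Lemma ldiff_covT (G : R -> R) : continuous G -> (forall x, 0 <= G x) ->
  cvg (P y @[y --> -oo]) -> cvg (P y @[y --> +oo]) ->
  (\int[mu]_x (G x)%:E = \int[mu]_y (G (X y) * P y)%:E)%E.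
Proof.
move=> cG G0; rewrite -ldiff_derive1 => c1 c2.
have cX : continuous (derive1 X) by rewrite ldiff_derive1.
have dX' (y : R) : derivable X y 1 by exact: is_derive1_derivable (dX y).
exact: (increasing_ge0_integration_by_substitutionT (@ldiff_incr) cX c1 c2 dX' ldiff_Ny ldiff_y cG G0).
Qed.

End LineDiffeo.

(** A path is carried by the successive time derivatives [C n] of its displacement phi - id; the
    last field is phi_x > 0. *)
Record flow_data {R : realType} (T : R) (C : nat -> R -> R -> R) : Prop := FlowData {
  fd_T : 0 < T;
  fd_g : forall n t, t \in `[0, T] -> gminf (C n t);
  fd_d : forall n, curve_derivative T (C n) (C n.+1);
  fd_p : forall t x, t \in `[0, T] -> -1 < derive1 (C 0%N t) x }.

(** * The flow of a path, its inverse, and the passage to Eulerian coordinates *)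

Section Path.
Context {R : realType}.
Local Notation mu := (@lebesgue_measure R).
Context (T : R) (C : nat -> R -> R -> R) (H : flow_data T C).
Let T0 := fd_T H.
Let gC := fd_g H.
Let dC := fd_d H.
Let pC := fd_p H.

Local Notation g := (cjet T C).

Definition flow (t y : R) : R := y + g 0 0 t y.
Definition jac (t y : R) : R := 1 + g 0 1 t y.
Definition iflow (t : R) : R -> R := pinv setT (flow t).

Lemma flow_dx t (y : R) : is_derive y 1 (flow t) (jac t y).
Proof. exact: (is_derive1D (is_derive1_id y) (cjet_dx T0 gC 0 0 t y)). Qed.

Lemma jac_dx t (y : R) : is_derive y 1 (jac t) (g 0 2 t y).
Proof.
apply: is_derive1_eq (is_derive1D (is_derive1_cst 1 y) (cjet_dx T0 gC 0 1 t y)) _ _ => //.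
by rewrite add0r.
Qed.

Lemma flow_dt t y : t \in `[0, T] -> has_dt T (fun s => flow s y) t (g 1 0 t y).
Proof.
move=> tT; rewrite -[g _ _ _ _]add0r; apply: has_dtD => //; first exact: has_dt_cst.
exact: cjet_dt.
Qed.

Lemma jac_dt t y : t \in `[0, T] -> has_dt T (fun s => jac s y) t (g 1 1 t y).
Proof.
move=> tT; rewrite -[g _ _ _ _]add0r; apply: has_dtD => //; first exact: has_dt_cst.
exact: cjet_dt.
Qed.

Lemma jac_cont t : continuous (jac t).
Proof. by move=> y; exact: is_derive1_continuous (jac_dx t y). Qed.

Lemma jac_gt0 t y : 0 < jac t y.
Proof.
have := pC y (clamp_in t T0); rewrite /jac cjetE /derive1n /=; lra.
Qed.

Lemma cvg0_bound (f : R -> R) : f x @[x --> -oo] --> (0 : R) -> f x @[x --> +oo] --> (0 : R) ->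
  exists A : R, 0 < A /\ forall x, A <= `|x| -> `|f x| <= 1 / 2.
Proof.
have h2 : 0 < 1 / 2 :> R by lra.
move=> /cvgrPdist_le/(_ _ h2)[A [_ HA]] /cvgrPdist_le/(_ _ h2)[B [_ HB]].
exists (`|A| + `|B| + 1); split; first by rewrite ltr_pwDr.
have hA := ler_norm (- A); rewrite normrN in hA; have hB := ler_norm B.
have A0 := normr_ge0 A; have B0 := normr_ge0 B.
move=> x; have [x0|x0] := leP 0 x.
  by rewrite (ger0_norm x0) => hx; have := HB x; rewrite sub0r normrN; apply; lra.
by rewrite (ltr0_norm x0) => hx; have := HA x; rewrite sub0r normrN; apply; lra.
Qed.

(** Far out [jac t] is at least 1/2, because the derivative of the displacement tends to 0 at both
    ends; on the remaining compact interval it attains a positive minimum. *)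
Lemma jac_low1 t : exists2 d : R, 0 < d & forall y, d <= jac t y.
Proof.
have [_ nn _] := gminf_nice (gC 0 (clamp_in t T0)).
have [l1 l2] := nice_cvg0 nn.
have [A [A0 HA]] := cvg0_bound l1 l2.
have le : - A <= A by lra.
have cj : {within `[- A, A], continuous (jac t)}.
  by apply: within_itv_continuous; exact: jac_cont.
have [c _ Hc] := EVT_min le cj.
exists (Num.min (jac t c) (1/2)); first by rewrite lt_min jac_gt0 /=; lra.
move=> y; rewrite ge_min; have [hy|hy] := leP A `|y|.
  apply/orP; right; have := HA y hy; rewrite ler_norml /jac cjetE /derive1n /= => /andP[h _]; lra.
by apply/orP; left; apply: Hc; rewrite in_itv /= -ler_norml ltW.
Qed.

Lemma jac_low : exists2 d : R, 0 < d & forall t y, d <= jac t y.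
Proof.
(* The lower bound is sought as [N^-1], so that the condition weakens as [N] grows, as
   [segment_bound] requires. *)
have [t _|M [M0 HM]] := @segment_bound R T (fun t N => forall y, N^-1 <= jac t y).
  have [d d0 Hd] := jac_low1 t.
  have d2 : 0 < d / 2 by rewrite divr_gt0.
  exists (d / 2)^-1.
  have := cjet_unif T0 gC dC 0 1 t d2; apply: filterS => s h N MN y.
  have N0 : 0 < N by apply: lt_le_trans MN; rewrite invr_gt0.
  have hN : N^-1 <= d / 2 by rewrite -[leRHS]invrK lef_pV2 // posrE // invr_gt0.
  have := Hd y; have := h y; rewrite ler_norml /jac => /andP[h1 _]; lra.
exists M^-1; first by rewrite invr_gt0.
move=> t y; have := HM _ (clamp_in t T0) y; rewrite /jac -cjet_clamp //.
Qed.

Lemma flow_near : exists2 K : R, 0 < K & forall t y, `|flow t y - y| <= K.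
Proof.
have [M [M0 HM]] := cjet_bound T0 gC dC 0 0.
by exists M => // t y; rewrite /flow addrAC subrr add0r.
Qed.

Lemma flowK t x : flow t (iflow t x) = x.
Proof.
have [K K0 HK] := flow_near.
by apply: (ldiffK (P := jac t) (K := K)) => // y; exact: flow_dx.
Qed.

Lemma iflowK t y : iflow t (flow t y) = y.
Proof.
have [K K0 HK] := flow_near; have [d d0 Hd] := jac_low.
by apply: (ldiffVK (P := jac t) (K := K) (d := d)) => // z; exact: flow_dx.
Qed.

Lemma iflow_near : exists2 K : R, 0 < K & forall t x, `|iflow t x - x| <= K.
Proof.
have [K K0 HK] := flow_near; exists K => // t x.
by have := HK t (iflow t x); rewrite flowK distrC.
Qed.

Lemma iflow_dx t (x : R) : is_derive x 1 (iflow t) (jac t (iflow t x))^-1.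
Proof.
have [K K0 HK] := flow_near; have [d d0 Hd] := jac_low.
by apply: (ldiffV_derive (P := jac t) (K := K) (d := d)) => // y; exact: flow_dx.
Qed.

Lemma flow_joint : joint_cont flow.
Proof.
apply: (@joint_contD _ (fun _ y => y) (g 0 0)); last exact: cjet_joint.
by apply: joint_cont_snd => x; exact: cvg_id.
Qed.

Lemma jac_joint : joint_cont jac.
Proof.
by apply: (@joint_contD _ (fun _ _ => 1) (g 0 1)); [exact: joint_cont_cst|exact: cjet_joint].
Qed.

(** The flow at time [s] expands the distance of the two inverse images by at least [d], whereas
    their images differ only by the change of the displacement between [t] and [s]. *)
Lemma iflow_unif : unif_cont iflow.
Proof.
move=> t e e0; have [d d0 Hd] := jac_low.
have de : 0 < d * e by rewrite mulr_gt0.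
have := cjet_unif T0 gC dC 0 0 t de; apply: filterS => s h x.
have E : flow s (iflow s x) - flow s (iflow t x) = flow t (iflow t x) - flow s (iflow t x).
  by rewrite !flowK.
have F : `|flow s (iflow s x) - flow s (iflow t x)| <= d * e.
  rewrite E /flow (_ : _ - _ = - (g 0 0 s (iflow t x) - g 0 0 t (iflow t x))); last by ring.
  by rewrite normrN.
have ex := @ldiff_expand _ (flow s) (jac s) d (flow_dx s) (Hd s).
have [le|le] := leP (iflow t x) (iflow s x).
  rewrite ger0_norm ?subr_ge0 // -(ler_pM2l d0) (le_trans (ex _ _ le)) //.
  by rewrite (le_trans _ F) // ler_norm.
rewrite ltr0_norm ?subr_lt0 // opprB -(ler_pM2l d0) (le_trans (ex _ _ (ltW le))) //.
by rewrite (le_trans _ F) // distrC ler_norm.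
Qed.

Lemma iflow_joint : joint_cont iflow.
Proof.
apply: unif_cont_joint; first exact: iflow_unif.
by move=> t x; exact: is_derive1_continuous (iflow_dx t x).
Qed.

(** Implicit differentiation of phi(s, psi(s, x)) = x: the mean value theorem in space relates the
    increment of the flow at the fixed particle [y] to that of the inverse, with a slope
    [jac s (xi s)] that tends to [jac t y]. *)
Lemma iflow_dt t x : t \in `[0, T] ->
  has_dt T (fun s => iflow s x) t (- (g 1 0 t (iflow t x) / jac t (iflow t x))).
Proof.
move=> tT; set y := iflow t x.
have ex (s : R) : exists xi, `|xi - y| <= `|iflow s x - y| /\
   flow t y - flow s y = jac s xi * (iflow s x - y).
  have e0 : flow t y - flow s y = flow s (iflow s x) - flow s y by rewrite /y !flowK.
  rewrite e0; have [le|le] := leP y (iflow s x).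
    have [c cab e] := MVT_le le (fun z _ => flow_dx s z); exists c; split => //.
    move: cab; rewrite in_itv /= => /andP[h1 h2].
    by rewrite ger0_norm ?ger0_norm ?subr_ge0 // lerD2r.
  have [c cab e] := MVT_le (ltW le) (fun z _ => flow_dx s z); exists c; split; last first.
    by rewrite -[LHS]opprB e -mulrN opprB.
  move: cab; rewrite in_itv /= => /andP[h1 h2].
  by rewrite ler0_norm ?ler0_norm ?subr_le0 // ?(ltW le) // lerN2 lerD2r.
have [xi Hxi] := choice ex.
have cxi : xi s @[s --> within `[0, T] t^'] --> y.
  apply/cvgrPdist_le => e e0.
  have [d /= d0 Hd] := iflow_unif t e0.
  apply/near_within_dnbhs; exists d => // s sd sT st.
  by rewrite distrC (le_trans (Hxi s).1) // Hd //= distrC.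
have cs : s @[s --> within `[0, T] t^'] --> t.
  by apply: cvg_within_filter; apply: cvg_within_filter; exact: cvg_id.
have cj : jac s (xi s) @[s --> within `[0, T] t^'] --> jac t y.
  apply: (cvg_comp (fun s => (s, xi s)) (fun p : R * R => jac p.1 p.2) _ (@jac_joint (t, y))).
  move=> A [[B1 B2] /= [b1 b2] hB].
  have h1 := cs _ b1; have h2 := cxi _ b2.
  by move: h1 h2; apply: filterS2 => s h1 h2; apply: (hB (s, xi s)).
have j0 t' y' : jac t' y' != 0 by rewrite gt_eqF // jac_gt0.
have : - ((s - t)^-1 * (flow s y - flow t y) * (jac s (xi s))^-1)
    @[s --> within `[0, T] t^'] --> - (g 1 0 t y / jac t y).
  by apply: cvgN; apply: cvgM; [exact: flow_dt|apply: cvgV].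
apply: cvg_trans; apply: near_eq_cvg; apply/near_within_dnbhs; exists 1 => // s _ sT st.
have [_ e] := Hxi s.
have -> : flow s y - flow t y = - (jac s (xi s) * (iflow s x - y)) by rewrite -e opprB.
rewrite -/y; field.
by rewrite subr_eq0 st j0.
Qed.

Lemma euler_dx (h hx : R -> R -> R) t (x : R) : (forall y : R, is_derive y 1 (h t) (hx t y)) ->
  is_derive x 1 (fun x => h t (iflow t x)) (hx t (iflow t x) / jac t (iflow t x)).
Proof. by move=> dh; exact: (is_derive1_chain (iflow_dx t x) (dh _)). Qed.

(** The derivative at a fixed point of space is the derivative along the particle minus the
    transport term, u times the space derivative. *)
Lemma euler_dt (h hx : R -> R -> R) t x ht : t \in `[0, T] ->
  (forall s y : R, is_derive y 1 (h s) (hx s y)) ->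
  joint_cont hx ->
  has_dt T (fun s => h s (iflow t x)) t ht ->
  has_dt T (fun s => h s (iflow s x)) t
    (ht - g 1 0 t (iflow t x) * (hx t (iflow t x) / jac t (iflow t x))).
Proof.
move=> tT dh chx hh.
have -> : ht - g 1 0 t (iflow t x) * (hx t (iflow t x) / jac t (iflow t x)) =
   ht + hx t (iflow t x) * - (g 1 0 t (iflow t x) / jac t (iflow t x)) by ring.
apply: (has_dt_chain (gx := hx) T0 tT (iflow_dt (x := x) tT) hh).
apply: (joint_cont_pair chx); first exact: (joint_cont_fst (clamp_continuous T0)).
by apply: joint_cont_snd => y; exact: cvg_id.
Qed.

Lemma euler_joint (h : R -> R -> R) : joint_cont h -> joint_cont (fun t x => h t (iflow t x)).
Proof.
move=> ch; apply: (joint_cont_pair ch); last exact: iflow_joint.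
by apply: joint_cont_fst => t; exact: cvg_id.
Qed.

End Path.

(** * Signed powers and the Eulerian equations *)

Section SignedPower.
Context {R : realType}.
Implicit Types (a r z : R).

Lemma abs_pow_derive a z : z != 0 ->
  is_derive z 1 (fun y => `|y| `^ a) (a * (z * `|z| `^ (a - 2))).
Proof.
move=> z0; have n0 : 0 < `|z| by rewrite normr_gt0.
have E : `|z| `^ (a - 1) = `|z| * `|z| `^ (a - 2).
  rewrite -[X in X * _](powRr1 (normr_ge0 z)) -powRD ?normr_eq0 ?z0 ?implybT //.
  by congr (_ `^ _); ring.
have [zp|zn|ze] := ltrgt0P z; last by rewrite ze eqxx in z0.
- apply: (@is_derive1_near _ (fun y => y `^ a)).
    by near=> y; rewrite gtr0_norm//; near: y; exact: lt_nbhsr.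
  apply: is_derive1_eq (is_derive1_powR a zp) _ _ => //.
  by rewrite gtr0_norm // in E; rewrite E.
- apply: (@is_derive1_near _ (fun y => (- y) `^ a)).
    by near=> y; rewrite ltr0_norm//; near: y; exact: lt_nbhsl.
  have nz : 0 < - z by rewrite oppr_gt0.
  have dN := is_derive1N (is_derive1_id z).
  apply: is_derive1_eq (is_derive1_chain dN (is_derive1_powR a nz)) _ _ => //.
  by rewrite ltr0_norm // in E; rewrite E; ring.
Unshelve. all: by end_near. Qed.

Lemma abs_powB2 r z : z != 0 -> `|z| `^ r = z ^+ 2 * `|z| `^ (r - 2).
Proof.
move=> z0; rewrite -[z ^+ 2]real_normK ?num_real // -powR_mulrn // -powRD ?normr_eq0 ?z0 ?implybT //.
by congr (_ `^ _); ring.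
Qed.

Lemma signed_pow0 r : signed_pow r 0 = 0.
Proof. by rewrite /signed_pow mul0r. Qed.

Lemma mul_signed_pow r z : 0 < r -> z * signed_pow r z = `|z| `^ r.
Proof.
move=> r0; have [->|z0] := eqVneq z 0; first by rewrite mul0r normr0 powR0 // gt_eqF.
by rewrite (abs_powB2 _ z0) /signed_pow mulrA expr2.
Qed.

Lemma norm_signed_pow r z : 1 < r -> `|signed_pow r z| = `|z| `^ (r - 1).
Proof.
move=> r1; have [->|z0] := eqVneq z 0.
  by rewrite signed_pow0 normr0 powR0 // subr_eq0 gt_eqF.
rewrite /signed_pow normrM (ger0_norm (powR_ge0 _ _)).
rewrite -[X in X * _](powRr1 (normr_ge0 z)) -powRD ?normr_eq0 ?z0 ?implybT //.
by congr (_ `^ _); ring.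
Qed.

(** The point 0 is excluded because the derivative blows up there when 1 < r < 2. *)
Lemma signed_pow_derive r z : z != 0 ->
  is_derive z 1 (signed_pow r) ((r - 1) * `|z| `^ (r - 2)).
Proof.
move=> z0; apply: is_derive1_eq (is_derive1M (is_derive1_id z) (abs_pow_derive (r - 2) z0)) _ _ => //.
rewrite (abs_powB2 (r - 2) z0); ring.
Qed.

Lemma norm_pow_cvg0 a : 0 < a -> `|z| `^ a @[z --> (0:R)^'] --> (0 : R).
Proof.
move=> a0; have h := powR_cvg0 a0.
apply: (cvg_comp (fun z : R => `|z|) (fun y => y `^ a) _ h).
move=> A [e /= e0 eA]; exists e => //= z ze zn.
apply: eA => /=; last by rewrite normr_gt0.
by move: ze; rewrite /ball_ /= !sub0r !normrN normr_id.
Qed.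

(** Unlike [signed_pow r], this function is C^1 across 0 for every r > 1: its difference quotient at
    0 has size [|z|] to the power r - 1. *)
Lemma abs_pow_derive_gt1 r z : 1 < r ->
  is_derive z 1 (fun y => `|y| `^ r) (r * signed_pow r z).
Proof.
move=> r1; have [->|z0] := eqVneq z 0; last exact: abs_pow_derive.
rewrite signed_pow0 mulr0; apply/is_derive1P.
rewrite normr0 powR0 ?gt_eqF ?(lt_trans ltr01 r1) //.
apply: norm_cvg0; have := @norm_pow_cvg0 (r - 1); rewrite subr_gt0 => /(_ r1).
apply: cvg_trans; apply: near_eq_cvg; near=> s.
have s0 : s != 0 by near: s; exact: nbhs_dnbhs_neq.
rewrite !subr0 normrM normfV (ger0_norm (powR_ge0 _ _)) powRB ?normr_eq0 ?s0 ?implybT //.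
by rewrite powRr1 // mulrC.
Unshelve. all: by end_near. Qed.

Lemma abs_pow_continuous r : 1 < r -> continuous (fun z : R => `|z| `^ r).
Proof. by move=> r1 z; exact: is_derive1_continuous (abs_pow_derive_gt1 z r1). Qed.

Lemma signed_pow_continuous r : 1 < r -> continuous (signed_pow r).
Proof.
move=> r1 z; have [->|z0] := eqVneq z 0; last exact: is_derive1_continuous (signed_pow_derive r z0).
rewrite /continuous_at signed_pow0; apply/cvgrPdist_le => e e0.
have := @norm_pow_cvg0 (r - 1); rewrite subr_gt0 => /(_ r1)/cvgrPdist_le/(_ _ e0)[d /= d0 Hd].
exists d => //= s sd; have [->|s0] := eqVneq s 0; first by rewrite signed_pow0 subrr normr0 ltW.
have := Hd s sd s0; rewrite !sub0r !normrN (ger0_norm (powR_ge0 _ _)).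
by rewrite norm_signed_pow.
Qed.

End SignedPower.

(** * Pointwise identities among the Eulerian equations where u_x <> 0 *)

Section EulerJet.
Context {R : realType}.
Context (T r : R) (T0 : 0 < T) (r1 : 1 < r).

(** [U k] stands for the k-th space derivative of [u] and [V k] for its time derivative, up to the
    orders that the Proudman--Johnson equation involves. Velocities of paths and smooth curves in
    the Lie algebra both provide such data. *)
Record euler_jet (u : R -> R -> R) (U V : nat -> R -> R -> R) : Prop := EulerJet {
  ej_u : forall t, t \in `[0, T] -> u t = U 0%N t;
  ej_dx : forall k t (x : R), (k < 3)%N -> is_derive x 1 (U k t) (U k.+1 t x);
  ej_dt : forall k t x, (k < 3)%N -> t \in `[0, T] -> has_dt T (fun s => U k s x) t (V k t x);
  ej_vx : forall k t (x : R), (k < 2)%N -> is_derive x 1 (V k t) (V k.+1 t x);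
  ej_U : forall k, (k < 4)%N -> joint_cont (U k);
  ej_V : forall k, (k < 3)%N -> joint_cont (V k) }.

Context (u : R -> R -> R) (U V : nat -> R -> R -> R) (J : euler_jet u U V).

Lemma has_dt_near (f g : R -> R) t l (d : R) : t \in `[0, T] -> 0 < d ->
  (forall s, s \in `[0, T] -> `|s - t| < d -> f s = g s) ->
  has_dt T f t l -> has_dt T g t l.
Proof.
move=> tT d0 fg; apply: cvg_trans; apply: near_eq_cvg; apply/near_within_dnbhs.
by exists d => // s sd sT st; rewrite !fg // subrr normr0.
Qed.

(** The Eulerian form of z_t + z^2 / r: the transport term turns the time derivative at a fixed
    point into the one along a particle (see [rsrc_eul]). *)
Definition rsrc (t x : R) : R := V 1%N t x + U 0%N t x * U 2%N t x + r^-1 * U 1%N t x ^+ 2.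

(** The right-hand side is the Proudman--Johnson expression with lambda = 1/r: in the coefficient of
    u_x u_xx, 1 comes from the transport term and 2/r from the square. *)
Lemma rsrc_dx t (x : R) : is_derive x 1 (rsrc t)
  (V 2%N t x + (1 + 2 * r^-1) * U 1%N t x * U 2%N t x + U 0%N t x * U 3%N t x).
Proof.
have d0 := ej_dx J t x (isT : (0 < 3)%N); have d1 := ej_dx J t x (isT : (1 < 3)%N).
have d2 := ej_dx J t x (isT : (2 < 3)%N); have v1 := ej_vx J t x (isT : (1 < 2)%N).
apply: is_derive1_eq (is_derive1D (is_derive1D v1 (is_derive1M d0 d2)) (is_derive1Z r^-1 (is_derive1M d1 d1))) _ _.
- by move=> y; rewrite /rsrc expr2.
- ring.
Qed.

Lemma ej_Dx t : t \in `[0, T] -> Dx u t = U 1%N t.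
Proof. by move=> tT; rewrite /Dx (ej_u J tT); apply: is_derive1_fun => x; exact: (ej_dx J). Qed.

Lemma ej_Dxx t : t \in `[0, T] -> derive1n 2 (u t) = U 2%N t.
Proof.
move=> tT; rewrite /derive1n /= -/(Dx u t) ej_Dx //.
by apply: is_derive1_fun => x; exact: (ej_dx J).
Qed.

Lemma ej_Dxxx t : t \in `[0, T] -> derive1n 3 (u t) = U 3%N t.
Proof.
move=> tT; rewrite -[LHS]/(derive1 (derive1n 2 (u t))) ej_Dxx //.
by apply: is_derive1_fun => x; exact: (ej_dx J).
Qed.

Lemma ej_Dt t : t \in `[0, T] -> Dt T u t = V 0%N t.
Proof.
move=> tT; apply/funext => x.
have h : has_dt T (fun s => u s x) t (V 0%N t x).
  apply: (has_dt_eq tT (@ej_dt u U V J 0%N t x isT tT) _ _) => // s sT.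
  by rewrite (ej_u J sT).
by have [_] := has_dt_Dt T0 tT h.
Qed.

Lemma ej_proudman t x : t \in `[0, T] -> proudman_johnson T r^-1 u t x =
  V 2%N t x + (1 + 2 * r^-1) * U 1%N t x * U 2%N t x + U 0%N t x * U 3%N t x.
Proof.
move=> tT; rewrite /proudman_johnson ej_Dt // ej_Dx // ej_Dxx // ej_Dxxx // (ej_u J tT).
have E1 : derive1 (V 0%N t) = V 1%N t by apply: is_derive1_fun => y; exact: (ej_vx J).
have E2 : derive1 (V 1%N t) = V 2%N t by apply: is_derive1_fun => y; exact: (ej_vx J).
by rewrite /derive1n /= E1 E2.
Qed.

Lemma ej_momentum t : t \in `[0, T] -> momentum r u t = fun x => signed_pow r (U 1%N t x).
Proof. by move=> tT; apply/funext => x; rewrite /momentum ej_Dx. Qed.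

Lemma ej_momentum_dx t (x : R) : t \in `[0, T] -> U 1%N t x != 0 ->
  is_derive x 1 (momentum r u t) ((r - 1) * `|U 1%N t x| `^ (r - 2) * U 2%N t x).
Proof.
move=> tT u0; rewrite ej_momentum //.
exact: (is_derive1_chain (ej_dx J t x (isT : (1 < 3)%N)) (signed_pow_derive r u0)).
Qed.

Lemma ej_momentum_dt t x : t \in `[0, T] -> U 1%N t x != 0 ->
  has_dt T (fun s => momentum r u s x) t ((r - 1) * `|U 1%N t x| `^ (r - 2) * V 1%N t x).
Proof.
move=> tT u0.
apply: (has_dt_eq tT (has_dt_comp tT (@ej_dt u U V J 1%N t x isT tT) (signed_pow_derive r u0)) _ _) => // s sT.
by rewrite ej_momentum.
Qed.

Lemma ej_near t x : U 1%N t x != 0 ->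
  exists2 d : R, 0 < d & forall s y, `|s - t| < d -> `|y - x| < d -> U 1%N s y != 0.
Proof.
move=> u0; apply: (@joint_cont_near R (U 1%N) t x (fun z => z != 0)).
  exact: (ej_U J).
by apply: (cvgr_neq0 _ (@cvg_id _ (nbhs (U 1%N t x)))).
Qed.

(** Both m_t and m_x carry the factor (r - 1) |u_x|^{r-2}, and |u_x|^r = u_x^2 |u_x|^{r-2}; what
    remains after extracting the factor is [rsrc]. *)
Lemma ej_integrated t x : t \in `[0, T] -> U 1%N t x != 0 ->
  rHS_integrated T r u t x = (r - 1) * `|U 1%N t x| `^ (r - 2) * rsrc t x.
Proof.
move=> tT u0; rewrite /rHS_integrated.
have [_ ->] := has_dt_Dt T0 tT (ej_momentum_dt tT u0).
rewrite {1}/Dx (is_derive1_derive1 (ej_momentum_dx tT u0)) ej_Dx // (ej_u J tT).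
rewrite (abs_powB2 r u0) /rsrc; field.
by rewrite gt_eqF // (lt_trans ltr01 r1).
Qed.

(** By joint continuity u_x stays nonzero near (t, x) in time and space, so that all powers can be
    differentiated there. The factorisation of [ej_integrated] then yields the r-Hunter--Saxton
    expression by differentiation, and the Proudman--Johnson expression if the power is divided out
    first. *)
Lemma ej_main t x : t \in `[0, T] -> U 1%N t x != 0 ->
  [/\ rHS_defined T r u t x,
      is_derive x 1 (rHS_integrated T r u t) (rHS T r u t x),
      is_derive x 1 (fun y => rHS_integrated T r u t y / `|Dx u t y| `^ (r - 2))
             ((r - 1) * proudman_johnson T r^-1 u t x) &
      \forall y \near x, rHS_integrated T r u t y = (r - 1) * `|U 1%N t y| `^ (r - 2) * rsrc t y].
Proof.
move=> tT u0; have [d d0 Hd] := ej_near u0.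
have t0 : `|t - t| < d by rewrite subrr normr0.
have x0 : `|x - x| < d by rewrite subrr normr0.
have nearx : \forall y \near x, `|y - x| < d.
  by exists d => //= y; rewrite /= distrC.
have nI : \forall y \near x, rHS_integrated T r u t y = (r - 1) * `|U 1%N t y| `^ (r - 2) * rsrc t y.
  by apply: filterS nearx => y yd; apply: ej_integrated => //; exact: Hd.
pose M s y := (r - 1) * `|U 1%N s y| `^ (r - 2) * U 2%N s y.
have d0' := ej_dx J t x (isT : (0 < 3)%N); have d1' := ej_dx J t x (isT : (1 < 3)%N).
have d2' := ej_dx J t x (isT : (2 < 3)%N).
have DM s y : s \in `[0, T] -> `|s - t| < d -> `|y - x| < d -> Dx (momentum r u) s y = M s y.
  by move=> sT sd yd; apply: is_derive1_derive1; apply: ej_momentum_dx => //; exact: Hd.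
have dA := is_derive1_chain d1' (abs_pow_derive (r - 2) u0).
have dM : is_derive x 1 (M t) ((r - 1) * ((r - 2) * (U 1%N t x * `|U 1%N t x| `^ (r - 2 - 2)) * U 2%N t x) * U 2%N t x
   + (r - 1) * `|U 1%N t x| `^ (r - 2) * U 3%N t x).
  apply: is_derive1_eq (is_derive1M (is_derive1Z (r - 1) dA) d2') _ _ => //; ring.
have dtM : has_dt T (fun s => M s x) t ((r - 1) * ((r - 2) * (U 1%N t x * `|U 1%N t x| `^ (r - 2 - 2)) * V 1%N t x) * U 2%N t x
   + (r - 1) * `|U 1%N t x| `^ (r - 2) * V 2%N t x).
  have h := has_dtZ (c := r - 1) tT (has_dt_comp tT (@ej_dt u U V J 1%N t x isT tT) (abs_pow_derive (r - 2) u0)).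
  apply: (has_dt_eq tT (has_dtM tT h (@ej_dt u U V J 2%N t x isT tT)) _ _) => //; ring.
have dtDM : has_dt T (fun s => Dx (momentum r u) s x) t ((r - 1) * ((r - 2) * (U 1%N t x * `|U 1%N t x| `^ (r - 2 - 2)) * V 1%N t x) * U 2%N t x
   + (r - 1) * `|U 1%N t x| `^ (r - 2) * V 2%N t x).
  by apply: (has_dt_near tT d0 _ dtM) => s sT sd; rewrite DM.
have dMu : is_derive x 1 (fun y => Dx (momentum r u) t y * u t y)
   (M t x * U 1%N t x + U 0%N t x * ((r - 1) * ((r - 2) * (U 1%N t x * `|U 1%N t x| `^ (r - 2 - 2)) * U 2%N t x) * U 2%N t x
   + (r - 1) * `|U 1%N t x| `^ (r - 2) * U 3%N t x)).
  apply: (@is_derive1_near _ (fun y => M t y * U 0%N t y)).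
  by apply: filterS nearx => y yd; rewrite DM // (ej_u J tT).
have [dtd DtE] := has_dt_Dt T0 tT dtDM.
have rn0 : r != 0 by rewrite gt_eqF // (lt_trans ltr01 r1).
split; [split; [|exact: dtd| |exact: is_derive1_derivable dMu]| | |exact: nI].
- exists d; first exact: d0.
  move=> s; rewrite /= distrC => sd sT.
  by apply: is_derive1_derivable (ej_momentum_dx sT _); exact: Hd.
- apply: filterS nearx => y yd.
  by apply: is_derive1_derivable (ej_momentum_dx tT _); exact: Hd.
- apply: (@is_derive1_near _ (fun y => (r - 1) * `|U 1%N t y| `^ (r - 2) * rsrc t y)).
    by apply: filterS nI => y ->.
  apply: is_derive1_eq (is_derive1M (is_derive1Z (r - 1) dA) (rsrc_dx t x)) _ _ => //.
  rewrite /rHS DtE DM // ej_Dx // (is_derive1_derive1 dMu) /M /rsrc.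
  rewrite (abs_powB2 (r - 2) u0); field.
  exact: rn0.
- apply: (@is_derive1_near _ (fun y => (r - 1) * rsrc t y)).
    move: nI nearx; apply: filterS2 => y -> yd; rewrite ej_Dx //.
    rewrite mulrAC -mulrA mulrAC -mulrA; field.
    by rewrite powR_eq0 normr_eq0 negb_and Hd.
  apply: is_derive1_eq (is_derive1Z (r - 1) (rsrc_dx t x)) _ _ => //.
  by rewrite ej_proudman.
Qed.

End EulerJet.

(** * The Riccati equation along the flow *)

Section Quotients.
Context {R : realType}.

Lemma is_derive1_div (f h : R -> R) (x df dh : R) : h x != 0 ->
  is_derive x 1 f df -> is_derive x 1 h dh ->
  is_derive x 1 (fun y => f y / h y) ((df - f x / h x * dh) / h x).
Proof.
move=> h0 Df Dh; apply: is_derive1_eq (is_derive1M Df (is_derive1V h0 Dh)) _ _ => //.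
by field.
Qed.

Lemma has_dt_div (T : R) (f h : R -> R) (t df dh : R) : t \in `[0, T] -> h t != 0 ->
  has_dt T f t df -> has_dt T h t dh ->
  has_dt T (fun y => f y / h y) t ((df - f t / h t * dh) / h t).
Proof.
move=> tT h0 Df Dh; apply: (has_dt_eq tT (has_dtM tT Df (has_dtV tT h0 Dh)) _ _) => //.
by field.
Qed.

End Quotients.

Lemma smooth_curve_jet (R : realType) (T : R) (u : R -> R -> R) : 0 < T -> smooth_curve T u ->
  exists U V, euler_jet T u U V.
Proof.
move=> T0 [C [C0 gC dC]].
exists (cjet T C 0), (cjet T C 1); split.
- by move=> t tT; rewrite cjetE clamp_id //= C0.
- by move=> k t x _; exact: cjet_dx.
- by move=> k t x _ tT; exact: cjet_dt.
- by move=> k t x _; exact: cjet_dx.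
- by move=> k _; exact: cjet_joint.
- by move=> k _; exact: cjet_joint.
Qed.

(** * The Riccati equation in Lagrangian coordinates and its equivalents *)

Section Lagrangian.
Context {R : realType} (T : R) (C : nat -> R -> R -> R) (H : flow_data T C).
Local Notation mu := (@lebesgue_measure R).
Local Notation g := (cjet T C).
Local Notation P := (jac T C).
Local Notation psi := (iflow T C).
Let T0 : 0 < T. Proof. exact: fd_T H. Qed.
Let gC n t : t \in `[0, T] -> gminf (C n t). Proof. exact: (fd_g H). Qed.
Let dC n : curve_derivative T (C n) (C n.+1). Proof. exact: (fd_d H). Qed.

Let P0 t y : P t y != 0.
Proof. by rewrite gt_eqF // jac_gt0. Qed.

Let gdx n k (t y : R) : is_derive y 1 (g n k t) (g n k.+1 t y).
Proof. exact: cjet_dx. Qed.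
Let gdt n k t y : t \in `[0, T] -> has_dt T (fun s => g n k s y) t (g n.+1 k t y).
Proof. exact: cjet_dt. Qed.
Let Pdx (t y : R) : is_derive y 1 (P t) (g 0 2 t y).
Proof. exact: jac_dx. Qed.
Let Pdt t y : t \in `[0, T] -> has_dt T (fun s => P s y) t (g 1 1 t y).
Proof. exact: jac_dt. Qed.
Let gj n k : joint_cont (g n k).
Proof. exact: cjet_joint. Qed.
Let Pj : joint_cont P.
Proof. exact: jac_joint. Qed.

(* [lg t y] is u_x at the point phi(t,y); [lgy, lgt, ...] are its derivatives along
   the Lagrangian coordinates and [lgx, lgxx] are u_xx, u_xxx at phi(t,y). *)
Definition lg t y := g 1 1 t y / P t y.
Definition lgy t y := (g 1 2 t y - lg t y * g 0 2 t y) / P t y.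
Definition lgt t y := (g 2 1 t y - lg t y * g 1 1 t y) / P t y.
Definition lgyy t y := ((g 1 3 t y - (lgy t y * g 0 2 t y + lg t y * g 0 3 t y)) - lgy t y * g 0 2 t y) / P t y.
Definition lgyt t y := ((g 2 2 t y - (lgt t y * g 0 2 t y + lg t y * g 1 2 t y)) - lgy t y * g 1 1 t y) / P t y.
Definition lgx t y := lgy t y / P t y.
Definition lgxy t y := (lgyy t y - lgx t y * g 0 2 t y) / P t y.
Definition lgxt t y := (lgyt t y - lgx t y * g 1 1 t y) / P t y.
Definition lgxx t y := lgxy t y / P t y.

Lemma lg_dx t (y : R) : is_derive y 1 (lg t) (lgy t y).
Proof. exact: (is_derive1_div (P0 t y) (gdx 1 1 t y) (Pdx t y)). Qed.

Lemma lg_dt t y : t \in `[0, T] -> has_dt T (fun s => lg s y) t (lgt t y).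
Proof. by move=> tT; exact: (has_dt_div tT (P0 t y) (@gdt 1 1 t y tT) (@Pdt t y tT)). Qed.

Lemma lgy_dx t (y : R) : is_derive y 1 (lgy t) (lgyy t y).
Proof.
apply: is_derive1_eq (is_derive1_div (P0 t y) (is_derive1B (gdx 1 2 t y) (is_derive1M (lg_dx t y) (gdx 0 2 t y))) (Pdx t y)) _ _ => //.
by rewrite /lgyy; congr (_ / _); rewrite /lgy; ring.
Qed.

Lemma lgy_dt t y : t \in `[0, T] -> has_dt T (fun s => lgy s y) t (lgyt t y).
Proof.
move=> tT.
apply: (has_dt_eq tT (has_dt_div tT (P0 t y) (has_dtB tT (@gdt 1 2 t y tT) (has_dtM tT (@lg_dt t y tT) (@gdt 0 2 t y tT))) (@Pdt t y tT)) _ _) => //.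
by rewrite /lgyt; congr (_ / _); rewrite /lgy; ring.
Qed.

Lemma lgt_dx t (y : R) : is_derive y 1 (lgt t) (lgyt t y).
Proof.
apply: is_derive1_eq (is_derive1_div (P0 t y) (is_derive1B (gdx 2 1 t y) (is_derive1M (lg_dx t y) (gdx 1 1 t y))) (Pdx t y)) _ _ => //.
rewrite /lgyt; congr (_ / _).
have := P0 t y; rewrite /lgt /lgy /lg => p0; field; exact: p0.
Qed.

Lemma lgx_dx t (y : R) : is_derive y 1 (lgx t) (lgxy t y).
Proof. exact: (is_derive1_div (P0 t y) (lgy_dx t y) (Pdx t y)). Qed.

Lemma lgx_dt t y : t \in `[0, T] -> has_dt T (fun s => lgx s y) t (lgxt t y).
Proof. by move=> tT; exact: (has_dt_div tT (P0 t y) (@lgy_dt t y tT) (@Pdt t y tT)). Qed.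

Let joint_div (F : R -> R -> R) : joint_cont F -> joint_cont (fun t y => F t y / P t y).
Proof. by move=> cF; apply: joint_contM => //; exact: joint_contV. Qed.

Lemma lg_joint : joint_cont lg.
Proof. exact: joint_div. Qed.

Lemma lgy_joint : joint_cont lgy.
Proof. by apply: joint_div; apply: joint_contB => //; apply: joint_contM => //; exact: lg_joint. Qed.

Lemma lgt_joint : joint_cont lgt.
Proof. by apply: joint_div; apply: joint_contB => //; apply: joint_contM => //; exact: lg_joint. Qed.

Lemma lgyy_joint : joint_cont lgyy.
Proof.
have j0 := lg_joint; have j1 := lgy_joint.
apply: joint_div; apply: joint_contB; last exact: joint_contM.
by apply: joint_contB => //; apply: joint_contD; exact: joint_contM.
Qed.

Lemma lgyt_joint : joint_cont lgyt.
Proof.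
have j0 := lg_joint; have j1 := lgy_joint; have j2 := lgt_joint.
apply: joint_div; apply: joint_contB; last exact: joint_contM.
by apply: joint_contB => //; apply: joint_contD; exact: joint_contM.
Qed.

Lemma lgx_joint : joint_cont lgx.
Proof. by apply: joint_div; exact: lgy_joint. Qed.

Lemma lgxy_joint : joint_cont lgxy.
Proof.
apply: joint_div; apply: joint_contB; first exact: lgyy_joint.
by apply: joint_contM => //; exact: lgx_joint.
Qed.

Lemma lgxt_joint : joint_cont lgxt.
Proof.
apply: joint_div; apply: joint_contB; first exact: lgyt_joint.
by apply: joint_contM => //; exact: lgx_joint.
Qed.

Lemma lg_bound : exists M : R, 0 < M /\ forall t y, `|lg t y| <= M.
Proof.
have [M [M0 HM]] := cjet_bound T0 gC dC 1 1; have [d d0 Hd] := jac_low H.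
exists (M / d); split; first by rewrite divr_gt0.
move=> t y; rewrite normrM normfV (gtr0_norm (jac_gt0 H t y)).
by apply: ler_pM; rewrite ?invr_ge0 ?(ltW (jac_gt0 H t y)) // lef_pV2 // posrE ?jac_gt0.
Qed.

Lemma lg_decay (e : R) : 0 < e -> exists A : R, 0 < A /\ forall t y, y <= - A -> `|lg t y| <= e.
Proof.
have [d d0 Hd] := jac_low H => e0.
have [A [A0 HA]] := cjet_decay T0 gC dC 1 1 (mulr_gt0 e0 d0).
exists A; split => // t y yA.
rewrite normrM normfV (gtr0_norm (jac_gt0 H t y)) ler_pdivrMr ?jac_gt0 //.
by rewrite (le_trans (HA _ _ yA)) // ler_wpM2l // ltW.
Qed.

Definition eul (k : nat) t x : R :=
  if k is 0%N then g 1 0 t (psi t x) else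
  if k is 1%N then lg t (psi t x) else
  if k is 2%N then lgx t (psi t x) else lgxx t (psi t x).

(** Each entry is a derivative along the particle minus u times the next space derivative, the shape
    dictated by [euler_dt]. *)
Definition eut (k : nat) t x : R :=
  if k is 0%N then g 2 0 t (psi t x) - eul 0 t x * eul 1 t x else
  if k is 1%N then lgt t (psi t x) - eul 0 t x * eul 2 t x else
  lgxt t (psi t x) - eul 0 t x * eul 3 t x.

Lemma eul_dx k t (x : R) : (k < 3)%N -> is_derive x 1 (eul k t) (eul k.+1 t x).
Proof.
case: k => [|[|[|//]]] _.
- by apply: (euler_dx (h := g 1 0) (hx := g 1 1) H x) => y; exact: gdx.
- by apply: (euler_dx (h := lg) (hx := lgy) H x) => y; exact: lg_dx.
- by apply: (euler_dx (h := lgx) (hx := lgxy) H x) => y; exact: lgx_dx.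
Qed.

Lemma eul_joint k : joint_cont (eul k).
Proof.
case: k => [|[|[|k]]]; apply: (euler_joint H).
- exact: gj.
- exact: lg_joint.
- exact: lgx_joint.
- by apply: joint_div; exact: lgxy_joint.
Qed.

(** Commutation of space and time derivatives is verified here by algebra on the Lagrangian
    quotients, not by a theorem on symmetry of second derivatives. *)
Lemma eul_jet u : (forall t, t \in `[0, T] -> u t = eul 0 t) -> euler_jet T u eul eut.
Proof.
move=> hu; split => //.
- by move=> k t x; exact: eul_dx.
- move=> k t x; case: k => [|[|[|//]]] _ tT.
  + by apply: (euler_dt (h := g 1 0) (hx := g 1 1) H) => //; exact: gdt.
  + by apply: (euler_dt (h := lg) (hx := lgy) H) => //; [exact: lg_dx|exact: lgy_joint|exact: lg_dt].
  + by apply: (euler_dt (h := lgx) (hx := lgxy) H) => //; [exact: lgx_dx|exact: lgxy_joint|exact: lgx_dt].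
- have e0 t x := @eul_dx 0 t x isT; have e1 t x := @eul_dx 1 t x isT; have e2 t x := @eul_dx 2 t x isT.
  move=> k t x; case: k => [|[|//]] _.
  + have d2 := euler_dx (h := g 2 0) (hx := g 2 1) H (t := t) x (gdx 2 0 t).
    apply: is_derive1_eq (is_derive1B d2 (is_derive1M (e0 t x) (e1 t x))) _ _ => //.
    rewrite /eut /eul /lgt; set y := psi t x; have := P0 t y; rewrite /lgt /lg => p0.
    by field.
  + have d2 := euler_dx (h := lgt) (hx := lgyt) H (t := t) x (lgt_dx t).
    apply: is_derive1_eq (is_derive1B d2 (is_derive1M (e0 t x) (e2 t x))) _ _ => //.
    rewrite /eut /eul /lgxt; set y := psi t x; have := P0 t y; rewrite /lg => p0.
    by field.
- by move=> k _; exact: eul_joint.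
- move=> k; case: k => [|[|[|//]]] _; apply: joint_contB.
  + by apply: (euler_joint H); exact: gj.
  + by apply: joint_contM; exact: eul_joint.
  + by apply: (euler_joint H); exact: lgt_joint.
  + by apply: joint_contM; exact: eul_joint.
  + by apply: (euler_joint H); exact: lgxt_joint.
  + by apply: joint_contM; exact: eul_joint.
Qed.

Definition riccati (r : R) : Prop :=
  forall t y, t \in `[0, T] -> lgt t y + r^-1 * lg t y ^+ 2 = 0.

Lemma rsrc_eul r t x : rsrc r eul eut t x = lgt t (psi t x) + r^-1 * lg t (psi t x) ^+ 2.
Proof. by rewrite /rsrc /eut /eul; ring. Qed.

Context (r : R) (r1 : 1 < r).
Let r0 : 0 < r := lt_trans ltr01 r1.

Lemma riccati_of_nonzero :
  (forall t y, t \in `]0, T[ -> lg t y != 0 -> lgt t y + r^-1 * lg t y ^+ 2 = 0) -> riccati r.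
Proof.
move=> h t y tT.
apply: (riccati_dense (z := fun s => lg s y) (dz := fun s => lgt s y) T0 _ _ _ tT) => [s sT|s|s sT].
- exact: lg_dt.
- have := @joint_cont_t R lgt y lgt_joint (clamp T s) => c.
  apply: (cvg_comp (clamp T) (fun s => lgt s y) _ c); exact: clamp_continuous.
- exact: h.
Qed.

(* With w = phi_y^(1/r) the Riccati equation reads w_tt = 0. *)
Lemma riccati_root y : riccati r -> forall t, t \in `[0, T] ->
  lg t y * P t y `^ r^-1 = lg 0 y * P 0 y `^ r^-1 /\
  P t y `^ r^-1 = P 0 y `^ r^-1 * (1 + t * lg 0 y / r).
Proof.
move=> ric; have rn0 : r != 0 by rewrite gt_eqF.
have dw t : t \in `[0, T] -> has_dt T (fun s => P s y `^ r^-1) t (r^-1 * (lg t y * P t y `^ r^-1)).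
  move=> tT; apply: (has_dt_eq tT (has_dt_comp tT (@Pdt t y tT) (is_derive1_powR r^-1 (jac_gt0 H t y))) _ _) => //.
  rewrite powRB ?P0 ?implybT // powRr1 ?(ltW (jac_gt0 H t y)) // /lg; field.
  by rewrite P0 rn0.
have dzw t : t \in `[0, T] -> has_dt T (fun s => lg s y * P s y `^ r^-1) t 0.
  move=> tT; apply: (has_dt_eq tT (has_dtM tT (@lg_dt t y tT) (dw t tT)) _ _) => //.
  rewrite (_ : _ + _ = P t y `^ r^-1 * (lgt t y + r^-1 * lg t y ^+ 2)); last by ring.
  by rewrite ric // mulr0.
have c1 t : t \in `[0, T] -> lg t y * P t y `^ r^-1 = lg 0 y * P 0 y `^ r^-1.
  by move=> tT; rewrite (has_dt0_cst T0 dzw).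
move=> t tT; split; first exact: c1.
have dd s : s \in `[0, T] -> has_dt T (fun s => P s y `^ r^-1 - s * (r^-1 * (lg 0 y * P 0 y `^ r^-1))) s 0.
  move=> sT; have did : has_dt T (fun s => s) s 1 by exact: (has_dt_derive sT _ (is_derive1_id s)).
  apply: (has_dt_eq sT (has_dtB sT (dw s sT) (has_dtM sT did (has_dt_cst (r^-1 * (lg 0 y * P 0 y `^ r^-1)) sT))) _ _) => //.
  by rewrite c1 //; ring.
have := has_dt0_cst T0 dd tT; rewrite mul0r subr0 => /eqP; rewrite subr_eq => /eqP ->.
by field.
Qed.

(** The product z phi_y^{1/r} is constant in time and its second factor never vanishes. *)
Lemma riccati_zero y t : riccati r -> t \in `[0, T] -> lg t y = 0 ->
  forall s, s \in `[0, T] -> lg s y = 0.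
Proof.
move=> ric tT z0 s sT.
have [e1 _] := riccati_root y ric tT; have [e2 _] := riccati_root y ric sT.
move: e2; rewrite -e1 z0 mul0r => /eqP; rewrite mulf_eq0 => /orP[/eqP //|].
by rewrite gt_eqF // powR_gt0 // jac_gt0.
Qed.

Definition lagr_eq : Prop := forall t y, t \in `[0, T] ->
  has_dt T (fun s => signed_pow r (lg s y)) t (- ((1 - r^-1) * `|lg t y| `^ r)).

(** Where z <> 0 the two equations differ by the factor (r - 1) |z|^{r-2}. Where z = 0 the chain
    rule may fail, but under the Riccati equation the zero persists for all times, so that
    [signed_pow r] of z is constantly 0 along the particle. *)
Lemma lagr_riccati : lagr_eq <-> riccati r.
Proof.
have rn0 : r != 0 by rewrite gt_eqF.
have rm0 : r - 1 != 0 by rewrite subr_eq0 gt_eqF.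
split=> [L|ric].
  apply: riccati_of_nonzero => t y tT z0; have tT' := subset_itv_oo_cc tT.
  have h := has_dt_comp tT' (@lg_dt t y tT') (signed_pow_derive r z0).
  have := has_dt_unique T0 tT' (L t y tT') h; rewrite (abs_powB2 r z0) => e.
  have p0 : `|lg t y| `^ (r - 2) != 0 by rewrite powR_eq0 normr_eq0 negb_and z0.
  apply: (mulfI rm0); apply: (mulfI p0); rewrite !mulr0.
  move: e; set A := _ `^ (r - 2) => e.
  have -> : A * ((r - 1) * (lgt t y + r^-1 * lg t y ^+ 2)) =
     (r - 1) * A * lgt t y + (1 - r^-1) * (lg t y ^+ 2 * A) by field.
  by rewrite -e addNr.
move=> t y tT; have [z0|z0] := eqVneq (lg t y) 0.
  have zz := riccati_zero ric tT z0.
  apply: (has_dt_eq tT (has_dt_cst 0 tT) _ _) => [s sT|]; first by rewrite zz // signed_pow0.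
  by rewrite z0 normr0 powR0 // mulr0 oppr0.
apply: (has_dt_eq tT (has_dt_comp tT (@lg_dt t y tT) (signed_pow_derive r z0)) _ _) => //.
have -> : lgt t y = - (r^-1 * lg t y ^+ 2) by have := ric t y tT; lra.
by rewrite (abs_powB2 r z0); field.
Qed.

Context (phi : R -> R -> R) (Hphi : forall t, t \in `[0, T] -> phi t = flow T C t).

Lemma phi_Dt t : t \in `[0, T] -> Dt T phi t = g 1 0 t.
Proof.
move=> tT; apply/funext => y.
have h : has_dt T (fun s => phi s y) t (g 1 0 t y).
  by apply: (has_dt_eq tT (@flow_dt R T C H t y tT) _ _) => // s sT; rewrite Hphi.
by have [_] := has_dt_Dt T0 tT h.
Qed.

Lemma phi_velocity t : t \in `[0, T] -> velocity T phi t = eul 0 t.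
Proof. by move=> tT; rewrite /velocity phi_Dt // Hphi. Qed.

Lemma geodesic_lagr : geodesic_equation T r phi <-> lagr_eq.
Proof.
have rn0 : r != 0 by rewrite gt_eqF.
have E t y : t \in `[0, T] -> Dx (Dt T phi) t y / Dx phi t y = lg t y.
  move=> tT; rewrite /Dx phi_Dt // Hphi // (is_derive1_derive1 (gdx 1 0 t y)).
  by rewrite (is_derive1_derive1 (flow_dx H t y)).
split=> [G t y tT|L z m t y tT].
  have [d e] := G t y tT.
  apply: (has_dt_eq tT (derivable_t_has_dt d) _ _) => [s sT|]; first by rewrite E.
  move: e; set D := Dt _ _ _ _; rewrite E // => e.
  by apply: (mulfI rn0); rewrite mulrN mulrA mulrBr divff // mulr1; lra.
have h : has_dt T (fun s => signed_pow r (Dx (Dt T phi) s y / Dx phi s y)) t (- ((1 - r^-1) * `|lg t y| `^ r)).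
  by apply: (has_dt_eq tT (L t y tT) _ _) => // s sT; rewrite E.
have [d ->] := has_dt_Dt (c := m) (x := y) T0 tT h.
split => //; rewrite /z E //; field.
exact: rn0.
Qed.

Lemma geodesic_riccati : geodesic_equation T r phi <-> riccati r.
Proof. by rewrite geodesic_lagr lagr_riccati. Qed.

Lemma lgt_decay t : lgt t y @[y --> -oo] --> (0 : R).
Proof.
have [d d0 Hd] := jac_low H; have [M [M0 HM]] := lg_bound.
apply/cvgrPdist_le => e e0.
have e1 : 0 < e * d / 2 by rewrite divr_gt0 // mulr_gt0.
have e2 : 0 < e * d / 2 / M by rewrite divr_gt0.
have [A [A0 HA]] := cjet_decay T0 gC dC 2 1 e1.
have [B [B0 HB]] := cjet_decay T0 gC dC 1 1 e2.
near=> y.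
have yA : y <= - A by apply: ltW; near: y; apply: nbhs_ninfty_lt; rewrite num_real.
have yB : y <= - B by apply: ltW; near: y; apply: nbhs_ninfty_lt; rewrite num_real.
rewrite sub0r normrN normrM normfV (gtr0_norm (jac_gt0 H t y)) ler_pdivrMr ?jac_gt0 //.
apply: (@le_trans _ _ (e * d)); last by rewrite ler_wpM2l // ltW.
rewrite (le_trans (ler_normB _ _)) // [leRHS](splitr (e * d)) lerD //; first exact: HA.
rewrite normrM -[leRHS](@divfK _ M _) ?gt_eqF // mulrC.
by apply: ler_pM => //; exact: HB.
Unshelve. all: by end_near. Qed.

Lemma lg_cvgNy t : lg t y @[y --> -oo] --> (0 : R).
Proof.
apply/cvgrPdist_le => e e0; have [A [A0 HA]] := lg_decay e0.
near=> y; rewrite sub0r normrN; apply: HA.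
by apply: ltW; near: y; apply: nbhs_ninfty_lt; rewrite num_real.
Unshelve. all: by end_near. Qed.

(** The Proudman--Johnson equation makes [rsrc] constant in space at each time; pulled back to
    particles, the constant is read off at -oo, where z and z_t tend to 0. *)
Lemma proudman_riccati :
  (forall t x, t \in `[0, T] -> proudman_johnson T r^-1 (velocity T phi) t x = 0) <-> riccati r.
Proof.
have J := eul_jet phi_velocity.
split=> [PJ t y tT|ric t x tT]; last first.
  rewrite (ej_proudman r T0 J x tT) -(is_derive1_derive1 (rsrc_dx r J t x)).
  apply: is_derive1_derive1.
  apply: is_derive1_eq (is_derive1_cst 0 x) _ _ => // z.
  by rewrite rsrc_eul ric.
have d0 (x : R) : is_derive x 1 (rsrc r eul eut t) 0.
  by have := rsrc_dx r J t x; rewrite -(ej_proudman r T0 J x tT) PJ.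
pose x := flow T C t y.
have c z : rsrc r eul eut t z = rsrc r eul eut t x by exact: is_derive_0_is_cst.
have E z : lgt t z + r^-1 * lg t z ^+ 2 = lgt t y + r^-1 * lg t y ^+ 2.
  have := c (flow T C t z); rewrite !rsrc_eul /x !(iflowK H); exact.
have l : lgt t z + r^-1 * lg t z ^+ 2 @[z --> -oo] --> (0 + r^-1 * (0 * 0) : R).
  apply: cvgD; first exact: lgt_decay.
  by apply: cvgMl_tmp; apply: cvgM; exact: lg_cvgNy.
have l' : lgt t z + r^-1 * lg t z ^+ 2 @[z --> -oo] --> lgt t y + r^-1 * lg t y ^+ 2.
  by rewrite (_ : (fun z => _) = cst (lgt t y + r^-1 * lg t y ^+ 2)); [exact: cvg_cst|apply/funext => z; rewrite E].
have := cvg_unique _ l' l; rewrite mulr0 mulr0 addr0; exact.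
Qed.

End Lagrangian.

Lemma diffeo_path_flow (R : realType) (T : R) (phi : R -> R -> R) : 0 < T -> diffeo_path T phi ->
  exists C, flow_data T C /\ forall t, t \in `[0, T] -> phi t = flow T C t.
Proof.
move=> T0 [D [C [C0 gC dC]]]; exists C; split.
  split => // t x tT; rewrite C0; have [_] := D t tT; exact.
move=> t tT; apply/funext => y; rewrite /flow cjetE clamp_id //= C0 /derive1n /=; ring.
Qed.

(** * Symmetry of second derivatives and elimination of a forcing term *)

Section MixedPartials.
Context {R : realType}.
Implicit Types (T t x : R) (c : R -> R -> R).

Lemma has_dt_MVT_sym T (f df : R -> R) (a b : R) : 0 < T ->
  (forall t, t \in `[0, T] -> has_dt T f t (df t)) -> a \in `[0, T] -> b \in `[0, T] ->
  exists c : R, [/\ c \in `[0, T], `|c - a| <= `|b - a| & f b - f a = df c * (b - a)].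
Proof.
move=> T0 h aT bT.
have sub (x y z : R) : x \in `[0, T] -> y \in `[0, T] -> z \in `[x, y] -> z \in `[0, T].
  rewrite !in_itv /= => /andP[x0 xT] /andP[y0 yT] /andP[xz zy].
  by rewrite (le_trans x0 xz) (le_trans zy yT).
have [ab|ba] := leP a b.
  have [c cab e] := has_dt_MVT T0 h aT bT ab.
  exists c; split => //; first exact: sub cab.
  by move: cab; rewrite in_itv /= => /andP[h1 h2]; rewrite !ger0_norm; lra.
have [c cab e] := has_dt_MVT T0 h bT aT (ltW ba).
exists c; split; first exact: sub cab.
- by move: cab; rewrite in_itv /= => /andP[h1 h2]; rewrite !ler0_norm; lra.
- by rewrite -opprB e; ring.
Qed.

Lemma MVT_sym (f df : R -> R) (a b : R) : (forall x : R, is_derive x 1 f (df x)) ->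
  exists c : R, `|c - a| <= `|b - a| /\ f b - f a = df c * (b - a).
Proof.
move=> h; have [ab|ba] := leP a b.
  have [c cab e] := MVT_le ab (fun x _ => h x); exists c; split => //.
  by move: cab; rewrite in_itv /= => /andP[h1 h2]; rewrite !ger0_norm; lra.
have [c cab e] := MVT_le (ltW ba) (fun x _ => h x); exists c; split; last by rewrite -opprB e; ring.
by move: cab; rewrite in_itv /= => /andP[h1 h2]; rewrite !ler0_norm; lra.
Qed.

Lemma C1_on_dt T c t x : C1_on T c -> t \in `[0, T] -> has_dt T (fun s => c s x) t (Dt T c t x).
Proof. by move=> [h _ _] tT; have [d _] := h t x tT; exact: derivable_t_has_dt. Qed.

Lemma C1_on_dx T c t x : C1_on T c -> t \in `[0, T] -> is_derive (x : R) 1 (c t) (Dx c t x).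
Proof. by move=> [h _ _] tT; have [_ d] := h t x tT; exact: derivable_is_derive1. Qed.

Lemma C1_on_chain T c (gamma : R -> R) t (dgamma : R) : 0 < T -> C1_on T c -> t \in `[0, T] ->
  has_dt T gamma t dgamma ->
  has_dt T (fun s => c s (gamma s)) t (Dt T c t (gamma t) + Dx c t (gamma t) * dgamma).
Proof.
move=> T0 cc tT hg; apply: (has_dt_chain T0 tT hg); first exact: C1_on_dt.
- by move=> s x sT; exact: (C1_on_dx x cc sT).
- by apply: (continuous_clamp_joint (F := Dx c) T0); case: cc.
Qed.

(** The second difference over a small rectangle with corner (t, x) is evaluated by the mean value
    theorem in both orders; this works at end times too, since the other time can be chosen on the
    admissible side. *)
Lemma Dt_Dx_comm T c t x : 0 < T -> C2_on T c -> t \in `[0, T] ->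
  Dt T (Dx c) t x = Dx (Dt T c) t x.
Proof.
move=> T0 [c1 ct cx] tT; apply/eqP; rewrite -subr_eq0; apply/negP => /negP n0.
pose A s y := Dt T (Dx c) (clamp T s) y; pose B s y := Dx (Dt T c) (clamp T s) y.
have jA : joint_cont A by apply: (continuous_clamp_joint (F := Dt T (Dx c)) T0); case: cx.
have jB : joint_cont B by apply: (continuous_clamp_joint (F := Dx (Dt T c)) T0); case: ct.
set e := `|Dt T (Dx c) t x - Dx (Dt T c) t x| / 2.
have e0 : 0 < e by rewrite divr_gt0 // normr_gt0.
have ball0 (z : R) : \forall w \near z, `|w - z| < e by exists e => //= w; rewrite /= distrC.
have [d1 d10 H1] := joint_cont_near jA (ball0 (A t x)).
have [d2 d20 H2] := joint_cont_near jB (ball0 (B t x)).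
pose d := Num.min d1 d2.
have d0 : 0 < d by rewrite lt_min d10.
have dd1 : d <= d1 by rewrite ge_min lexx.
have dd2 : d <= d2 by rewrite ge_min lexx orbT.
have [s [sT st sd]] := interior_near T0 tT d0.
have sT' := subset_itv_oo_cc sT.
pose h := d / 2; have h0 : 0 < h by rewrite divr_gt0.
have hx : `|x + h - x| < d by rewrite addrAC subrr add0r gtr0_norm // /h; lra.
have dF (y : R) : is_derive y 1 (fun y => c s y - c t y) (Dx c s y - Dx c t y).
  exact: (is_derive1B (C1_on_dx y c1 sT') (C1_on_dx y c1 tT)).
have [xi [xi1 e1]] := MVT_sym x (x + h) dF.
have [tau [tauT tau1 e2]] := has_dt_MVT_sym T0 (fun t' t'T => C1_on_dt (x := xi) cx t'T) tT sT'.
have dG t' : t' \in `[0, T] -> has_dt T (fun t' => c t' (x + h) - c t' x) t' (Dt T c t' (x + h) - Dt T c t' x).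
  by move=> t'T; exact: (has_dtB t'T (C1_on_dt (x := x + h) c1 t'T) (C1_on_dt (x := x) c1 t'T)).
have [tau' [tau'T tau'1 e3]] := has_dt_MVT_sym T0 dG tT sT'.
have [xi' [xi'1 e4]] := MVT_sym x (x + h) (fun y => C1_on_dx y ct tau'T).
have E : Dt T (Dx c) tau xi = Dx (Dt T c) tau' xi'.
  have st0 : s - t != 0 by rewrite subr_eq0.
  have hh0 : h != 0 by rewrite gt_eqF.
  apply: (mulfI st0); apply: (mulfI hh0).
  move: e1 e3; rewrite e2 e4 => e1 e3.
  move: e1 e3; move: (Dt T (Dx c) tau xi) (Dx (Dt T c) tau' xi') => a b e1 e3.
  have -> : h * ((s - t) * a) = a * (s - t) * (x + h - x) by ring.
  have -> : h * ((s - t) * b) = b * (x + h - x) * (s - t) by ring.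
  by rewrite -e1 -e3; ring.
have hA : `|A tau xi - A t x| < e by apply: H1; [exact: le_lt_trans (lt_le_trans sd dd1)|exact: le_lt_trans (lt_le_trans hx dd1)].
have hB : `|B tau' xi' - B t x| < e by apply: H2; [exact: le_lt_trans (lt_le_trans sd dd2)|exact: le_lt_trans (lt_le_trans hx dd2)].
move: hA hB; rewrite /A /B !clamp_id // E => hA hB.
have : `|Dt T (Dx c) t x - Dx (Dt T c) t x| < e + e.
  move: hA hB; move: (Dx (Dt T c) tau' xi') (Dt T (Dx c) t x) (Dx (Dt T c) t x) => w a b hA hB.
  rewrite (_ : a - b = (w - b) - (w - a)); last by ring.
  exact: (le_lt_trans (ler_normB _ _) (ltrD hB hA)).
by rewrite /e -splitr ltxx.
Qed.

(** Integration in space leaves an unknown [c t] that is independent of the particle. Were it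
    nonzero, it would keep half its size on a short time interval; but for a suitable particle both
    [h] and [q] are as small as desired, and the mean value theorem for [h] contradicts this. *)
Lemma forcing_eq0 T (h q : R -> R -> R) (c : R -> R) : 0 < T ->
  (forall t y, t \in `[0, T] -> has_dt T (fun s => h s y) t (c t - q t y)) ->
  continuous (fun t => c (clamp T t)) ->
  (forall e : R, 0 < e -> exists y, forall t, t \in `[0, T] -> `|h t y| <= e /\ `|q t y| <= e) ->
  forall t, t \in `[0, T] -> c t = 0.
Proof.
move=> T0 dh cc small t tT; apply/eqP/negP => /negP ct0.
have nc : 0 < `|c t| by rewrite normr_gt0.
have [d d0 Hd] : exists2 d : R, 0 < d & forall s, s \in `[0, T] -> `|s - t| < d -> `|c t| / 2 <= `|c s|.
  have n2 : 0 < `|c t| / 2 by rewrite divr_gt0.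
  have /cvgrPdist_lt/(_ _ n2)[d /= d0 Hd] := cc t.
  exists d => // s sT sd; have := Hd s; rewrite /= distrC !clamp_id // => /(_ sd) h1.
  have := ler_distD (c s) (c t) 0; rewrite !subr0; lra.
have dd : 0 < Num.min d (1 / 2) by rewrite lt_min d0 /=; lra.
have [s [sT st sd]] := interior_near T0 tT dd.
have sT' := subset_itv_oo_cc sT.
move: sd; rewrite lt_min => /andP[sd s1].
have st0 : 0 < `|s - t| by rewrite normr_gt0 subr_eq0.
(* Three errors of size [k] make 3/8 of [|c t| * |s - t|], less than the half kept by [c]. Since
   [|s - t| < 1/2], the [q] term costs no more than [k]. *)
pose k := `|c t| * `|s - t| / 8.
have k0 : 0 < k by rewrite divr_gt0 // mulr_gt0.
have [y Hy] := small k k0.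
have [xi [xiT xi1 E]] := has_dt_MVT_sym T0 (fun t' t'T => dh t' y t'T) tT sT'.
have hxi := Hd xi xiT (le_lt_trans xi1 sd).
have [a1 _] := Hy _ sT'; have [a2 _] := Hy _ tT; have [_ a3] := Hy _ xiT.
have E' : c xi * (s - t) = h s y - h t y + q xi y * (s - t) by rewrite E; ring.
have b3 : `|q xi y * (s - t)| <= k.
  rewrite normrM -[leRHS]mulr1; apply: ler_pM => //; lra.
have : `|c xi * (s - t)| <= k + k + k.
  by rewrite E' (le_trans (ler_normD _ _)) // lerD // (le_trans (ler_normB _ _)) // lerD.
rewrite normrM => h3.
have h2 : `|c t| / 2 * `|s - t| <= `|c xi| * `|s - t| by rewrite ler_wpM2r.
have h8 : k * 8 = `|c t| * `|s - t| by rewrite /k divfK.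
have w0 : 0 < `|c t| * `|s - t| by rewrite mulr_gt0.
have h4 : `|c t| / 2 * `|s - t| = (`|c t| * `|s - t|) / 2 by ring.
rewrite h4 in h2; move: h8 h3 h2 w0; move: (`|c t| * `|s - t|) (`|c xi| * `|s - t|) => w v; lra.
Qed.

End MixedPartials.

(** * The classical r-Hunter--Saxton equation *)

Section Classical.
Context {R : realType} (T : R) (C : nat -> R -> R -> R) (H : flow_data T C).
Context (r : R) (r1 : 1 < r) (phi : R -> R -> R).
Context (Hphi : forall t, t \in `[0, T] -> phi t = flow T C t).
Let T0 : 0 < T. Proof. exact: fd_T H. Qed.
Let r0 : 0 < r. Proof. exact: lt_trans ltr01 r1. Qed.
Context (u : R -> R -> R) (J : euler_jet T u (eul T C) (eut T C)).

Lemma geodesic_rHS_nonzero : geodesic_equation T r phi ->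
  forall t x, t \in `[0, T] -> Dx u t x != 0 -> rHS_defined T r u t x /\ rHS T r u t x = 0.
Proof.
move=> /(geodesic_riccati H r1 Hphi) ric t x tT; rewrite (ej_Dx J) // => u0.
have [d i _ n] := ej_main T0 r1 J tT u0; split => //.
rewrite -(is_derive1_derive1 i); apply: is_derive1_derive1.
apply: is_derive1_near (is_derive1_cst 0 x); apply: filterS n => y ->.
by rewrite rsrc_eul ric // mulr0.
Qed.

Context (c2 : C2_on T (momentum r u)).
Local Notation m := (momentum r u).
Let c1 : C1_on T m. Proof. by case: c2. Qed.

(** The terms m_x u_x and (1 - 1/r) (|u_x|^r)_x agree by the chain rule where u_x <> 0, and both
    vanish where u_x = 0; at such points m is differentiable by assumption only. *)
Lemma rHS_integrated_dx t (x : R) : t \in `[0, T] ->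
  is_derive x 1 (rHS_integrated T r u t) (rHS T r u t x).
Proof.
move=> tT; have [_ ct cx] := c2.
have d1 := C1_on_dx x ct tT; have d2 := C1_on_dx x cx tT.
have d3 : is_derive x 1 (u t) (eul T C 1 t x).
  by rewrite (ej_u J tT); exact: (ej_dx J t x (isT : (0 < 3)%N)).
have d4 : is_derive x 1 (Dx u t) (eul T C 2 t x).
  by rewrite (ej_Dx J tT); exact: (ej_dx J t x (isT : (1 < 3)%N)).
have d5 := is_derive1M d2 d3.
have d6 := is_derive1Z (1 - r^-1) (is_derive1_chain d4 (abs_pow_derive_gt1 (Dx u t x) r1)).
apply: (is_derive1_eq (is_derive1D (is_derive1D d1 d5) d6)); first by [].
rewrite /rHS (Dt_Dx_comm x T0 c2 tT) (is_derive1_derive1 d5).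
have : (1 - r^-1) * (r * signed_pow r (Dx u t x) * eul T C 2 t x) = Dx m t x * Dx u t x.
  rewrite (ej_Dx J tT); have [z0|z0] := eqVneq (eul T C 1 t x) 0.
    by rewrite z0 signed_pow0 !(mulr0, mul0r).
  rewrite {1}/Dx (is_derive1_derive1 (ej_momentum_dx r J tT z0)) /signed_pow; field.
  by rewrite gt_eqF.
by move=> E; rewrite addrAC E.
Qed.

(** Following the particle absorbs the transport term m_x u; this relates the Eulerian primitive to
    [lagr_eq]. *)
Lemma momentum_along_flow t y : t \in `[0, T] ->
  has_dt T (fun s => signed_pow r (lg T C s y)) t
    (rHS_integrated T r u t (flow T C t y) - (1 - r^-1) * `|lg T C t y| `^ r).
Proof.
move=> tT.
have E s : s \in `[0, T] -> Dx u s (flow T C s y) = lg T C s y.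
  by move=> sT; rewrite (ej_Dx J sT) /eul (iflowK H).
apply: (has_dt_eq tT (C1_on_chain T0 c1 tT (@flow_dt _ _ _ H t y tT)) _ _) => [s sT|].
  by rewrite /momentum E.
rewrite /rHS_integrated E // (ej_u J tT) /eul (iflowK H); ring.
Qed.

(** If the equation holds, its primitive depends on time alone; this is the forcing of
    [forcing_eq0], and it vanishes because z decays at -oo uniformly in time. *)
Lemma rHS_classical_geodesic : geodesic_equation T r phi <->
  forall t x, t \in `[0, T] -> rHS T r u t x = 0.
Proof.
rewrite (geodesic_lagr H r1 Hphi); split=> [L t x tT|h].
  have I0 z : rHS_integrated T r u t z = 0.
    have e := has_dt_unique T0 tT (momentum_along_flow (y := iflow T C t z) tT) (L t (iflow T C t z) tT).
    by move: e; rewrite (flowK H); lra.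
  rewrite -(is_derive1_derive1 (rHS_integrated_dx x tT)); apply: is_derive1_derive1.
  by apply: is_derive1_eq (is_derive1_cst 0 x) _ _.
have cst t x : t \in `[0, T] -> rHS_integrated T r u t x = rHS_integrated T r u t 0.
  move=> tT; apply: is_derive_0_is_cst => y.
  by rewrite -(h t y tT); exact: rHS_integrated_dx.
have [c cE] : exists c : R -> R, forall t, c t = rHS_integrated T r u t 0 by eexists.
have cc : continuous (fun t => c (clamp T t)).
  have [_ ct cx] := c1.
  have j1 := continuous_clamp_joint T0 ct; have j2 := continuous_clamp_joint T0 cx.
  have E : (fun t => c (clamp T t)) = fun t => Dt T m (clamp T t) 0 +
     Dx m (clamp T t) 0 * eul T C 0 (clamp T t) 0 + (1 - r^-1) * `|eul T C 1 (clamp T t) 0| `^ r.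
    apply/funext => t; have tT := clamp_in t T0.
    by rewrite cE /rHS_integrated (ej_Dx J tT) (ej_u J tT).
  rewrite E => t; have cl := clamp_continuous T0 (x := t).
  apply: cvgD; first apply: cvgD.
  - exact: (joint_cont_t (x := 0) j1).
  - apply: cvgM; first exact: (joint_cont_t (x := 0) j2).
    apply: (cvg_comp (clamp T) (fun s => eul T C 0 s 0) cl).
    exact: (joint_cont_t (x := 0) (ej_U J (isT : (0 < 4)%N))).
  - apply: cvgMl_tmp; apply: (cvg_comp (clamp T) (fun s => `|eul T C 1 s 0| `^ r) cl).
    apply: (cvg_comp (fun s => eul T C 1 s 0) (fun z => `|z| `^ r)).
      exact: (joint_cont_t (x := 0) (ej_U J (isT : (1 < 4)%N))).
    exact: abs_pow_continuous.
suff c0 t : t \in `[0, T] -> c t = 0.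
  move=> t y tT; apply: (has_dt_eq tT (momentum_along_flow (y := y) tT) _ _) => //.
  by rewrite cst // -cE c0 // sub0r.
apply: (forcing_eq0 (h := fun s y => signed_pow r (lg T C s y))
  (q := fun s y => (1 - r^-1) * `|lg T C s y| `^ r) T0 _ cc).
  by move=> s y sT; rewrite cE -(cst s (flow T C s y) sT); exact: momentum_along_flow.
move=> k k0.
have /cvgrPdist_le/(_ _ k0)[e1 /= e10 He1] := @signed_pow_continuous R r r1 0.
have /cvgrPdist_le/(_ _ k0)[e2 /= e20 He2] := @abs_pow_continuous R r r1 0.
have e0 : 0 < Num.min e1 e2 / 2 by rewrite divr_gt0 // lt_min e10.
have [A [A0 HA]] := lg_decay H e0.
exists (- A) => s sT; have := HA s (- A) (lexx _); move: (lg T C s (- A)) => z hz.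
have m0 : 0 < Num.min e1 e2 by rewrite lt_min e10.
have hz' : `|z| < Num.min e1 e2 by lra.
move: hz'; rewrite lt_min => /andP[z1 z2]; split.
  by have := He1 z; rewrite /= sub0r normrN signed_pow0 sub0r normrN; apply.
have := He2 z; rewrite /= sub0r normrN normr0 powR0 ?gt_eqF // sub0r normrN => /(_ z2).
apply: le_trans; rewrite normrM ler_piMl //.
have i0 : 0 < r^-1 by rewrite invr_gt0.
have i1 : r^-1 < 1 by rewrite invf_lt1.
by rewrite ger0_norm; lra.
Qed.

End Classical.

(** * Integrals with a parameter and test functions *)

Section ParameterIntegrals.
Context {R : realType}.
Local Notation mu := (@lebesgue_measure R).
Implicit Types (F Ft : R -> R -> R) (a b A B t : R).

Lemma rect_bound F a b A B : joint_cont F ->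
  exists M : R, 0 < M /\ forall t x, t \in `[a, b] -> x \in `[A, B] -> `|F t x| <= M.
Proof.
move=> cF.
have cpt : compact (`[a, b]%classic `*` `[A, B]%classic).
  by apply: compact_setX; exact: segment_compact.
have ci : compact ((fun p : R * R => F p.1 p.2) @` (`[a, b]%classic `*` `[A, B]%classic)).
  by apply: continuous_compact => //; apply: continuous_subspaceT.
have [M [Mr HM]] := compact_bounded ci.
exists (`|M| + 1); split; first by rewrite ltr_pwDr.
move=> t x tab xAB; apply: HM.
  by rewrite (le_lt_trans (ler_norm _)) // ltrDl.
by exists (t, x).
Qed.

Lemma int_param_cont F A B : joint_cont F ->
  continuous (fun t => \int[mu]_(x in `[A, B]) F t x).
Proof.
move=> cF t.
have [M [M0 HM]] := rect_bound (t - 1) (t + 1) A B cF.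
have tI : t \in (`]t - 1, (t + 1)[%classic : set R).
  by rewrite inE /= in_itv /=; apply/andP; split; lra.
apply: (@continuity_under_integral R _ _ mu F `[A, B] _ (t - 1) (t + 1) _ _ (fun=> M)) => //.
- by move=> s _; apply: itv_integrable; exact: joint_cont_x.
- by apply: aeW => x _ s _; exact: joint_cont_t.
- by apply: itv_integrable => x; exact: cvg_cst.
- by move=> s sI; apply: aeW => x xAB; apply: HM => //; exact: subset_itv_oo_cc.
Qed.

Lemma int_param_derive F Ft A B a b : joint_cont F -> joint_cont Ft ->
  (forall t x : R, t \in `]a, b[ -> is_derive t 1 (F ^~ x) (Ft t x)) ->
  forall t : R, t \in `]a, b[ ->
  is_derive t 1 (fun t => \int[mu]_(x in `[A, B]) F t x) (\int[mu]_(x in `[A, B]) Ft t x).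
Proof.
move=> cF cFt dF t tab.
have [M [M0 HM]] := rect_bound a b A B cFt.
have E s x : s \in `]a, b[ -> partial1of2 F s x = Ft s x.
  by move=> sab; rewrite /partial1of2; exact: (is_derive1_derive1 (dF s x sab)).
have I1 s : `]a, b[%classic s -> mu.-integrable `[A, B] (EFin \o F s).
  by move=> _; apply: itv_integrable; exact: joint_cont_x.
have I2 (s x : R) : `]a, b[%classic s -> `[A, B]%classic x -> derivable (F ^~ x) s 1.
  by move=> sab _; have [] := dF s x sab.
have I3 : mu.-integrable `[A, B] (EFin \o (fun=> M)).
  by apply: itv_integrable => x; exact: cvg_cst.
have I4 (s x : R) : `]a, b[%classic s -> `[A, B]%classic x -> `|partial1of2 F s x| <= M.
  by move=> sab xAB; rewrite E //; apply: HM => //; exact: subset_itv_oo_cc.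
have M0' (x : R) : 0 <= M by exact: ltW.
have d := @derivable_under_integral R _ _ mu F `[A, B] (measurable_itv _) t a b tab I1 I2 (fun=> M) M0' I3 I4.
have e := @differentiation_under_integral R _ _ mu F `[A, B] (measurable_itv _) t a b tab I1 I2 (fun=> M) M0' I3 I4.
have -> : \int[mu]_(x in `[A, B]) Ft t x = \int[mu]_(x in `[A, B]) partial1of2 F t x.
  by apply: eq_Rintegral => x _; rewrite E.
by rewrite -e; exact: derivable_is_derive1.
Qed.

Lemma int_param_FTC F Ft A B T : 0 < T -> joint_cont F -> joint_cont Ft ->
  (forall t x : R, t \in `]0, T[ -> is_derive t 1 (F ^~ x) (Ft t x)) ->
  \int[mu]_(t in `[0, T]) \int[mu]_(x in `[A, B]) Ft t x =
  \int[mu]_(x in `[A, B]) F T x - \int[mu]_(x in `[A, B]) F 0 x.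
Proof.
move=> T0 cF cFt dF.
have d := int_param_derive A B cF cFt dF.
have c := int_param_cont (A := A) (B := B) cF.
rewrite {1}/Rintegral (@continuous_FTC2 _ _ (fun t => \int[mu]_(x in `[A, B]) F t x)) //=.
- by apply: within_itv_continuous; exact: int_param_cont.
- split.
  + by move=> t tT; exact: is_derive1_derivable (d t tT).
  + by apply: cvg_at_right_filter; exact: c.
  + by apply: cvg_at_left_filter; exact: c.
- by move=> t tT; exact: is_derive1_derive1 (d t tT).
Qed.

Lemma L1_itv (f : R -> R) a b : continuous f -> L1 (fun x => \1_(`[a, b]) x * f x).
Proof.
move=> cf; have := itv_integrable a b cf; rewrite integrable_mkcond // => h; apply: etrans h.
congr (_.-integrable _ _); apply/funext => x; rewrite /= patchE indicE.
by case: ifP; rewrite /= ?mul1r ?mul0r.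
Qed.

Lemma int_itv_gt0 (f : R -> R) a b c : continuous f -> (forall x, 0 <= f x) -> c \in `]a, b[ ->
  0 < f c -> 0 < \int[mu]_(x in `[a, b]) f x.
Proof.
move=> cf f0; rewrite in_itv /= => /andP[ac cb] fc.
have f2 : 0 < f c / 2 by rewrite divr_gt0.
have /cvgrPdist_lt/(_ _ f2)[d /= d0 Hd] := cf c.
pose e := Num.min (d / 2) (Num.min (c - a) (b - c)).
have e0 : 0 < e by rewrite !lt_min divr_gt0 //= !subr_gt0 ac.
have ed : e <= d / 2 by rewrite ge_min lexx.
have ea : e <= c - a by rewrite ge_min ge_min lexx !orbT.
have eb : e <= b - c by rewrite ge_min ge_min lexx !orbT.
have sub : `[c - e, c + e]%classic `<=` (`[a, b]%classic : set R).
  by move=> x /=; rewrite !in_itv /= => /andP[h1 h2]; apply/andP; split; lra.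
have : \int[mu]_(x in `[c - e, c + e]) (f c / 2) <= \int[mu]_(x in `[a, b]) f x.
  apply: (@le_trans _ _ (\int[mu]_(x in `[c - e, c + e]) f x)).
    apply: le_Rintegral => //.
    - by apply: itv_integrable => x; exact: cvg_cst.
    - exact: itv_integrable.
    move=> x /=; rewrite in_itv /= => /andP[h1 h2].
    have := Hd x; rewrite /= => /(_ _).
    have -> : (`|c - x| < d) by rewrite ltr_norml; apply/andP; split; lra.
    by move=> /(_ isT); rewrite ltr_norml => /andP[h3 h4]; lra.
  rewrite (int_indic _ (measurable_itv `[c - e, c + e])) (int_indic _ (measurable_itv `[a, b])).
  have Lab := L1_itv a b cf; have Lce := L1_itv (c - e) (c + e) cf.
  apply: int_le => // x; rewrite !indicE !mem_setE.
  have := sub x; rewrite /=; case: (x \in `[c - e, c + e]) => [/(_ isT) -> //|_].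
  by rewrite mul0r; apply: mulr_ge0; rewrite ?ler0n.
apply: lt_le_trans; rewrite Rintegral_cst //= lebesgue_measure_itv /= lte_fin.
have ce : c - e < c + e by lra.
by rewrite ce /= mulr_gt0 //; lra.
Qed.

Lemma int_rect_gt0 (K : R -> R -> R) T A B t0 x0 : joint_cont K -> (forall t x, 0 <= K t x) ->
  t0 \in `]0, T[ -> x0 \in `]A, B[ -> 0 < K t0 x0 ->
  0 < \int[mu]_(t in `[0, T]) \int[mu]_(x in `[A, B]) K t x.
Proof.
move=> cK K0 tT xAB Kp; apply: (int_itv_gt0 _ _ tT).
- exact: int_param_cont.
- by move=> t; apply: Rintegral_ge0.
- by apply: (int_itv_gt0 _ _ xAB) => //; exact: joint_cont_x.
Qed.

End ParameterIntegrals.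

(** * Smooth bump functions *)

Section Bump.
Context {R : realType}.
Implicit Types (x c d : R).

(** The classical flat function with a negative power in front: the family over [n] is stable under
    differentiation up to linear combinations, which gives smoothness without any formula for higher
    derivatives. *)
Definition flat (n : nat) x : R := if 0 < x then x ^- n * expR (- x^-1) else 0.

Lemma flat_ge0 n x : 0 <= flat n x.
Proof. by rewrite /flat; case: ltP => // x0; rewrite mulr_ge0 ?expR_ge0 // invr_ge0 exprn_ge0 // ltW. Qed.

Lemma flat_le n x : flat n x <= n.+1%:R ^+ n.+1 * `|x|.
Proof.
rewrite /flat; case: ltP => [x0|_]; last by rewrite mulr_ge0 // exprn_ge0.
pose y := x^-1; have y0 : 0 < y by rewrite invr_gt0.
pose m : R := n.+1%:R; have m0 : 0 < m by [].
(* This is y / m <= exp(y / m) raised to the power m = n+1. The exponential thus beats one power of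
   1/x more than occurs in [flat n], leaving a factor x. *)
have h : (y / m) ^+ n.+1 <= expR y.
  have -> : expR y = expR (y / m) ^+ n.+1.
    by rewrite -expRM_natr -/m divfK // gt_eqF.
  apply: lerXn2r; rewrite ?nnegrE ?expR_ge0 ?divr_ge0 ?ltW //.
  by have := expR_ge1Dx (y / m); move: (y / m) (expR _) => p q; lra.
rewrite expRN ler_pdivrMr ?expR_gt0 // gtr0_norm // -exprVn -/y.
have -> : y ^+ n = m ^+ n.+1 * x * (y / m) ^+ n.+1.
  rewrite expr_div_n [y ^+ n.+1]exprS /y; field.
  by rewrite expf_neq0 ?gt_eqF.
by rewrite ler_wpM2l // mulr_ge0 ?(ltW x0) // exprn_ge0 // ltW.
Qed.

Lemma flat_derive n x : is_derive x 1 (flat n) (- n%:R * flat n.+1 x + flat n.+2 x).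
Proof.
have [x0|x0|->] := ltrgt0P x.
- have xn0 : x != 0 by rewrite gt_eqF.
  apply: (@is_derive1_near _ (fun y => (y^-1) ^+ n * expR (- y^-1))).
    by near=> y; rewrite /flat ifT ?exprVn //; near: y; exact: lt_nbhsr.
  have dI : is_derive x 1 (fun y : R => y^-1) (- x ^- 2).
    by apply: is_derive1_eq (is_derive1V xn0 (is_derive1_id x)) _ _ => //; rewrite mulN1r.
  have dp : is_derive x 1 (fun y : R => y^-1 ^+ n) (- n%:R * x ^- n.+1).
    elim: n => [|n IH].
      by apply: is_derive1_eq (is_derive1_cst 1 x) _ _ => // ; rewrite mulNr mul0r oppr0.
    apply: is_derive1_eq (is_derive1M dI IH) _ _ => [y|]; first by rewrite exprS.
    rewrite -!exprVn -natr1 !exprS; ring.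
  have de := is_derive1_chain (is_derive1N dI) (is_derive_expR (- x^-1)).
  apply: is_derive1_eq (is_derive1M dp de) _ _ => //.
  rewrite /flat x0 -!exprVn !exprS; ring.
- apply: (@is_derive1_near _ (fun=> 0)).
    by near=> y; rewrite /flat ifF //; apply/negbTE; rewrite -leNgt ltW //; near: y; exact: lt_nbhsl.
  apply: is_derive1_eq (is_derive1_cst 0 x) _ _ => //.
  have x0' : (0 < x) = false by apply/negbTE; rewrite -leNgt ltW.
  by rewrite /flat x0' mulr0 addr0.
have f0 k : flat k 0 = 0 by rewrite /flat ltxx.
rewrite !f0 mulr0 addr0; apply/is_derive1P; rewrite f0; apply/cvgrPdist_le => e e0.
pose K : R := n.+2%:R ^+ n.+2; have K0 : 0 < K by rewrite exprn_gt0.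
exists (e / K) => /=; first by rewrite divr_gt0.
move=> s; rewrite /= sub0r normrN ltr_pdivlMr // => se s0.
rewrite sub0r normrN !subr0.
have -> : s^-1 * flat n s = flat n.+1 s.
  by rewrite /flat; case: ltP => _; rewrite ?mulr0 // exprS invfM mulrA.
rewrite ger0_norm ?flat_ge0 // (le_trans (flat_le _ _)) // -/K mulrC ltW //.
Unshelve. all: by end_near. Qed.

Inductive flat_span : (R -> R) -> Prop :=
| flat_span_base n : flat_span (flat n)
| flat_spanD f g : flat_span f -> flat_span g -> flat_span (fun x => f x + g x)
| flat_spanZ c f : flat_span f -> flat_span (fun x => c * f x).

Lemma smooth_coind (S : (R -> R) -> Prop) f :
  (forall f, S f -> der f /\ S (derive1 f)) -> S f -> smooth f.
Proof.
move=> HS Sf; apply/jetP => n; elim: n f Sf => [|n IH] f Sf /=.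
  by have [] := HS _ Sf.
by have [d s] := HS _ Sf; split => //; exact: IH.
Qed.

Lemma smooth_flat n : smooth (flat n).
Proof.
apply: (smooth_coind (S := flat_span)); last exact: flat_span_base.
move=> f; elim=> {f} [k|f g _ [df sf] _ [dg sg]|c f _ [df sf]].
- split; first by move=> x; exact: is_derive1_derivable (flat_derive k x).
  rewrite (is_derive1_fun (flat_derive k)); apply: flat_spanD; last exact: flat_span_base.
  by apply: flat_spanZ; exact: flat_span_base.
- by split; [exact: derD|rewrite derive1_D //; exact: flat_spanD].
- by split; [exact: derZ|rewrite derive1_Z //; exact: flat_spanZ].
Qed.

Lemma derive1_affine f c d : der f ->
  derive1 (fun x => f (c * x + d)) = fun x => c * derive1 f (c * x + d).
Proof.
move=> df; apply: is_derive1_fun => x; rewrite [c * derive1 _ _]mulrC.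
exact: (is_derive1_chain (is_derive1_affine c d x) (derivable_is_derive1 (df _))).
Qed.

Lemma smooth_affine f c d : smooth f -> smooth (fun x => f (c * x + d)).
Proof.
move=> sf; pose S h := exists e f, smooth f /\ h = fun x => e * f (c * x + d).
apply: (smooth_coind (S := S)); last by exists 1, f; split => //; apply/funext => x; rewrite mul1r.
move=> h [e [f' [sf' ->]]].
have df' := sf' 0%N.
have da : der (fun x => f' (c * x + d)).
  by move=> x; apply: is_derive1_derivable (is_derive1_chain (is_derive1_affine c d x) (derivable_is_derive1 (df' _))).
split; first exact: derZ.
exists (e * c), (derive1 f'); split; first by have [] := smooth_derive sf'.
by rewrite (derive1_Z e da) (derive1_affine c d df'); apply/funext => x; rewrite mulrA.
Qed.

Definition bump c d x : R := flat 0 (x - (c - d)) * flat 0 ((c + d) - x).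

Lemma smooth_bump c d : smooth (bump c d).
Proof.
have e1 : (fun x => flat 0 (x - (c - d))) = fun x => flat 0 (1 * x + - (c - d)).
  by apply/funext => x; rewrite mul1r.
have e2 : (fun x => flat 0 ((c + d) - x)) = fun x => flat 0 (-1 * x + (c + d)).
  by apply/funext => x; congr flat; ring.
by apply: smoothM; rewrite ?e1 ?e2; apply: smooth_affine; exact: smooth_flat.
Qed.

Lemma bump_ge0 c d x : 0 <= bump c d x.
Proof. by rewrite mulr_ge0 // flat_ge0. Qed.

Lemma bump_center c d : 0 < d -> 0 < bump c d c.
Proof.
move=> d0; rewrite /bump /flat.
have -> : 0 < c - (c - d) by lra.
have -> : 0 < c + d - c by lra.
by rewrite !expr0 invr1 !mul1r mulr_gt0 ?expR_gt0.
Qed.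

Lemma bump_out c d x : d <= `|x - c| -> bump c d x = 0.
Proof.
rewrite /bump /flat => h; case: (ltP 0 (x - (c - d))) => h1; rewrite ?mul0r //.
case: (ltP 0 (c + d - x)) => h2; rewrite ?mulr0 //.
have : `|x - c| < d by rewrite ltr_norml; apply/andP; split; lra.
by rewrite ltNge h.
Qed.

Lemma derive1n_out (f : R -> R) c d k : smooth f -> (forall x, d <= `|x - c| -> f x = 0) ->
  forall x, d <= `|x - c| -> derive1n k f x = 0.
Proof.
move=> sf f0; elim: k => [//|k IH].
have open_out x : d < `|x - c| -> derive1n k.+1 f x = 0.
  move=> dx; apply: is_derive1_derive1; apply: is_derive1_near (is_derive1_cst 0 x).
  have cn : `|y - c| @[y --> x] --> `|x - c|.
    by apply: cvg_norm; apply: cvgB; [exact: cvg_id|exact: cvg_cst].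
  have : \forall y \near x, d < `|y - c| by exact: (cvgr_gt _ cn).
  by apply: filterS => y dy; apply/esym/IH; rewrite ltW.
move=> x; rewrite le_eqVlt => /predU1P[dx|]; last exact: open_out.
have [d0|d0] := ltP d 0; first by move: d0; rewrite dx ltNge normr_ge0.
(* A nonzero derivative at a boundary point would persist slightly further out, where it is already
   known to vanish. *)
apply/eqP/negP => /negP n0.
have := cvgr_neq0 _ (@smooth_continuous _ f k.+1 sf x) n0.
move=> [e /= e0 He].
pose s : R := if c <= x then 1 else -1.
have hs : d < `|x + s * (e / 2) - c|.
  rewrite dx /s; case: ifP => cx.
    have cx' : c <= x by [].
    rewrite mul1r (@ger0_norm _ (x - c)) ?(@ger0_norm _ (x + e / 2 - c)); lra.
  have cx' : x < c by rewrite ltNge cx.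
  rewrite mulN1r (@ler0_norm _ (x - c)) ?(@ler0_norm _ (x - e / 2 - c)); lra.
have /eqP := open_out _ hs; apply/negP; apply: He => /=.
rewrite opprD addrA subrr add0r normrN normrM (gtr0_norm (divr_gt0 e0 _)) //.
have -> : `|s| = 1 by rewrite /s; case: ifP; rewrite ?normrN normr1.
by lra.
Qed.

Lemma smooth_support_nice f c d : smooth f -> (forall x, d <= `|x - c| -> f x = 0) -> nice f.
Proof.
move=> sf f0 k; split; first exact: sf.
apply: (@L1_support _ _ (c - d) (c + d)); first exact: smooth_continuous.
move=> x; rewrite in_itv /= => h; apply: (@derive1n_out f c d k sf f0).
rewrite leNgt; apply: contra h; rewrite ltr_norml => /andP[h1 h2].
by apply/andP; split; lra.
Qed.

Lemma nice_bump c d : nice (bump c d).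
Proof. exact: (smooth_support_nice (@smooth_bump c d) (@bump_out c d)). Qed.

End Bump.

(** * A localised du Bois-Reymond lemma *)

Section LocalDuBois.
Context {R : realType}.
Local Notation mu := (@lebesgue_measure R).
Implicit Types (F G : R -> R -> R) (a b c d e A B t x : R).

Lemma int_itvB (f g : R -> R) a b : continuous f -> continuous g ->
  \int[mu]_(x in `[a, b]) (f x - g x) = \int[mu]_(x in `[a, b]) f x - \int[mu]_(x in `[a, b]) g x.
Proof. by move=> cf cg; rewrite RintegralB //; exact: itv_integrable. Qed.

Lemma int_itvZ (c : R) (f : R -> R) a b : continuous f ->
  \int[mu]_(x in `[a, b]) (c * f x) = c * \int[mu]_(x in `[a, b]) f x.
Proof. by move=> cf; rewrite RintegralZl //; exact: itv_integrable. Qed.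

Lemma int_rectB F G a b A B : joint_cont F -> joint_cont G ->
  \int[mu]_(t in `[a, b]) \int[mu]_(x in `[A, B]) (F t x - G t x) =
  \int[mu]_(t in `[a, b]) \int[mu]_(x in `[A, B]) F t x
  - \int[mu]_(t in `[a, b]) \int[mu]_(x in `[A, B]) G t x.
Proof.
move=> cF cG; rewrite -int_itvB; try exact: int_param_cont.
by apply: eq_Rintegral => t _; rewrite int_itvB //; exact: joint_cont_x.
Qed.

Lemma int_rectZ (c : R) F a b A B : joint_cont F ->
  \int[mu]_(t in `[a, b]) \int[mu]_(x in `[A, B]) (c * F t x) =
  c * \int[mu]_(t in `[a, b]) \int[mu]_(x in `[A, B]) F t x.
Proof.
move=> cF; rewrite -int_itvZ; try exact: int_param_cont.
by apply: eq_Rintegral => t _; rewrite int_itvZ //; exact: joint_cont_x.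
Qed.

Lemma bump_is_derive c e x k : is_derive x 1 (derive1n k (bump c e)) (derive1n k.+1 (bump c e) x).
Proof. exact: smooth_is_derive (@smooth_bump _ c e). Qed.

Lemma bump_continuous c e k : continuous (derive1n k (bump c e) : R -> R).
Proof. exact: smooth_continuous (@smooth_bump _ c e). Qed.

Lemma bump_derive_out c e x k : e <= `|x - c| -> derive1n k (bump c e) x = 0.
Proof. by apply: derive1n_out; [exact: smooth_bump|exact: bump_out]. Qed.

Lemma bump_mul_derive c e d (f df : R -> R) : 0 < e -> e < d ->
  (forall t, `|t - c| < d -> is_derive t 1 f (df t)) -> forall t,
  is_derive t 1 (fun t => bump c e t * f t) (derive1 (bump c e) t * f t + bump c e t * df t).
Proof.
move=> e0 ed hf t.
have [td|td] := ltP `|t - c| d.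
  apply: is_derive1_eq (is_derive1M (@bump_is_derive c e t 0) (hf t td)) _ _ => //.
  by rewrite addrC [X in X + _]mulrC.
have te : e < `|t - c| by exact: lt_le_trans td.
have -> : derive1 (bump c e) t * f t + bump c e t * df t = 0.
  have -> : derive1 (bump c e) t = 0 by exact: (@bump_derive_out c e t 1 (ltW te)).
  by rewrite (bump_out (ltW te)) !mul0r addr0.
apply: is_derive1_near (is_derive1_cst 0 t).
have cn : `|y - c| @[y --> t] --> `|t - c|.
  by apply: cvg_norm; apply: cvgB; [exact: cvg_id|exact: cvg_cst].
have : \forall y \near t, e < `|y - c| by exact: (cvgr_gt _ cn).
by apply: filterS => y dy; rewrite bump_out ?mul0r // ltW.
Qed.

(** The time derivative of bump times [m] integrates to 0, as the bump vanishes at both end times.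
    Subtracting the hypothesis leaves the integral of bump times [mt - n], which cannot be 0 when
    the bump lies where that difference keeps a sign. Differentiability of [m] is asked only near
    (t0, x0), so that zeros of u_x can be avoided. *)
Lemma local_dubois (m mt n : R -> R -> R) (T t0 x0 d : R) :
  joint_cont m -> joint_cont mt -> joint_cont n -> t0 \in `]0, T[ -> 0 < d ->
  (forall t x, `|t - t0| < d -> `|x - x0| < d -> is_derive t 1 (m ^~ x) (mt t x)) ->
  (forall e, 0 < e -> e < d -> e <= t0 -> e <= T - t0 -> 
     \int[mu]_(t in `[0, T]) \int[mu]_(x in `[x0 - e, x0 + e])
       (derive1 (bump t0 e) t * bump x0 e x * m t x + bump t0 e t * bump x0 e x * n t x) = 0) ->
  mt t0 x0 = n t0 x0.
Proof.
move=> cm cmt cn t0T d0 dm Hint.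
have [T0 t00 tT] : [/\ 0 < T, 0 < t0 & t0 < T].
  by move: t0T; rewrite in_itv /= => /andP[h1 h2]; split => //; exact: lt_trans h2.
apply/eqP; rewrite -subr_eq0; apply/negP => /negP q0.
pose q t x := mt t x - n t x.
have cq : joint_cont q by exact: joint_contB.
pose s : R := if 0 < q t0 x0 then 1 else -1.
have sq : 0 < s * q t0 x0.
  rewrite /s; case: ifPn => [h|]; first by rewrite mul1r.
  by rewrite -leNgt => h; rewrite mulN1r oppr_gt0 lt_neqAle q0.
have csq : joint_cont (fun t x => s * q t x) by exact: joint_contZ.
have := cvgr_gt _ (csq (t0, x0)) _ sq.
rewrite /= => -[[U V] /= [[u /= u0 HU] [v /= v0 HV]] HUV].
(* Small enough for the region of differentiability, for the neighbourhood where [q] keeps its sign,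
   and for the support in time to stay inside [0, T]. *)
pose e := Num.min (d / 2) (Num.min (Num.min (u / 2) (v / 2)) (Num.min t0 (T - t0))).
have e0 : 0 < e by rewrite !lt_min !divr_gt0 //= t00 subr_gt0.
have ed : e < d.
  have : e <= d / 2 by rewrite ge_min lexx.
  by move: d0; lra.
have eu : e < u.
  have : e <= u / 2 by rewrite !ge_min lexx !orbT.
  by move: u0; lra.
have ev : e < v.
  have : e <= v / 2 by rewrite !ge_min lexx !orbT.
  by move: v0; lra.
have et : e <= t0 by rewrite !ge_min lexx !orbT.
have eT : e <= T - t0 by rewrite !ge_min lexx !orbT.
pose a := bump t0 e; pose b := bump x0 e.
have ca k : continuous (derive1n k a) by exact: bump_continuous.
have cb : continuous b by exact: (@bump_continuous x0 e 0).
have jab F k : joint_cont F -> joint_cont (fun t x => derive1n k a t * b x * F t x).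
  move=> cF; apply: joint_contM cF.
  by apply: joint_contM; [exact: joint_cont_fst|exact: joint_cont_snd].
pose G t x := a t * b x * m t x.
pose Gt t x := derive1 a t * b x * m t x + a t * b x * mt t x.
have cG : joint_cont G by exact: (jab m 0%N).
have cGt : joint_cont Gt by apply: joint_contD; [exact: (jab m 1%N)|exact: (jab mt 0%N)].
have dG t x : t \in `]0, T[ -> is_derive t 1 (G ^~ x) (Gt t x).
  move=> _; have [xd|xd] := ltP `|x - x0| d.
    have h := @bump_mul_derive t0 e d (m ^~ x) (mt ^~ x) e0 ed (fun t td => dm t x td xd) t.
    apply: is_derive1_eq (is_derive1Z (b x) h) _ _ => [y|].
      by rewrite /G -/a mulrCA mulrA.
    rewrite /Gt -/a; move: (derive1 a t) (a t) (b x) (m t x) (mt t x) => p1 p2 p3 p4 p5; ring.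
  have bx : b x = 0 by apply: bump_out; apply: le_trans xd; exact: ltW.
  have -> : Gt t x = 0 by rewrite /Gt bx !mulr0 !mul0r addr0.
  by apply: is_derive1_eq (is_derive1_cst 0 t) _ _ => // y; rewrite /G bx mulr0 mul0r.
have a0 t : e <= `|t - t0| -> a t = 0 by exact: bump_out.
have FTC : \int[mu]_(t in `[0, T]) \int[mu]_(x in `[x0 - e, x0 + e]) Gt t x = 0.
  rewrite (int_param_FTC _ _ T0 cG cGt dG) /G.
  have -> : a T = 0 by apply: a0; rewrite ger0_norm ?subr_ge0 // ltW.
  have -> : a 0 = 0 by apply: a0; rewrite sub0r normrN gtr0_norm.
  by rewrite -[RHS](subrr 0); congr (_ - _); rewrite -[RHS](mul0r (\int[mu]_(x in `[x0 - e, x0 + e]) 0)) -RintegralZl //;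
    by [apply: eq_Rintegral => x _; rewrite !mul0r|apply: itv_integrable; move=> y; exact: cvg_cst].
pose K t x := s * (a t * b x * q t x).
have cK : joint_cont K by apply: joint_contZ; exact: (jab q 0%N).
have K0 t x : 0 <= K t x.
  rewrite /K; have [te|te] := leP e `|t - t0|; first by rewrite a0 // !mul0r mulr0.
  have [xe|xe] := leP e `|x - x0|; first by rewrite /b bump_out // mulr0 mul0r mulr0.
  rewrite mulrCA; apply: mulr_ge0; first by rewrite mulr_ge0 // bump_ge0.
  apply/ltW/(HUV (t, x)); split => /=.
    by apply: HU => /=; rewrite distrC; exact: lt_trans eu.
  by apply: HV => /=; rewrite distrC; exact: lt_trans ev.
have Kp : 0 < K t0 x0.
  by rewrite /K mulrCA mulr_gt0 // mulr_gt0 // bump_center.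
have x0I : x0 \in `]x0 - e, (x0 + e)[ by rewrite in_itv /=; apply/andP; split; move: e0; lra.
have := int_rect_gt0 cK K0 t0T x0I Kp.
pose N t x := derive1 a t * b x * m t x + a t * b x * n t x.
have cN : joint_cont N by apply: joint_contD; [exact: (jab m 1%N)|exact: (jab n 0%N)].
have KE : K = fun t x => s * (Gt t x - N t x).
  apply/funext => t; apply/funext => x; rewrite /K /Gt /N /q.
  move: (derive1 a t) (a t) (b x) (m t x) (mt t x) (n t x) => p1 p2 p3 p4 p5 p6; ring.
have hz := Hint e e0 ed et eT.
rewrite KE int_rectZ ?int_rectB //; last exact: joint_contB.
by rewrite FTC /N hz subrr mulr0 ltxx.
Qed.

End LocalDuBois.

(** * Stability of smooth curves under linear combinations and tensor products *)

Section CurveDerivative.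
Context {R : realType}.
Local Notation mu := (@lebesgue_measure R).

Lemma curve_derivativeP (T : R) (c d : R -> R -> R) :
  (forall t, t \in `[0, T] -> gminf (c t)) -> (forall t, t \in `[0, T] -> gminf (d t)) ->
  (curve_derivative T c d <-> forall t k (e : R), t \in `[0, T] -> 0 < e ->
    exists2 b : R, 0 < b & forall s, `|s - t| < b -> s \in `[0, T] -> s != t ->
    \int[mu]_x `|(s - t)^-1 * (derive1n k.+1 (c s) x - derive1n k.+1 (c t) x)
                 - derive1n k.+1 (d t) x| <= e).
Proof.
move=> gc gd.
have E t s k : t \in `[0, T] -> s \in `[0, T] ->
    seminorm k (fun x => time_quotient c t x s - d t x) =
    (\int[mu]_x `|(s - t)^-1 * (derive1n k.+1 (c s) x - derive1n k.+1 (c t) x)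
                 - derive1n k.+1 (d t) x|)%:E.
  move=> tT sT; have [g E] := gminf_quotient (s - t)^-1 (gc s sT) (gc t tT) (gd t tT).
  have E1 x := congr1 (fun f => f x) (E k.+1).
  rewrite /seminorm /time_quotient -(int_norm_EFin (gminfL1 k g)); congr EFin.
  by apply: eq_Rintegral => x _; rewrite E1.
split=> [H t k e tT e0|H t tT k].
  have /fine_cvgP[_ /cvgrPdist_le/(_ _ e0)/near_within_dnbhs[b b0 Hb]] := H t tT k.
  exists b => // s sb sT st; have := Hb s sb sT st.
  by rewrite /= E //= sub0r normrN; apply: le_trans; exact: ler_norm.
apply/fine_cvgP; split.
  by apply/near_within_dnbhs; exists 1 => // s _ sT _; rewrite E.
apply/cvgrPdist_le => e e0; apply/near_within_dnbhs.
have [b b0 Hb] := H t k e tT e0; exists b => // s sb sT st.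
by rewrite /= E //= sub0r normrN ger0_norm; [exact: Hb|exact: int_ge0].
Qed.

Lemma int_quotient_affine (f h w f' h' w' : R -> R) (p q : R) :
  L1 f -> L1 h -> L1 w -> L1 f' -> L1 h' -> L1 w' ->
  \int[mu]_x `|p * ((f x + q * f' x) - (h x + q * h' x)) - (w x + q * w' x)| <=
  \int[mu]_x `|p * (f x - h x) - w x| + `|q| * \int[mu]_x `|p * (f' x - h' x) - w' x|.
Proof.
move=> Lf Lh Lw Lf' Lh' Lw'.
pose v x := p * (f x - h x) - w x; pose v' x := p * (f' x - h' x) - w' x.
have Lv : L1 v by apply: L1B => //; apply: L1Z; exact: L1B.
have Lv' : L1 v' by apply: L1B => //; apply: L1Z; exact: L1B.
rewrite -int_Z; last exact: L1_norm.
rewrite -int_D; [|exact: L1_norm|by apply: L1Z; exact: L1_norm].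
have E x : p * ((f x + q * f' x) - (h x + q * h' x)) - (w x + q * w' x) = v x + q * v' x.
  by rewrite /v /v'; ring.
under eq_Rintegral => x _ do rewrite E.
apply: int_le => [||x].
- by apply: L1_norm; apply: L1D => //; exact: L1Z.
- by apply: L1D; [exact: L1_norm|apply: L1Z; exact: L1_norm].
by rewrite -normrM; exact: ler_normD.
Qed.

Lemma curve_derivative_affine (T q : R) (c d c' d' : R -> R -> R) :
  (forall t, t \in `[0, T] -> gminf (c t)) -> (forall t, t \in `[0, T] -> gminf (d t)) ->
  (forall t, t \in `[0, T] -> gminf (c' t)) -> (forall t, t \in `[0, T] -> gminf (d' t)) ->
  curve_derivative T c d -> curve_derivative T c' d' ->
  curve_derivative T (fun t x => c t x + q * c' t x) (fun t x => d t x + q * d' t x).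
Proof.
move=> gc gd gc' gd' /(curve_derivativeP gc gd) H /(curve_derivativeP gc' gd') H'.
apply/curve_derivativeP => [t tT|t tT|t k e tT e0].
- by apply: gminfD; [exact: gc|apply: gminfZ; exact: gc'].
- by apply: gminfD; [exact: gd|apply: gminfZ; exact: gd'].
have e2 : 0 < e / 2 by rewrite divr_gt0.
have q1 : 0 < 1 + `|q| by rewrite ltr_pwDl.
have e3 : 0 < e / 2 / (1 + `|q|) by rewrite divr_gt0.
have [b b0 Hb] := H t k _ tT e2; have [b' b'0 Hb'] := H' t k _ tT e3.
exists (Num.min b b'); first by rewrite lt_min b0.
move=> s; rewrite lt_min => /andP[sb sb'] sT st.
have J f g : gminf f -> gminf g ->
    derive1n k.+1 (fun x => f x + q * g x) = fun x => derive1n k.+1 f x + q * derive1n k.+1 g x.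
  move=> /gminf_nice[s1 _ _] /gminf_nice[s2 _ _].
  have s3 : smooth (fun x => q * g x) by exact: smoothZ.
  by rewrite (derive1nD k.+1 s1 s3) (derive1nZ k.+1 q s2).
rewrite (J (c s) (c' s) (gc s sT) (gc' s sT)).
rewrite (J (c t) (c' t) (gc t tT) (gc' t tT)).
rewrite (J (d t) (d' t) (gd t tT) (gd' t tT)).
have gs f : gminf f -> L1 (derive1n k.+1 f) by move=> gf; exact: gminfL1.
have h := Hb s sb sT st; have h' := Hb' s sb' sT st.
apply: le_trans (int_quotient_affine _ _ _ _ _ _ _ _) _.
- by apply: gs; exact: gc.
- by apply: gs; exact: gc.
- by apply: gs; exact: gd.
- by apply: gs; exact: gc'.
- by apply: gs; exact: gc'.
- by apply: gs; exact: gd'.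
rewrite [leRHS](splitr e); apply: lerD; first exact: h.
apply: (@le_trans _ _ (`|q| * (e / 2 / (1 + `|q|)))); first by apply: ler_wpM2l h'.
rewrite mulrCA -[leRHS]mulr1 ler_wpM2l ?(ltW e2) // ler_pdivrMr // mul1r.
by rewrite lerDr.
Qed.

Lemma smooth_tensor (T : R) (a h : R -> R) : smooth a -> gminf h ->
  [/\ forall n t, gminf (fun x => derive1n n a t * h x) &
      forall n, curve_derivative T (fun t x => derive1n n a t * h x)
                                   (fun t x => derive1n n.+1 a t * h x)].
Proof.
move=> sa gh.
have g n t : gminf (fun x => derive1n n a t * h x) by exact: gminfZ.
split => // n; apply/curve_derivativeP => // t k e tT e0.
pose N := \int[mu]_x `|derive1n k.+1 h x|.
have N0 : 0 <= N by exact: int_ge0.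
have N1 : 0 < N + 1 by rewrite ltr_wpDl.
have [sh _ _] := gminf_nice gh.
have eN : 0 < e / (N + 1) by rewrite divr_gt0.
have /is_derive1P/cvgrPdist_le/(_ _ eN)[b /= b0 Hb] := smooth_is_derive n t sa.
exists b => // s sb sT st.
have E c : derive1 (derive1n k (fun x => c * h x)) = fun x => c * derive1n k.+1 h x.
  exact: (@derive1nZ _ k.+1).
have L : L1 (fun x => `|derive1n k.+1 h x|) by apply: L1_norm; exact: gminfL1.
pose q := (s - t)^-1 * (derive1n n a s - derive1n n a t) - derive1n n.+1 a t.
have qe : `|q| <= e / (N + 1).
  by have := Hb s; rewrite /= distrC => /(_ sb st); rewrite distrC.
rewrite (E (derive1n n a s)) (E (derive1n n a t)) (E (derive1 (derive1n n a) t)).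
rewrite (_ : (fun x => _) = fun x => `|q| * `|derive1n k.+1 h x|); last first.
  apply/funext => x; rewrite -normrM; congr `|_|; rewrite /q.
  rewrite -[derive1n n.+1 a t]/(derive1 (derive1n n a) t).
  by move: ((s - t)^-1) (derive1n n a s) (derive1n n a t) (derive1 (derive1n n a) t) (derive1n k.+1 h x) => p1 p2 p3 p4 p5; ring.
rewrite int_Z // -/N.
apply: (@le_trans _ _ (e / (N + 1) * N)); first by rewrite ler_wpM2r.
by rewrite -mulrA -[leRHS]mulr1 ler_wpM2l ?(ltW e0) // mulrC ler_pdivrMr // mul1r lerDl.
Qed.

End CurveDerivative.

(** * First variation of the energy *)

Section LineIntegrals.
Context {R : realType}.
Local Notation mu := (@lebesgue_measure R).
Implicit Types (F k : R -> R -> R) (a b M t x : R).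

(** The majorant may depend on time, but its space integral is bounded uniformly in time; this
    allows truncation to compact rectangles and differentiation under the double integral. *)
Record line_dominated F k M : Prop := LineDominated {
  ld_cont : joint_cont F;
  ld_le : forall t x, `|F t x| <= k t x;
  ld_L1 : forall t, L1 (k t);
  ld_int : forall t, \int[mu]_x k t x <= M }.

Section Dominated.
Context F k M (D : line_dominated F k M).

Lemma line_L1 t : L1 (F t).
Proof.
apply: L1_dominated (ld_L1 D t); last exact: ld_le D t.
by apply: continuous_measurable_fun; exact: joint_cont_x (ld_cont D).
Qed.

Lemma line_le t : `|\int[mu]_x F t x| <= M.
Proof.
apply: le_trans (ld_int D t); apply: le_trans (int_norm (line_L1 t)) _.
by apply: int_le; [apply: L1_norm; exact: line_L1|exact: ld_L1 D t|exact: ld_le D t].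
Qed.

Lemma line_trunc_le t (n : nat) : `|\int[mu]_(x in `[- n%:R, n%:R]) F t x| <= M.
Proof.
have c : continuous (F t) by exact: joint_cont_x (ld_cont D).
rewrite int_indic //.
have L : L1 (fun x => \1_(`[- n%:R, n%:R]%classic : set R) x * F t x).
  apply: L1_dominated (ld_L1 D t).
    by apply: measurable_funM; [exact: measurable_indic|exact: continuous_measurable_fun].
  move=> x; rewrite normrM; apply: le_trans (ld_le D t x).
  by rewrite -[leRHS]mul1r ler_wpM2r // indic_le1.
apply: le_trans (ld_int D t); apply: le_trans (int_norm L) _.
apply: int_le; [exact: L1_norm|exact: ld_L1 D t|move=> x].
rewrite normrM; apply: le_trans (ld_le D t x).
by rewrite -[leRHS]mul1r ler_wpM2r // indic_le1.
Qed.

Lemma line_trunc t : \int[mu]_(x in `[- n%:R, n%:R]) F t x @[n --> \oo] --> \int[mu]_x F t x.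
Proof.
have c : continuous (F t) by exact: joint_cont_x (ld_cont D).
under eq_fun => n do rewrite int_indic //.
apply: (int_dct (g := k t)).
- by move=> n; apply: measurable_funM; [exact: measurable_indic|exact: continuous_measurable_fun].
- exact: continuous_measurable_fun.
- exact: ld_L1 D t.
- move=> n x; rewrite normrM; apply: le_trans (ld_le D t x).
  by rewrite -[leRHS]mul1r ler_wpM2r // indic_le1.
apply: aeW => x; apply: cvg_near_cst.
near=> n; rewrite indicE mem_set ?mul1r //= in_itv /= -ler_norml.
near: n; exact: nbhs_infty_ger.
Unshelve. all: by end_near. Qed.

Lemma line_measurable : measurable_fun setT (fun t => \int[mu]_x F t x).
Proof.
apply: (@measurable_fun_cvg _ _ _ setT (fun n t => \int[mu]_(x in `[- n%:R, n%:R]) F t x)).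
- move=> n; apply: continuous_measurable_fun; exact: int_param_cont (ld_cont D).
- by move=> t _; exact: line_trunc.
Qed.

Lemma line_integrable a b : mu.-integrable `[a, b] (EFin \o (fun t => \int[mu]_x F t x)).
Proof.
apply: (@le_integrable _ _ _ mu `[a, b] _ _ (EFin \o (fun=> M))) => //.
- apply/measurable_EFinP; exact: measurable_funTS line_measurable.
- move=> t _; rewrite /= lee_fin; apply: le_trans (line_le t) _; exact: ler_norm.
- by apply: itv_integrable => x; exact: cvg_cst.
Qed.

Lemma line_trunc2 a b :
  \int[mu]_(t in `[a, b]) \int[mu]_(x in `[- n%:R, n%:R]) F t x @[n --> \oo] -->
  \int[mu]_(t in `[a, b]) \int[mu]_x F t x.
Proof.
under eq_fun => n do rewrite int_indic //.
rewrite int_indic //.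
apply: (int_dct (g := fun t => \1_(`[a, b]%classic : set R) t * M)).
- move=> n; apply: measurable_funM; first exact: measurable_indic.
  by apply: continuous_measurable_fun; exact: int_param_cont (ld_cont D).
- by apply: measurable_funM; [exact: measurable_indic|exact: line_measurable].
- by apply: L1_itv => x; exact: cvg_cst.
- move=> n t; rewrite normrM ger0_norm // ler_wpM2l //; exact: line_trunc_le.
by apply: aeW => t; apply: cvgM; [exact: cvg_cst|exact: line_trunc].
Qed.

End Dominated.

(** Differentiation under the integral sign is used twice, in space with majorant [k t] and in time
    with the constant [M]. *)
Lemma int_line_derive (L Ls : R -> R -> R -> R) k a b M (d : R) : 0 < d ->
  (forall s : R, s \in `]- d, d[ -> line_dominated (L s) k M) ->
  (forall s : R, s \in `]- d, d[ -> line_dominated (Ls s) k M) ->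
  (forall s t x : R, s \in `]- d, d[ -> is_derive s 1 (fun s : R => L s t x) (Ls s t x)) ->
  is_derive (0 : R) 1 (fun s : R => \int[mu]_(t in `[a, b]) \int[mu]_x L s t x)
    (\int[mu]_(t in `[a, b]) \int[mu]_x Ls 0 t x).
Proof.
move=> d0 DL DLs dL.
have zI : (0 : R) \in `]- d, d[ by rewrite in_itv /= oppr_lt0 d0.
have d1 (s t : R) : s \in `]- d, d[ ->
    is_derive s 1 (fun s : R => \int[mu]_x L s t x) (\int[mu]_x Ls s t x).
  move=> sI.
  have I1 s' : `]- d, d[%classic s' -> mu.-integrable setT (EFin \o L s' t).
    by move=> sI'; exact: line_L1 (DL s' sI') t.
  have I2 (s' x : R) : `]- d, d[%classic s' -> [set: R] x -> derivable (fun s : R => L s t x) s' 1.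
    by move=> sI' _; have [] := dL s' t x sI'.
  have k0 x : 0 <= k t x by exact: le_trans (normr_ge0 _) (ld_le (DL s sI) t x).
  have E s' x : s' \in `]- d, d[ -> partial1of2 (fun s x => L s t x) s' x = Ls s' t x.
    by move=> sI'; rewrite /partial1of2; exact: (is_derive1_derive1 (dL s' t x sI')).
  have I4 (s' x : R) : `]- d, d[%classic s' -> [set: R] x ->
      `|partial1of2 (fun s x => L s t x) s' x| <= k t x.
    by move=> sI' _; rewrite E //; exact: ld_le (DLs s' sI') t x.
  have D := @derivable_under_integral R _ _ mu (fun s x => L s t x) setT measurableT s (- d) d sI I1 I2
    (k t) k0 (ld_L1 (DL s sI) t) I4.
  have e := @differentiation_under_integral R _ _ mu (fun s x => L s t x) setT measurableT s (- d) d sI I1 I2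
    (k t) k0 (ld_L1 (DL s sI) t) I4.
  have -> : \int[mu]_x Ls s t x = \int[mu]_x partial1of2 (fun s x => L s t x) s x.
    by apply: eq_Rintegral => x _; rewrite E.
  by rewrite -e; exact: derivable_is_derive1.
pose I s t := \int[mu]_x L s t x.
have M0 (t : R) : 0 <= M by exact: le_trans (normr_ge0 _) (line_le (DL 0 zI) 0).
have E s t : s \in `]- d, d[ -> partial1of2 I s t = \int[mu]_x Ls s t x.
  by move=> sI; rewrite /partial1of2; exact: (is_derive1_derive1 (d1 s t sI)).
have I1 s : `]- d, d[%classic s -> mu.-integrable `[a, b] (EFin \o I s).
  by move=> sI; exact: line_integrable (DL s sI) _ _.
have I2 (s t : R) : `]- d, d[%classic s -> `[a, b]%classic t -> derivable (I ^~ t) s 1.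
  by move=> sI _; have [] := d1 s t sI.
have I3 : mu.-integrable `[a, b] (EFin \o (fun=> M)).
  by apply: itv_integrable => x; exact: cvg_cst.
have I4 (s t : R) : `]- d, d[%classic s -> `[a, b]%classic t -> `|partial1of2 I s t| <= M.
  by move=> sI _; rewrite E //; exact: line_le (DLs s sI) t.
have D := @derivable_under_integral R _ _ mu I `[a, b] (measurable_itv _) 0 (- d) d zI I1 I2 (fun=> M) M0 I3 I4.
have e := @differentiation_under_integral R _ _ mu I `[a, b] (measurable_itv _) 0 (- d) d zI I1 I2 (fun=> M) M0 I3 I4.
have -> : \int[mu]_(t in `[a, b]) \int[mu]_x Ls 0 t x = \int[mu]_(t in `[a, b]) partial1of2 I 0 t.
  by apply: eq_Rintegral => x _; rewrite E.
by rewrite -e; exact: derivable_is_derive1.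
Qed.

End LineIntegrals.

Lemma lg_jac (R : realType) (T : R) (C : nat -> R -> R -> R) (H : flow_data T C) t y :
  lg T C t y * jac T C t y = cjet T C 1 1 t y.
Proof. by rewrite /lg divfK // gt_eqF // (jac_gt0 H). Qed.

(** * The energy in Lagrangian coordinates and its first variation *)

Section Energy.
Context {R : realType} (r : R) (r1 : 1 < r).
Local Notation mu := (@lebesgue_measure R).
Let r0 : 0 < r := lt_trans ltr01 r1.

(** One factor |z| is kept because |z| phi_y = |phi_ty| is integrable in space, whereas phi_y tends
    to 1 at infinity. *)
Lemma powR_le_bound (z M : R) : `|z| <= M -> `|z| `^ r <= M `^ (r - 1) * `|z|.
Proof.
move=> zM; rewrite -mulr_powRB1 // mulrC ler_wpM2r //.
by apply: ge0_ler_powR; rewrite ?nnegrE ?subr_ge0 ?(ltW r1) // (le_trans _ zM).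
Qed.

Lemma signed_pow_le_bound (z M : R) : `|z| <= M -> `|signed_pow r z| <= M `^ (r - 1).
Proof.
move=> zM; rewrite norm_signed_pow //.
by apply: ge0_ler_powR; rewrite ?nnegrE ?subr_ge0 ?(ltW r1) // (le_trans _ zM).
Qed.

Lemma variation_bound (z M b q : R) : `|z| <= M ->
  `|r * signed_pow r z * b - (r - 1) * `|z| `^ r * q| <=
  r * M `^ (r - 1) * `|b| + (r - 1) * M `^ r * `|q|.
Proof.
move=> zM; have M0 : 0 <= M by exact: le_trans zM.
have s0 : 0 <= r - 1 by rewrite subr_ge0 ltW.
apply: le_trans (ler_normB _ _) _; rewrite !(normrM _ b) !(normrM _ q).
apply: lerD; apply: ler_wpM2r => //; rewrite normrM.
  by rewrite (gtr0_norm r0) ler_wpM2l ?(ltW r0) // signed_pow_le_bound.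
rewrite (ger0_norm s0) (ger0_norm (powR_ge0 _ _)) ler_wpM2l //.
by apply: ge0_ler_powR; rewrite ?nnegrE ?(ltW r0).
Qed.

Section OnePath.
Context (C : nat -> R -> R -> R) (H : flow_data 1 C) (phi : R -> R -> R).
Context (Hphi : forall t, t \in `[0, 1] -> phi t = flow 1 C t).
Local Notation g := (cjet 1 C).
Local Notation z := (lg 1 C).
Local Notation P := (jac 1 C).

Lemma energy_density_L1 t : L1 (fun y => `|z t y| `^ r * P t y).
Proof.
have [M [M0 HM]] := lg_bound H.
apply: (L1_dominated (g := fun y => M `^ (r - 1) * `|g 1 1 t y|)).
- apply: continuous_measurable_fun; apply: (joint_cont_x (F := fun t y => `|z t y| `^ r * P t y)).
  apply: joint_contM (jac_joint H).
  by apply: (joint_cont_comp (h := fun z => `|z| `^ r)); [exact: abs_pow_continuous|exact: lg_joint H].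
- move=> y; rewrite -(lg_jac H); have := powR_le_bound (HM t y); move: (z t y) => w h.
  by rewrite !normrM (ger0_norm (powR_ge0 _ _)) mulrA ler_wpM2r.
- by apply: L1Z; apply: L1_norm; exact: (cjet_L1 (fd_T H) (fd_g H)).
Qed.

Lemma jac_cvg t : cvg (P t y @[y --> -oo]) /\ cvg (P t y @[y --> +oo]).
Proof.
have gt : gminf (C 0%N (clamp 1 t)) by apply: (fd_g H); exact: clamp_in (fd_T H).
have [_ n _] := gminf_nice gt; have [a b] := nice_cvg0 n.
rewrite /jac cjetE; split; apply/cvg_ex; exists (1 + 0).
  by apply: cvgD; [exact: cvg_cst|exact: a].
by apply: cvgD; [exact: cvg_cst|exact: b].
Qed.

Lemma finsler_flow t : t \in `[0, 1] ->
  (finsler r (phi t) (Dt 1 phi t) `^ r)%E = (\int[mu]_y (`|z t y| `^ r * P t y))%:E.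
Proof.
move=> tT; rewrite /finsler (phi_Dt H Hphi tT) Hphi //.
have E : derive1 (g 1 0 t \o pinv setT (flow 1 C t)) = fun x => z t (iflow 1 C t x).
  apply/funext => x; apply: is_derive1_derive1.
  apply: (euler_dx H (h := g 1 0) (hx := g 1 1)) => y.
  exact: (cjet_dx (fd_T H) (fd_g H)).
rewrite E.
have cz : continuous (fun x => `|z t (iflow 1 C t x)| `^ r).
  apply: (joint_cont_x (F := fun t x => `|z t (iflow 1 C t x)| `^ r)).
  apply: (joint_cont_comp (h := fun z => `|z| `^ r)); first exact: abs_pow_continuous.
  by apply: (euler_joint H); exact: lg_joint H.
have [d d0 Hd] := jac_low H; have [K K0 HK] := flow_near H; have [j1 j2] := jac_cvg t.
rewrite (ldiff_covT (fun y => flow_dx H t y) (@jac_cont _ _ _ H t) d0 (Hd t) (HK t) cz (fun x => powR_ge0 _ _) j1 j2).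
have L := energy_density_L1 t.
rewrite (_ : (\int[mu]_y _)%E = (\int[mu]_y (`|z t y| `^ r * P t y))%:E); last first.
  rewrite /Rintegral fineK; last exact: integrable_fin_num L.
  by apply: eq_integral => y _; rewrite (iflowK H).
rewrite !poweR_EFin -powRrM mulVf ?gt_eqF // powRr1 //.
by apply: int_ge0 => y; rewrite mulr_ge0 ?powR_ge0 // ltW // (jac_gt0 H).
Qed.

Lemma fine_energy : fine (energy r phi) =
  \int[mu]_(t in `[0, 1]) \int[mu]_y (`|z t y| `^ r * P t y).
Proof.
rewrite /energy /Rintegral; congr fine; apply: eq_integral => t.
by rewrite mem_setE => tT; rewrite finsler_flow.
Qed.

End OnePath.

Section Variation.
Context (C D : nat -> R -> R -> R) (H : flow_data 1 C).
Context (gD : forall n t, t \in `[0, 1] -> gminf (D n t)).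
Context (dD : forall n, curve_derivative 1 (D n) (D n.+1)).
Local Notation g := (cjet 1 C).
Local Notation e := (cjet 1 D).
Local Notation z := (lg 1 C).
Local Notation P := (jac 1 C).
Let T0 : (0 : R) < 1 := ltr01.
Let gC n t : t \in `[0, 1] -> gminf (C n t). Proof. exact: (fd_g H). Qed.
Let dC n : curve_derivative 1 (C n) (C n.+1). Proof. exact: (fd_d H). Qed.

Definition vary (s : R) (n : nat) (t x : R) : R := C n t x + s * D n t x.

Lemma vary_cjet s n k t : cjet 1 (vary s) n k t = fun x => g n k t x + s * e n k t x.
Proof.
rewrite !cjetE /vary.
have tT := @clamp_in R 1 t T0.
have [s1 _ _] := gminf_nice (gC n tT); have [s2 _ _] := gminf_nice (gD n tT).
have s3 : smooth (fun x => s * D n (clamp 1 t) x) by exact: smoothZ.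
by rewrite (derive1nD k s1 s3) (derive1nZ k s s2).
Qed.

(** The perturbation changes phi_x by at most [|s| * M], so half of the lower bound [b] survives as
    long as |s| < b / (2 M). *)
Lemma vary_flow_data : exists2 d : R, 0 < d & exists2 q : R, 0 < q &
  forall s, `|s| < d -> flow_data 1 (vary s) /\ forall t x, q <= P t x + s * e 0 1 t x.
Proof.
have [b b0 Hb] := jac_low H; have [M [M0 HM]] := cjet_bound T0 gD dD 0 1.
exists (b / 2 / M); first by rewrite !divr_gt0.
exists (b / 2); first by rewrite divr_gt0.
move=> s sd.
have low t x : b / 2 <= P t x + s * e 0 1 t x.
  have : `|s * e 0 1 t x| <= b / 2.
    rewrite normrM; apply: (@le_trans _ _ (b / 2 / M * M)); last by rewrite divfK ?gt_eqF.
    by apply: ler_pM => //; exact: ltW.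
  rewrite ler_norml => /andP[h _]; have := Hb t x.
  by move: (P t x) (s * _) h => p w; lra.
split; last exact: low.
split; first exact: T0.
- by move=> n t tT; apply: gminfD; [exact: gC|apply: gminfZ; exact: gD].
- move=> n; exact: (curve_derivative_affine s (@gC n) (@gC n.+1) (@gD n) (@gD n.+1) (@dC n) (@dD n)).
move=> t x tT.
have := low t x; rewrite /jac.
have -> : derive1 (vary s 0 t) x = g 0 1 t x + s * e 0 1 t x.
  by have := vary_cjet s 0 1 t; rewrite cjetE clamp_id // => /(congr1 (fun f => f x)).
by move: (g 0 1 t x) (s * _) b0 => p w; lra.
Qed.

Definition vary_lg (s t x : R) : R := (g 1 1 t x + s * e 1 1 t x) / (P t x + s * e 0 1 t x).

Context (phi eta : R -> R -> R) (Hphi : forall t, t \in `[0, 1] -> phi t = flow 1 C t).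
Context (Heta : forall t, t \in `[0, 1] -> eta t = e 0 0 t).

Definition variation (t x : R) : R :=
  r * signed_pow r (z t x) * e 1 1 t x - (r - 1) * `|z t x| `^ r * e 0 1 t x.

(** With P_s = phi_x + s eta_x and z_s P_s = phi_tx + s eta_tx, the s-derivative of |z_s|^r P_s is r
    m_s eta_tx - (r - 1) |z_s|^r eta_x, where m_s = z_s |z_s|^{r-2} and |z_s|^r = z_s m_s.
    Everything is dominated, uniformly in s, by a combination of |phi_tx|, |eta_tx| and |eta_x|. *)
Lemma first_variation : (exists k M, line_dominated variation k M) /\
  is_derive (0 : R) 1 (fun s => fine (energy r (fun t x => phi t x + s * eta t x)))
    (\int[mu]_(t in `[0, 1]) \int[mu]_x variation t x).
Proof.
have [d d0 [q q0 Hd]] := vary_flow_data.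
pose L s t x := `|vary_lg s t x| `^ r * (P t x + s * e 0 1 t x).
pose Ls s t x := r * signed_pow r (vary_lg s t x) * e 1 1 t x
                 - (r - 1) * `|vary_lg s t x| `^ r * e 0 1 t x.
have lgE s t x : lg 1 (vary s) t x = vary_lg s t x.
  by rewrite /lg /jac !vary_cjet /vary_lg /jac addrA.
have L0 t x : vary_lg 0 t x = z t x by rewrite /vary_lg !mul0r !addr0.
have [A [A0 HA]] := cjet_bound T0 gC dC 1 1; have [B [B0 HB]] := cjet_bound T0 gD dD 1 1.
have [Ai [Ai0 HAi]] := cjet_L1_bound T0 gC dC 1 0; have [Bi [Bi0 HBi]] := cjet_L1_bound T0 gD dD 1 0.
have [Qi [Qi0 HQi]] := cjet_L1_bound T0 gD dD 0 0.
pose d' := Num.min d 1.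
have d'0 : 0 < d' by rewrite lt_min d0 ltr01.
have d'E s : s \in `]- d', d'[ -> `|s| < d /\ `|s| <= 1.
  by rewrite in_itv /= -ltr_norml lt_min => /andP[-> /ltW ->].
pose Z := (A + B) / q; have Z0 : 0 < Z by rewrite divr_gt0 // addr_gt0.
have num s t x : `|s| <= 1 -> `|g 1 1 t x + s * e 1 1 t x| <= `|g 1 1 t x| + `|e 1 1 t x|.
  move=> s1; rewrite (le_trans (ler_normD _ _)) // lerD2l normrM.
  by rewrite -[leRHS]mul1r ler_wpM2r.
have zZ s t x : s \in `]- d', d'[ -> `|vary_lg s t x| <= Z.
  move=> /d'E[sd s1]; have [_ /(_ t x) h] := Hd s sd.
  have p0 : 0 < P t x + s * e 0 1 t x by exact: lt_le_trans h.
  rewrite /vary_lg normrM normfV (gtr0_norm p0) /Z; apply: ler_pM => //.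
  - by rewrite invr_ge0 ltW.
  - by apply: le_trans (num s t x s1) _; apply: lerD.
  - by rewrite lef_pV2 ?posrE.
(* The sum of the three coefficients in the bounds for the density and for its derivative, so that
   each of them is at most [c]. *)
pose c := Z `^ (r - 1) + r * Z `^ (r - 1) + (r - 1) * Z `^ r.
have c1 : 0 <= Z `^ (r - 1) by exact: powR_ge0.
have c2 : 0 <= r * Z `^ (r - 1) by rewrite mulr_ge0 // ltW.
have c3 : 0 <= (r - 1) * Z `^ r by rewrite mulr_ge0 ?powR_ge0 // subr_ge0 ltW.
pose k t x := c * (`|g 1 1 t x| + `|e 1 1 t x| + `|e 0 1 t x|).
pose M := c * (Ai + Bi + Qi).
have c0 : 0 <= c by rewrite /c !addr_ge0.
have Lg t : L1 (fun x => `|g 1 1 t x|) by apply: L1_norm; exact: (cjet_L1 T0 gC).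
have Le1 t : L1 (fun x => `|e 1 1 t x|) by apply: L1_norm; exact: (cjet_L1 T0 gD).
have Le0 t : L1 (fun x => `|e 0 1 t x|) by apply: L1_norm; exact: (cjet_L1 T0 gD).
have Lge t : L1 (fun x => `|g 1 1 t x| + `|e 1 1 t x|) by exact: L1D.
have Lk t : L1 (k t) by apply: L1Z; apply: L1D.
have kM t : \int[mu]_x k t x <= M.
  rewrite /k /M int_Z; last by apply: L1D.
  by rewrite (int_D (Lge t) (Le0 t)) (int_D (Lg t) (Le1 t)) ler_wpM2l // !lerD.
have jg : joint_cont (g 1 1) by exact: (cjet_joint T0 gC dC).
have je1 : joint_cont (e 1 1) by exact: (cjet_joint T0 gD dD).
have je0 : joint_cont (e 0 1) by exact: (cjet_joint T0 gD dD).
have jP s : joint_cont (fun t x => P t x + s * e 0 1 t x).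
  by apply: joint_contD (jac_joint H) _; exact: joint_contZ.
have Ppos s t x : s \in `]- d', d'[ -> 0 < P t x + s * e 0 1 t x.
  by move=> /d'E[sd _]; have [_ /(_ t x) h] := Hd s sd; exact: lt_le_trans h.
have jz s : s \in `]- d', d'[ -> joint_cont (vary_lg s).
  move=> sI; apply: joint_contM; first by apply: joint_contD => //; exact: joint_contZ.
  by apply: joint_contV => // t x; rewrite gt_eqF // Ppos.
have kE t x (w1 w2 w3 : R) : 0 <= w1 <= c -> 0 <= w2 <= c -> 0 <= w3 <= c ->
    w1 * `|g 1 1 t x| + w2 * `|e 1 1 t x| + w3 * `|e 0 1 t x| <= k t x.
  move=> /andP[_ h1] /andP[_ h2] /andP[_ h3]; rewrite /k !mulrDr.
  by apply: lerD; [apply: lerD|]; apply: ler_wpM2r.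
have DL s : s \in `]- d', d'[ -> line_dominated (L s) k M.
  move=> sI; split => //.
    apply: joint_contM => //.
    by apply: (joint_cont_comp (h := fun z => `|z| `^ r)); [exact: abs_pow_continuous|exact: jz].
  move=> t x; have p := Ppos s t x sI.
  have -> : `|L s t x| = `|vary_lg s t x| `^ r * (P t x + s * e 0 1 t x).
    by rewrite ger0_norm // mulr_ge0 ?powR_ge0 // ltW.
  apply: (@le_trans _ _ (Z `^ (r - 1) * `|g 1 1 t x + s * e 1 1 t x|)).
    have E : `|g 1 1 t x + s * e 1 1 t x| = `|vary_lg s t x| * (P t x + s * e 0 1 t x).
      by rewrite -[X in _ = _ * X](gtr0_norm p) -normrM /vary_lg divfK // gt_eqF.
    by rewrite E mulrA ler_wpM2r ?(ltW p) // powR_le_bound // zZ.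
  have [_ s1] := d'E s sI.
  apply: (@le_trans _ _ (Z `^ (r - 1) * (`|g 1 1 t x| + `|e 1 1 t x|))).
    by rewrite ler_wpM2l // num.
  apply: le_trans (kE t x (Z `^ (r - 1)) (Z `^ (r - 1)) 0 _ _ _).
  - by rewrite mul0r addr0 mulrDr.
  - by rewrite c1 /c -addrA lerDl addr_ge0.
  - by rewrite c1 /c -addrA lerDl addr_ge0.
  - by rewrite lexx c0.
have DLs s : s \in `]- d', d'[ -> line_dominated (Ls s) k M.
  move=> sI; split => //.
    apply: joint_contB; apply: joint_contM => //; apply: joint_contZ.
      by apply: joint_cont_comp; [exact: signed_pow_continuous|exact: jz].
    by apply: (joint_cont_comp (h := fun z => `|z| `^ r)); [exact: abs_pow_continuous|exact: jz].
  move=> t x; have h := zZ s t x sI.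
  apply: le_trans (kE t x 0 (r * Z `^ (r - 1)) ((r - 1) * Z `^ r) _ _ _).
  - by rewrite mul0r add0r; exact: variation_bound.
  - by rewrite lexx c0.
  - by rewrite c2 /c -addrA addrCA lerDl addr_ge0.
  - by rewrite c3 /c lerDr addr_ge0.
have dL s t x : s \in `]- d', d'[ -> is_derive s 1 (fun s => L s t x) (Ls s t x).
  move=> sI; have p := Ppos s t x sI; have pn := lt0r_neq0 p.
  have dp : is_derive s 1 (fun s => P t x + s * e 0 1 t x) (e 0 1 t x).
    have := is_derive1_affine (e 0 1 t x) (P t x) s.
    by move=> h; apply: is_derive1_eq h _ _ => // y; rewrite addrC mulrC.
  have dg : is_derive s 1 (fun s => g 1 1 t x + s * e 1 1 t x) (e 1 1 t x).
    have := is_derive1_affine (e 1 1 t x) (g 1 1 t x) s.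
    by move=> h; apply: is_derive1_eq h _ _ => // y; rewrite addrC mulrC.
  have dz := @is_derive1_div R (fun s : R => g 1 1 t x + s * e 1 1 t x) (fun s : R => P t x + s * e 0 1 t x) s _ _ pn dg dp.
  have dzr := is_derive1_chain dz (abs_pow_derive_gt1 (vary_lg s t x) r1).
  apply: is_derive1_eq (is_derive1M dzr dp) _ _ => //.
  have E := mul_signed_pow (vary_lg s t x) r0.
  rewrite /Ls -E -/(vary_lg s t x).
  move: (signed_pow r (vary_lg s t x)) (vary_lg s t x) pn => p5 p2.
  move: (P t x + s * e 0 1 t x) (e 0 1 t x) (e 1 1 t x) => p1 p3 p4 pn.
  by field.
have Ls0 : Ls 0 = variation.
  by apply/funext => t; apply/funext => x; rewrite /Ls L0.
have zI : (0 : R) \in `]- d', d'[ by rewrite in_itv /= oppr_lt0 d'0.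
split; first by exists k, M; rewrite -Ls0; exact: DLs.
have := int_line_derive 0 1 d'0 DL DLs dL; rewrite Ls0.
move=> h; apply: is_derive1_near h; near=> s.
have sd : `|s| < d.
  near: s; exists d => //= s; by rewrite /= sub0r normrN.
have [Hs _] := Hd s sd.
rewrite (fine_energy Hs (phi := fun t x => phi t x + s * eta t x)).
  apply: eq_Rintegral => t _; apply: eq_Rintegral => x _.
  by rewrite /L lgE /jac vary_cjet addrA.
move=> t tT; apply/funext => x; rewrite Hphi // Heta // /flow vary_cjet; ring.
Unshelve. all: by end_near. Qed.

End Variation.

End Energy.

(* [|z| `^ (r - 2)] is not continuous at 0 for small [r]; the cut-off at [c] is. *)
Section CutPower.
Context {R : realType}.

Definition cut_pow (a c z : R) : R := Num.max `|z| c `^ a.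

Lemma cut_pow_continuous (a c : R) : 0 < c -> continuous (cut_pow a c).
Proof.
move=> c0 z; rewrite /cut_pow.
have m0 : 0 < Num.max `|z| c by rewrite lt_max c0 orbT.
apply: (@continuous_comp _ _ _ (fun z : R => Num.max `|z| c) (fun y : R => y `^ a)).
  by apply: continuous_max; [exact: norm_continuous|exact: cvg_cst].
exact: is_derive1_continuous (is_derive1_powR a m0).
Qed.

Lemma cut_powE (a c z : R) : c <= `|z| -> cut_pow a c z = `|z| `^ a.
Proof. by move=> h; rewrite /cut_pow max_l. Qed.

End CutPower.

Lemma bounded_away {R : realType} (F : R -> R -> R) (t0 x0 : R) : joint_cont F -> F t0 x0 != 0 ->
  exists2 c : R, 0 < c & exists2 d : R, 0 < d & forall t x : R,
    `|t - t0| < d -> `|x - x0| < d -> c <= `|F t x|.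
Proof.
move=> jF z0.
have n0 : 0 < `|F t0 x0| / 2 by rewrite divr_gt0 // normr_gt0.
exists (`|F t0 x0| / 2) => //.
have jn : joint_cont (fun t x => `|F t x|).
  by apply: joint_cont_comp; [exact: norm_continuous|exact: jF].
have lt2 : `|F t0 x0| / 2 < `|F t0 x0| by move: n0; lra.
have := cvgr_gt _ (jn (t0, x0)) _ lt2.
move=> [[U V] /= [[u /= u0 HU] [v /= v0 HV]] HUV].
exists (Num.min u v); first by rewrite lt_min u0.
move=> t x; rewrite !lt_min => /andP[tu _] /andP[_ xv]; apply/ltW/(HUV (t, x)); split => /=.
  by apply: HU => /=; rewrite distrC.
by apply: HV => /=; rewrite distrC.
Qed.

(** * Critical paths of the energy and the Riccati equation *)

Section EulerLagrange.
Context {R : realType} (r : R) (r1 : 1 < r).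
Local Notation mu := (@lebesgue_measure R).
Context (C : nat -> R -> R -> R) (H : flow_data 1 C) (phi : R -> R -> R).
Context (Hphi : forall t, t \in `[0, 1] -> phi t = flow 1 C t).
Local Notation z := (lg 1 C).
Let r0 : 0 < r. Proof. exact: lt_trans ltr01 r1. Qed.
Let T0 : (0 : R) < 1 := ltr01.

Let jm : joint_cont (fun t x => signed_pow r (z t x)).
Proof. by apply: joint_cont_comp; [exact: signed_pow_continuous|exact: lg_joint H]. Qed.

Let jz : joint_cont (fun t x => `|z t x| `^ r).
Proof.
apply: (joint_cont_comp (h := fun z => `|z| `^ r)); [exact: abs_pow_continuous|exact: lg_joint H].
Qed.

(** Under the Riccati equation the first variation has density equal to the time derivative of r m
    eta_x, and eta_x vanishes at both end times. *)
Lemma riccati_euler_lagrange : riccati 1 C r -> euler_lagrange r phi.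
Proof.
move=> /(lagr_riccati H r1) L eta [D [D0 gD dD]] eta0 eta1.
have Heta t : t \in `[0, 1] -> eta t = cjet 1 D 0 0 t by move=> tT; rewrite cjetE clamp_id // D0.
have [[k [M LD]] h] := first_variation r1 H gD dD Hphi Heta.
apply: is_derive1_eq h _ _ => //.
have lim := line_trunc2 (a := 0) (b := 1) LD.
apply: cvg_unique lim _ => //.
(* The integral over each truncation [-n, n] is exactly 0, hence so is its limit. *)
apply: cvg_near_cst; near=> n.
pose G t x := r * (signed_pow r (z t x) * cjet 1 D 0 1 t x).
have je0 : joint_cont (cjet 1 D 0 1) by exact: (cjet_joint T0 gD dD).
have cG : joint_cont G by apply: joint_contZ; exact: joint_contM.
have dG (t x : R) : t \in `]0, 1[ -> is_derive t 1 (G ^~ x) (variation r C D t x).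
  move=> tI; have tT : t \in `[0, 1] by exact: subset_itv_oo_cc.
  apply: (has_dt_interior tI).
  have d1 := L t x tT; have d2 : has_dt 1 (fun s => cjet 1 D 0 1 s x) t (cjet 1 D 1 1 t x) by apply: (cjet_dt gD dD).
  have h1 := has_dtM tT d1 d2.
  have h2 := has_dtZ (c := r) tT h1.
  refine (@has_dt_eq _ _ _ (G ^~ x) t _ (variation r C D t x) tT h2 _ _) => //.
  rewrite /variation.
  move: (signed_pow _ _) (cjet 1 D 1 1 t x) (cjet 1 D 0 1 t x) (`|z t x| `^ r) => a b c d.
  by field; rewrite gt_eqF.
rewrite (int_param_FTC _ _ T0 cG (ld_cont LD) dG) /G.
have E t : t \in `[0, 1] -> (forall x, eta t x = 0) -> cjet 1 D 0 1 t = fun=> 0.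
  move=> tT et; rewrite cjetE clamp_id // D0 /=.
  have -> : eta t = fun=> 0 by apply/funext.
  by apply/funext => x; exact: (is_derive1_derive1 (is_derive1_cst 0 x)).
rewrite (E 0) ?(E 1) ?in_itv /= ?lexx ?ler01 //.
apply/eqP; rewrite subr_eq0; apply/eqP/eq_Rintegral => x _; by rewrite !mulr0.
Unshelve. all: by end_near. Qed.

Lemma euler_lagrange_riccati : euler_lagrange r phi -> riccati 1 C r.
Proof.
move=> EL; apply: (riccati_of_nonzero H) => t0 x0 t0T z0.
have [c c0 [d d0 Hd]] : exists2 c : R, 0 < c & exists2 d : R, 0 < d & forall t x : R,
    `|t - t0| < d -> `|x - x0| < d -> c <= `|z t x|.
  exact: bounded_away (lg_joint H) z0.
have jl := lgt_joint H.
(* Near (t0, x0) this is the time derivative of m; the cut-off makes it continuous everywhere, as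
   [local_dubois] requires. *)
pose mt t x := (r - 1) * (cut_pow (r - 2) c (z t x) * lgt 1 C t x).
pose n t x := - ((1 - r^-1) * `|z t x| `^ r).
have cmt : joint_cont mt.
  apply: joint_contZ; apply: joint_contM => //.
  by apply: joint_cont_comp; [exact: cut_pow_continuous|exact: lg_joint H].
have cn : joint_cont n by apply: joint_contN; exact: joint_contZ.
have zn t x : `|t - t0| < d -> `|x - x0| < d -> z t x != 0.
  by move=> ht hx; rewrite -normr_gt0 (lt_le_trans c0) // Hd.
pose d' := Num.min d (Num.min t0 (1 - t0)).
have [t00 t01] : 0 < t0 /\ t0 < 1 by move: t0T; rewrite in_itv /= => /andP.
have d'0 : 0 < d' by rewrite !lt_min d0 t00 subr_gt0.
have dm (t x : R) : `|t - t0| < d' -> `|x - x0| < d' ->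
    is_derive t 1 (fun t => signed_pow r (z t x)) (mt t x).
  rewrite !lt_min => /andP[td /andP[h1 h2]] /andP[xd _].
  have tI : t \in `]0, 1[.
    by move: h1 h2; rewrite in_itv /= !ltr_norml => /andP[h1 h2] /andP[h3 h4]; apply/andP; split; lra.
  have tT : t \in `[0, 1] by exact: subset_itv_oo_cc.
  apply: (has_dt_interior tI).
  have h := has_dt_comp tT (lg_dt H (y := x) tT) (signed_pow_derive r (zn t x td xd)).
  apply: (@has_dt_eq _ _ _ (fun t => signed_pow r (z t x)) t _ (mt t x) tT h) => //.
  by rewrite /mt cut_powE ?mulrA // Hd.
have key := local_dubois jm cmt cn t0T d'0 dm.
have : mt t0 x0 = n t0 x0.
  apply: key => e e0 ed et eT.
  pose a := bump t0 e; pose b := bump x0 e.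
  have sa : smooth a by exact: smooth_bump.
  have [gb db] := nice_prim_gminf (nice_bump x0 e).
  have [gD dD] := smooth_tensor 1 sa gb.
  pose D n t x := derive1n n a t * prim b x.
  pose eta t x := a t * prim b x.
  have a0 t : e <= `|t - t0| -> a t = 0 by exact: bump_out.
  have gD' k t : t \in `[0, 1] -> gminf (D k t) by move=> _; exact: gD.
  have J k t : t \in `[0, 1] -> cjet 1 D k 1 t = fun x => derive1n k a t * b x.
    move=> tT; rewrite cjetE clamp_id // /D.
    have [s _ _] := gminf_nice gb.
    by rewrite (derive1nZ 1 _ s) /= db.
  have Heta t : t \in `[0, 1] -> eta t = cjet 1 D 0 0 t by move=> tT; rewrite cjetE clamp_id.
  have [[k [M LD]] h] := first_variation r1 H gD' dD Hphi Heta.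
  have h0 : is_derive (0 : R) 1 (fun s => fine (energy r (fun t x => phi t x + s * eta t x))) 0.
    apply: EL.
    - by exists D; split => //; exact: dD.
    - by move=> x; rewrite /eta a0 ?mul0r // sub0r normrN gtr0_norm.
    - by move=> x; rewrite /eta a0 ?mul0r // gtr0_norm ?subr_gt0.
  have hv : \int[mu]_(t in `[0, 1]) \int[mu]_x variation r C D t x = 0.
    by rewrite -(is_derive1_derive1 h) (is_derive1_derive1 h0).
  have rn : r != 0 by rewrite gt_eqF.
  (* The first variation is [r] times the integral that has to vanish. *)
  apply: (mulfI rn); rewrite mulr0 -[RHS]hv.
  have ca k' : continuous (derive1n k' a) by exact: bump_continuous.
  have cb : continuous b by exact: (@bump_continuous _ x0 e 0).
  have jab F k' : joint_cont F -> joint_cont (fun t x => derive1n k' a t * b x * F t x).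
    move=> cF; apply: joint_contM cF.
    by apply: joint_contM; [exact: joint_cont_fst|exact: joint_cont_snd].
  rewrite -int_rectZ; last by apply: joint_contD; [exact: (jab _ 1%N)|exact: (jab n 0%N)].
  apply: eq_Rintegral => t; rewrite mem_setE => tT.
  rewrite (@int_support _ (variation r C D t) (x0 - e) (x0 + e)); last first.
    move=> x xI; have bx : b x = 0.
      apply: bump_out; rewrite leNgt; apply: contra xI; rewrite ltr_norml in_itv /= => /andP[p1 p2].
      by apply/andP; split; move: p1 p2; lra.
    by rewrite /variation !J // bx !mulr0 subrr.
  apply: eq_Rintegral => x _; rewrite /variation !J // /n -/a -/b /=.
  move: (derive1 a t) (a t) (b x) (signed_pow _ _) (`|z t x| `^ r) => p1 p2 p3 p4 p5.
  by field; rewrite gt_eqF.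
have zz : z t0 x0 != 0 by apply: zn; rewrite subrr normr0.
rewrite /mt /n cut_powE; last by apply: Hd; rewrite subrr normr0.
rewrite (abs_powB2 r zz).
have p0 : `|z t0 x0| `^ (r - 2) != 0 by rewrite gt_eqF // powR_gt0 // normr_gt0.
have rm : r - 1 != 0 by rewrite subr_eq0 gt_eqF.
have rn : r != 0 by rewrite gt_eqF.
move: (z t0 x0) (lgt 1 C t0 x0) (`|z t0 x0| `^ (r - 2)) p0 => w l p p0 E.
have : (r - 1) * p * (l + r^-1 * w ^+ 2) = 0.
  rewrite mulrDr -mulrA E; field; exact: rn.
by move/eqP; rewrite !mulf_eq0 (negbTE rm) (negbTE p0) /= => /eqP.
Qed.

End EulerLagrange.

(** * The weak r-Hunter--Saxton equation *)

Section WeakForm.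
Context {R : realType} (T r : R) (T0 : 0 < T) (r1 : 1 < r).
Local Notation mu := (@lebesgue_measure R).
Let r0 : 0 < r. Proof. exact: lt_trans ltr01 r1. Qed.

Lemma far_near (M x : R) : M < `|x| -> \forall y \near x, M < `|y|.
Proof.
have cn : `|y| @[y --> x] --> `|x| by apply: cvg_norm; exact: cvg_id.
exact: (cvgr_gt _ cn).
Qed.

Lemma C2c_support (eta : R -> R -> R) : C2c T eta -> exists M : R, [/\ 0 < M,
  forall t x, M < `|x| -> [/\ eta t x = 0, Dx eta t x = 0, Dx (Dx eta) t x = 0 &
                              t \in `[0, T] -> Dt T (Dx eta) t x = 0],
  Dx eta 0 = fun=> 0 & Dx eta T = fun=> 0].
Proof.
move=> [c2 [a [b [M [a0 bT H]]]]]; exists (`|M| + 1); split; first by rewrite ltr_pwDr.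
- move=> t x Mx.
  have Mx' : M < `|x| by apply: le_lt_trans Mx; apply: le_trans (ler_norm _) _; rewrite lerDl.
  have e0 s y : M < `|y| -> eta s y = 0 by move=> h; apply: H; rewrite h !orbT.
  have e1 s y : M < `|y| -> Dx eta s y = 0.
    move=> /far_near h; apply: is_derive1_derive1; apply: is_derive1_near (is_derive1_cst 0 y).
    by apply: filterS h => w hw; rewrite e0.
  split; [exact: e0|exact: e1| |].
    apply: is_derive1_derive1; apply: is_derive1_near (is_derive1_cst 0 x).
    by apply: filterS (far_near Mx') => w hw; rewrite e1.
  move=> tT; have [_ _ c1] := c2.
  have h := @C1_on_dt _ T _ t x c1 tT.
  apply: (has_dt_unique T0 tT h).
  by apply: (has_dt_eq tT (has_dt_cst 0 tT) _ _) => // s sT; rewrite e1.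
- apply/funext => x; apply: is_derive1_derive1; apply: is_derive1_eq (is_derive1_cst 0 x) _ _ => // y.
  by rewrite H // a0.
- apply/funext => x; apply: is_derive1_derive1; apply: is_derive1_eq (is_derive1_cst 0 x) _ _ => // y.
  by rewrite H // bT orbT.
Qed.

Context (u : R -> R -> R) (U V : nat -> R -> R -> R) (J : euler_jet T u U V).

(** Besides m eta_xt, expansion leaves m (u eta_xx - u_xx eta). Since m u_xx = (|u_x|^r)_x / r, an
    integration by parts removes u_xx, and eta enters only through eta_x. No derivative of m
    occurs. *)
Lemma weak_inner (eta : R -> R -> R) t : C2c T eta -> t \in `[0, T] ->
  \int[mu]_x (momentum r u t x *
        (Dt T (Dx eta) t x - derive1 (fun y => Dx u t y * eta t y) x
         + derive1 (fun y => u t y * Dx eta t y) x)) =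
  \int[mu]_x (signed_pow r (U 1%N t x) * (Dt T (Dx eta) t x + U 0%N t x * Dx (Dx eta) t x)
              + r^-1 * `|U 1%N t x| `^ r * Dx eta t x).
Proof.
move=> ceta tT; have [M [M0 HM _ _]] := C2c_support ceta.
have [[c1 _ c3] _] := ceta.
have jt : continuous (Dt T (Dx eta) t).
  have [_ h _] := c3; have := continuous_clamp_joint (F := Dt T (Dx eta)) T0 h.
  by move=> /joint_cont_x => /(_ t); rewrite clamp_id.
have jxx : continuous (Dx (Dx eta) t).
  have [_ _ h] := c3; have := continuous_clamp_joint (F := Dx (Dx eta)) T0 h.
  by move=> /joint_cont_x => /(_ t); rewrite clamp_id.
have dx0 (x : R) : is_derive x 1 (eta t) (Dx eta t x) by exact: C1_on_dx c1 tT.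
have dx1 (x : R) : is_derive x 1 (Dx eta t) (Dx (Dx eta) t x) by exact: C1_on_dx c3 tT.
have jx : continuous (Dx eta t) by move=> x; exact: is_derive1_continuous (dx1 x).
have j0 : continuous (eta t) by move=> x; exact: is_derive1_continuous (dx0 x).
have cU k : (k < 4)%N -> continuous (U k t) by move=> k4; exact: joint_cont_x (ej_U J k4).
have dU k (x : R) : (k < 3)%N -> is_derive x 1 (U k t) (U k.+1 t x) by exact: (ej_dx J).
pose sp x := signed_pow r (U 1%N t x).
pose ab x := `|U 1%N t x| `^ r.
have csp : continuous sp.
  move=> x; apply: (@continuous_comp _ _ _ (U 1%N t) (signed_pow r)); first exact: cU.
  exact: signed_pow_continuous.
have cab : continuous ab.
  move=> x; apply: (@continuous_comp _ _ _ (U 1%N t) (fun z => `|z| `^ r)); first exact: cU.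
  exact: abs_pow_continuous.
pose Q x := r^-1 * (ab x * eta t x).
pose Q' x := r^-1 * (ab x * Dx eta t x + eta t x * (r * sp x * U 2%N t x)).
have dQ (x : R) : is_derive x 1 Q (Q' x).
  have h := is_derive1_chain (dU 1%N x isT) (abs_pow_derive_gt1 (U 1%N t x) r1).
  exact: is_derive1Z (is_derive1M h (dx0 x)).
have cM (f h : R -> R) : continuous f -> continuous h -> continuous (fun x => f x * h x).
  by move=> cf ch x; exact: cvgM (cf x) (ch x).
have cA (f h : R -> R) : continuous f -> continuous h -> continuous (fun x => f x + h x).
  by move=> cf ch x; exact: cvgD (cf x) (ch x).
have cC (c : R) : continuous (fun _ : R => c) by move=> x; exact: cvg_cst.
have cQ' : continuous Q'.
  apply: (cM _ _) => //; apply: (cA _ _); first exact: (cM _ _).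
  by apply: (cM _ _) => //; apply: (cM _ _); [apply: (cM _ _)|exact: cU].
pose N := M + 1.
have far x : x \notin `[- N, N] -> M < `|x|.
  move=> h; rewrite ltNge; apply: contra h; rewrite ler_norml in_itv /= => /andP[h1 h2].
  by apply/andP; split; move: h1 h2; rewrite /N; lra.
have Q'0 x : x \notin `[- N, N] -> Q' x = 0.
  by move=> /far h; have [e0 e1 _ _] := HM t x h; rewrite /Q' e0 e1 mulr0 mul0r addr0 mulr0.
have intQ : \int[mu]_x Q' x = 0.
  have NN : - N <= N by move: M0; rewrite /N; lra.
  have MN : M < `|N| by rewrite gtr0_norm; move: M0; rewrite /N; lra.
  have MN' : M < `|- N| by rewrite normrN.
  rewrite (int_support Q'0) (int_FTC NN dQ cQ') /Q.
  have [e0 _ _ _] := HM t N MN; have [e1 _ _ _] := HM t (- N) MN'.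
  by rewrite e0 e1 !mulr0 subrr.
have E x : momentum r u t x *
        (Dt T (Dx eta) t x - derive1 (fun y => Dx u t y * eta t y) x
         + derive1 (fun y => u t y * Dx eta t y) x) =
    (sp x * (Dt T (Dx eta) t x + U 0%N t x * Dx (Dx eta) t x) + r^-1 * ab x * Dx eta t x) - Q' x.
  have e1 : derive1 (fun y => Dx u t y * eta t y) x = U 1%N t x * Dx eta t x + eta t x * U 2%N t x.
    rewrite (ej_Dx J tT); exact: is_derive1_derive1 (is_derive1M (dU 1%N x isT) (dx0 x)).
  have e2 : derive1 (fun y => u t y * Dx eta t y) x = U 0%N t x * Dx (Dx eta) t x + Dx eta t x * U 1%N t x.
    rewrite (ej_u J tT); exact: is_derive1_derive1 (is_derive1M (dU 0%N x isT) (dx1 x)).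
  rewrite e1 e2 (ej_momentum _ J tT) /Q' -/(sp x).
  move: (sp x) (ab x) (Dt T (Dx eta) t x) (U 0%N t x) (U 1%N t x) (U 2%N t x) (eta t x).
  move: (Dx eta t x) (Dx (Dx eta) t x) => p1 p2 p3 p4 p5 p6 p7 p8 p9.
  by field; rewrite gt_eqF.
under eq_Rintegral => x _ do rewrite E.
have L1Q : L1 Q' by exact: L1_support cQ' Q'0.
rewrite int_B // ?intQ ?subr0 //.
apply: (@L1_support _ _ (- N) N).
  apply: (cA _ _).
    apply: (cM _ _) => //; apply: (cA _ _) => //; apply: (cM _ _) => //; exact: cU.
  by apply: (cM _ _) => //; apply: (cM _ _).
move=> x /far h; have [_ e1 e2 e3] := HM t x h.
by rewrite e1 e2 (e3 tT) !mulr0 !addr0 mulr0.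
Qed.

End WeakForm.

(** * From the Riccati equation to the weak equation *)

Section WeakLagrangian.
Context {R : realType} (T : R) (C : nat -> R -> R -> R) (H : flow_data T C).
Local Notation mu := (@lebesgue_measure R).
Context (r : R) (r1 : 1 < r) (phi : R -> R -> R).
Context (Hphi : forall t, t \in `[0, T] -> phi t = flow T C t).
Local Notation z := (lg T C).
Local Notation X := (flow T C).
Local Notation P := (jac T C).
Let T0 : 0 < T. Proof. exact: fd_T H. Qed.
Let r0 : 0 < r. Proof. exact: lt_trans ltr01 r1. Qed.

Let Hu t : t \in `[0, T] -> velocity T phi t = eul T C 0 t.
Proof. exact: (phi_velocity H Hphi). Qed.

Lemma weak_inner_velocity (eta : R -> R -> R) t : C2c T eta -> t \in `[0, T] ->
  \int[mu]_x (momentum r (velocity T phi) t x *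
        (Dt T (Dx eta) t x - derive1 (fun y => Dx (velocity T phi) t y * eta t y) x
         + derive1 (fun y => velocity T phi t y * Dx eta t y) x)) =
  \int[mu]_x (signed_pow r (eul T C 1 t x) * (Dt T (Dx eta) t x + eul T C 0 t x * Dx (Dx eta) t x)
              + r^-1 * `|eul T C 1 t x| `^ r * Dx eta t x).
Proof. exact: (weak_inner T0 r1 (eul_jet H Hu)). Qed.

(** Pulled back by x = phi(t, y), the integrand becomes, particle by particle, the time derivative
    of m (eta_x o phi) phi_y; eta vanishes near the end times, so nothing remains after
    integration. *)
Lemma riccati_weak : riccati T C r -> rHS_weak T r (velocity T phi).
Proof.
move=> /(lagr_riccati H r1) L eta ceta.
have [M [M0 HM E0 ET]] := C2c_support T0 ceta.
have [[c1 _ c3] _] := ceta.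
have [K K0 HK] := flow_near H; have [d d0 Hd] := jac_low H.
(* The flow moves points by at most [K], so the particles of [-N, N] cover the support of eta in
   space at every time. *)
pose N := M + K + 1.
have N0 : 0 < N by rewrite /N; lra.
pose E t x := Dx eta (clamp T t) x.
pose Et t x := Dt T (Dx eta) (clamp T t) x.
pose Ex t x := Dx (Dx eta) (clamp T t) x.
have jE : joint_cont E by apply: (continuous_clamp_joint (F := Dx eta) T0); case: c1.
have jEt : joint_cont Et by apply: (continuous_clamp_joint (F := Dt T (Dx eta)) T0); case: c3.
have jEx : joint_cont Ex by apply: (continuous_clamp_joint (F := Dx (Dx eta)) T0); case: c3.
have jX (F : R -> R -> R) : joint_cont F -> joint_cont (fun t y => F t (X t y)).
  move=> jF; apply: (joint_cont_pair (a := fun t _ => t) (b := X)) => //.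
    by apply: (joint_cont_fst (h := id)); move=> t; exact: cvg_id.
  exact: flow_joint H.
have jsp : joint_cont (fun t y => signed_pow r (z t y)).
  by apply: joint_cont_comp; [exact: signed_pow_continuous|exact: lg_joint H].
have jab : joint_cont (fun t y => `|z t y| `^ r).
  by apply: (joint_cont_comp (h := fun z => `|z| `^ r)); [exact: abs_pow_continuous|exact: lg_joint H].
have jg : joint_cont (cjet T C 1 0) by exact: (cjet_joint T0 (fd_g H) (fd_d H)).
pose G t y := signed_pow r (z t y) * (E t (X t y) * P t y).
pose Gt t y := (signed_pow r (z t y) * (Et t (X t y) + cjet T C 1 0 t y * Ex t (X t y))
  + r^-1 * `|z t y| `^ r * E t (X t y)) * P t y.
have jG : joint_cont G by exact: (joint_contM jsp (joint_contM (jX _ jE) (jac_joint H))).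
have jGt : joint_cont Gt.
  apply: joint_contM (jac_joint H); apply: joint_contD.
    exact: (joint_contM jsp (joint_contD (jX _ jEt) (joint_contM jg (jX _ jEx)))).
  exact: (joint_contM (joint_contZ (c := r^-1) jab) (jX _ jE)).
have dG (t y : R) : t \in `]0, T[ -> is_derive t 1 (G ^~ y) (Gt t y).
  move=> tI; have tT : t \in `[0, T] by exact: subset_itv_oo_cc.
  apply: (has_dt_interior tI).
  have d1 := L t y tT.
  have d2 := C1_on_chain T0 c3 tT (flow_dt H (y := y) tT).
  have d3 := jac_dt H (y := y) tT.
  have h := has_dtM tT d1 (has_dtM tT d2 d3).
  apply: (@has_dt_eq _ _ _ (G ^~ y) t _ (Gt t y) tT h).
    by move=> s sT; rewrite /G /E clamp_id.
  rewrite /Gt /E /Et /Ex clamp_id // -(lg_jac H).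
  have e := mul_signed_pow (z t y) r0; rewrite -e.
  move: (signed_pow r (z t y)) (z t y) (P t y) (cjet T C 1 0 t y) => p1 p2 p3 p4.
  move: (Dt T (Dx eta) t (X t y)) (Dx (Dx eta) t (X t y)) (Dx eta t (X t y)) => p5 p6 p7.
  by field; rewrite gt_eqF.
have inner t : t \in `[0, T] ->
  \int[mu]_x (signed_pow r (eul T C 1 t x) * (Dt T (Dx eta) t x + eul T C 0 t x * Dx (Dx eta) t x)
              + r^-1 * `|eul T C 1 t x| `^ r * Dx eta t x) =
  \int[mu]_(y in `[- N, N]) Gt t y.
  move=> tT.
  pose I x := signed_pow r (eul T C 1 t x) * (Et t x + eul T C 0 t x * Ex t x)
              + r^-1 * `|eul T C 1 t x| `^ r * E t x.
  have cI : continuous I.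
    have ju k := eul_joint H k.
    apply: (joint_cont_x (F := fun t x => signed_pow r (eul T C 1 t x) * (Et t x + eul T C 0 t x * Ex t x)
              + r^-1 * `|eul T C 1 t x| `^ r * E t x)).
    have j1 : joint_cont (fun t x => signed_pow r (eul T C 1 t x)).
      by apply: (joint_cont_comp (h := signed_pow r)); [exact: signed_pow_continuous|exact: (ju 1%N)].
    have j2 : joint_cont (fun t x => `|eul T C 1 t x| `^ r).
      by apply: (joint_cont_comp (h := fun z => `|z| `^ r)); [exact: abs_pow_continuous|exact: (ju 1%N)].
    apply: joint_contD; first exact: (joint_contM j1 (joint_contD jEt (joint_contM (ju 0%N) jEx))).
    exact: (joint_contM (joint_contZ (c := r^-1) j2) jE).
  have IE x : signed_pow r (eul T C 1 t x) * (Dt T (Dx eta) t x + eul T C 0 t x * Dx (Dx eta) t x)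
              + r^-1 * `|eul T C 1 t x| `^ r * Dx eta t x = I x.
    by rewrite /I /E /Et /Ex clamp_id.
  under eq_Rintegral => x _ do rewrite IE.
  have I0 x : x \notin `[X t (- N), X t N] -> I x = 0.
    move=> xN; have Mx : M < `|x|.
      rewrite ltNge; apply: contra xN; rewrite ler_norml in_itv /= => /andP[h1 h2].
      have := HK t (- N); have := HK t N; rewrite !ler_norml /N => /andP[h3 _] /andP[_ h4].
      by apply/andP; split; lra.
    have [_ e1 e2 e3] := HM t x Mx.
    by rewrite /I /E /Et /Ex clamp_id // e1 e2 (e3 tT) !mulr0 !addr0 mulr0.
  have NN : - N <= N by lra.
  rewrite (int_support I0) (ldiff_cov (fun y => flow_dx H t y) (@jac_cont _ _ _ H t) d0 (Hd t) NN cI).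
  apply: eq_Rintegral => y _; rewrite /I /Gt /=.
  by rewrite (iflowK H).
have -> : \int[mu]_(t in `[0, T]) \int[mu]_x
      (momentum r (velocity T phi) t x *
        (Dt T (Dx eta) t x - derive1 (fun y => Dx (velocity T phi) t y * eta t y) x
         + derive1 (fun y => velocity T phi t y * Dx eta t y) x)) =
    \int[mu]_(t in `[0, T]) \int[mu]_(y in `[- N, N]) Gt t y.
  by apply: eq_Rintegral => t; rewrite mem_setE => tT; rewrite weak_inner_velocity // inner.
rewrite (int_param_FTC _ _ T0 jG jGt dG) /G /E.
have i0 : 0 \in `[0, T] by rewrite in_itv /= lexx ltW.
have iT : T \in `[0, T] by rewrite in_itv /= lexx ltW.
rewrite !clamp_id // E0 ET.
by apply/eqP; rewrite subr_eq0; apply/eqP/eq_Rintegral => x _; rewrite !mul0r !mulr0.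
Qed.

End WeakLagrangian.

Section Shift.
Context {R : realType}.
Local Notation mu := (@lebesgue_measure R).

Lemma int_shift (G : R -> R) (a b s : R) : a <= b -> continuous G ->
  \int[mu]_(x in `[a + s, b + s]) G x = \int[mu]_(x in `[a, b]) G (x + s).
Proof.
move=> ab cG.
have dX (y : R) : is_derive y 1 (fun y => y + s) 1.
  by apply: is_derive1_eq (is_derive1_affine 1 s y) _ _ => // x; rewrite mul1r.
have c1 : continuous (fun _ : R => 1 : R) by move=> y; exact: cvg_cst.
rewrite (ldiff_cov (X := fun y => y + s) dX c1 ltr01 (fun=> lexx _) ab cG).
by apply: eq_Rintegral => x _; rewrite mulr1.
Qed.

Lemma int_itv_le (f : R -> R) (a b e : R) : a <= b -> continuous f ->
  (forall x, x \in `[a, b] -> `|f x| <= e) -> `|\int[mu]_(x in `[a, b]) f x| <= e * (b - a).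
Proof.
move=> ab cf fe.
have ce : continuous (fun _ : R => e) by move=> y; exact: cvg_cst.
have E : \int[mu]_(x in `[a, b]) e = e * (b - a).
  rewrite Rintegral_cst //= lebesgue_measure_itv /= lte_fin.
  by case: ltP => //= ba; rewrite (_ : b = a) ?subrr //; apply/eqP; rewrite eq_le ab ba.
have cn : continuous (fun x => `|f x|) by move=> x; apply: cvg_norm; exact: cf.
rewrite -E ler_norml; apply/andP; split.
  rewrite lerNl -mulN1r -int_itvZ //; apply: le_Rintegral => //.
  - by apply: itv_integrable => x; apply: cvgM; [exact: cvg_cst|exact: cf].
  - exact: itv_integrable.
  by move=> x xI; rewrite mulN1r (le_trans _ (fe x xI)) // -normrN ler_norm.
apply: le_Rintegral => //; [exact: itv_integrable|exact: itv_integrable|].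
by move=> x xI; rewrite (le_trans _ (fe x xI)) // ler_norm.
Qed.

Lemma int_rect_le (F : R -> R -> R) (a b A B e : R) : a <= b -> A <= B -> joint_cont F ->
  (forall t x, t \in `[a, b] -> x \in `[A, B] -> `|F t x| <= e) ->
  `|\int[mu]_(t in `[a, b]) \int[mu]_(x in `[A, B]) F t x| <= e * (B - A) * (b - a).
Proof.
move=> ab AB cF Fe; apply: int_itv_le => //; first exact: int_param_cont.
by move=> t tI; apply: int_itv_le => //; [exact: joint_cont_x|move=> x xI; exact: Fe].
Qed.

Lemma C1_on_tensor (T : R) (c : R -> R -> R) (f df h dh : R -> R) : 0 < T ->
  (forall t x, t \in `[0, T] -> c t x = f t * h x) ->
  (forall t : R, is_derive t 1 f (df t)) -> (forall x : R, is_derive x 1 h (dh x)) ->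
  continuous df -> continuous dh ->
  [/\ C1_on T c, (forall t x, t \in `[0, T] -> Dt T c t x = df t * h x) &
      (forall t x, t \in `[0, T] -> Dx c t x = f t * dh x)].
Proof.
move=> T0 E df_ dh_ cdf cdh.
have Ct t : t \in `[0, T] -> c t = fun x => f t * h x by move=> tT; apply/funext => x; exact: E.
have d1 t x : t \in `[0, T] -> has_dt T (fun s => c s x) t (df t * h x).
  move=> tT; rewrite mulrC; apply: (has_dt_derive tT _ (is_derive1Z (h x) (df_ t))) => s sT.
  by rewrite E // mulrC.
have d2 t (x : R) : t \in `[0, T] -> is_derive x 1 (c t) (f t * dh x).
  by move=> tT; rewrite Ct //; exact: is_derive1Z.
have D t x : t \in `[0, T] -> derivable_t T c t x /\ Dt T c t x = df t * h x.
  by move=> tT; exact: has_dt_Dt T0 tT (d1 t x tT).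
have cf : continuous f by move=> t; exact: is_derive1_continuous (df_ t).
have ch : continuous h by move=> x; exact: is_derive1_continuous (dh_ x).
have X t x : t \in `[0, T] -> Dx c t x = f t * dh x by move=> tT; exact: is_derive1_derive1 (d2 t x tT).
have Y t x : t \in `[0, T] -> Dt T c t x = df t * h x by move=> /(D t x)[].
split => //; split.
- by move=> t x tT; split; [by case: (D t x tT)|exact: is_derive1_derivable (d2 t x tT)].
- apply: joint_continuous_on Y _; apply: joint_contM; [exact: joint_cont_fst|exact: joint_cont_snd].
- apply: joint_continuous_on X _; apply: joint_contM; [exact: joint_cont_fst|exact: joint_cont_snd].
Qed.

Lemma C2c_tensor (T : R) (f h : R -> R) (a b M : R) : 0 < T -> smooth f -> smooth h ->
  0 < a -> b < T -> (forall t, t < a \/ b < t -> f t = 0) -> (forall x, M < `|x| -> h x = 0) ->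
  let eta := fun t x => f t * h x in
  C2c T eta /\ forall t x, t \in `[0, T] ->
    [/\ Dx eta t x = f t * derive1 h x, Dx (Dx eta) t x = f t * derive1n 2 h x &
        Dt T (Dx eta) t x = derive1 f t * derive1 h x].
Proof.
move=> T0 sf sh a0 bT f0 h0 eta.
have df k (t : R) : is_derive t 1 (derive1n k f) (derive1n k.+1 f t) by exact: smooth_is_derive.
have dh k (x : R) : is_derive x 1 (derive1n k h) (derive1n k.+1 h x) by exact: smooth_is_derive.
have cf k : continuous (derive1n k f) by exact: smooth_continuous.
have ch k : continuous (derive1n k h) by exact: smooth_continuous.
have [c0 t0 x0] := C1_on_tensor (c := eta) T0 (fun t x _ => erefl) (df 0%N) (dh 0%N) (cf 1%N) (ch 1%N).
have [c1 t1 x1] := C1_on_tensor (c := Dt T eta) T0 t0 (df 1%N) (dh 0%N) (cf 2%N) (ch 1%N).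
have [c2 t2 x2] := C1_on_tensor (c := Dx eta) T0 x0 (df 0%N) (dh 1%N) (cf 1%N) (ch 2%N).
split; last by move=> t x tT; split; [exact: x0|exact: x2|exact: t2].
split; first by split.
exists a, b, M; split => // t x /or3P[e|e|e]; rewrite /eta.
- by rewrite f0 ?mul0r //; left.
- by rewrite f0 ?mul0r //; right.
- by rewrite h0 ?mulr0.
Qed.

(** Constancy on either side of the bump gives the difference of two translates compact support. *)
Lemma prim_bump (c e : R) : [/\ forall x, x <= c - e -> prim (bump c e) x = 0,
   forall x, c + e <= x -> prim (bump c e) x = \int[mu]_y bump c e y,
   smooth (prim (bump c e)) & derive1 (prim (bump c e)) = bump c e].
Proof.
have [g d] := nice_prim_gminf (nice_bump c e); have [s _ _] := gminf_nice g.
have bo (y : R) : e <= c - y \/ e <= y - c -> bump c e y = 0.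
  move=> h; apply: bump_out; case: h => h; last exact: le_trans (ler_norm _).
  by rewrite -normrN opprB; exact: le_trans (ler_norm _).
have lo (x y : R) : x <= c - e -> \1_(`]-oo, x]) y * bump c e y = 0.
  move=> xc; rewrite indicE mem_setE in_itv /=; case: leP => yx; rewrite ?mul0r // bo ?mulr0 //.
  by left; lra.
have hi (x y : R) : c + e <= x -> \1_(`]-oo, x]) y * bump c e y = bump c e y.
  move=> xc; rewrite indicE mem_setE in_itv /=; case: leP => yx; rewrite ?mul1r // mul0r bo //.
  by right; lra.
split => // x xc; rewrite prim_indic.
  rewrite -[RHS](mul0r (\int[mu]_y bump c e y)) -int_Z; last by have [] := nice_bump c e 0.
  by apply: eq_Rintegral => y _; rewrite mul0r lo.
by apply: eq_Rintegral => y _; exact: hi.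
Qed.

End Shift.

(** * From the weak equation to the Riccati equation *)

Section WeakLocal.
Context {R : realType} (T r : R) (T0 : 0 < T) (r1 : 1 < r).
Local Notation mu := (@lebesgue_measure R).
Let r0 : 0 < r. Proof. exact: lt_trans ltr01 r1. Qed.
Context (u : R -> R -> R) (U V : nat -> R -> R -> R) (J : euler_jet T u U V).
Context (M0 M1 : R) (U0M : forall t x, `|U 0%N t x| <= M0) (U1M : forall t x, `|U 1%N t x| <= M1).
Context (U1_decay : forall e : R, 0 < e -> exists A : R, forall t x, x <= A -> `|U 1%N t x| <= e).
Context (weak : forall eta, C2c T eta -> \int[mu]_(t in `[0, T]) \int[mu]_x
  (signed_pow r (U 1%N t x) * (Dt T (Dx eta) t x + U 0%N t x * Dx (Dx eta) t x)
   + r^-1 * `|U 1%N t x| `^ r * Dx eta t x) = 0).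

Let jU k : (k < 4)%N -> joint_cont (U k). Proof. exact: (ej_U J). Qed.

Let jsp : joint_cont (fun t x => signed_pow r (U 1%N t x)).
Proof. by apply: joint_cont_comp; [exact: signed_pow_continuous|exact: jU]. Qed.

Let jab : joint_cont (fun t x => `|U 1%N t x| `^ r).
Proof.
by apply: (joint_cont_comp (h := fun z => `|z| `^ r)); [exact: abs_pow_continuous|exact: jU].
Qed.

Lemma signed_pow_decay (e : R) : 0 < e ->
  exists A : R, forall t x, x <= A -> `|signed_pow r (U 1%N t x)| <= e.
Proof.
move=> e0; have cs : continuous (signed_pow r : R -> R) by exact: signed_pow_continuous.
have := cs 0; move=> /cvgrPdist_le/(_ _ e0)[d /= d0 Hd].
have d2 : 0 < d / 2 by rewrite divr_gt0.
have [A HA] := U1_decay d2; exists A => t x xA.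
have := Hd (U 1%N t x); rewrite /= !sub0r signed_pow0 sub0r !normrN; apply.
by apply: le_lt_trans (HA t x xA) _; lra.
Qed.

(** The integrand of the weak equation for eta_x = f(t) h(x), with the solution translated instead
    of the test function, so that the domain of integration stays fixed. *)
Definition weak_density (s : R) (f df h dh : R -> R) (t x : R) : R :=
  signed_pow r (U 1%N t (x + s)) * (df t * h x + U 0%N t (x + s) * (f t * dh x))
  + r^-1 * `|U 1%N t (x + s)| `^ r * (f t * h x).

Lemma weak_density_joint s f df h dh : continuous f -> continuous df -> continuous h ->
  continuous dh -> joint_cont (weak_density s f df h dh).
Proof.
move=> cf cdf ch cdh.
have sh F : joint_cont F -> joint_cont (fun t x => F t (x + s)).
  move=> jF; apply: (joint_cont_pair (a := fun t _ => t) (b := fun _ x => x + s)) => //.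
    by apply: (joint_cont_fst (h := id)); move=> t; exact: cvg_id.
  apply: (joint_cont_snd (h := fun x => x + s)) => x.
  by apply: cvgD; [exact: cvg_id|exact: cvg_cst].
have t1 := sh _ jsp; have t2 := sh _ jab; have t3 := sh _ (jU (k := 0%N) isT).
have f1 := joint_cont_fst cf; have f2 := joint_cont_fst cdf.
have f3 := joint_cont_snd ch; have f4 := joint_cont_snd cdh.
apply: joint_contD; last exact: (joint_contM (joint_contZ (c := r^-1) t2) (joint_contM f1 f3)).
exact: (joint_contM t1 (joint_contD (joint_contM f2 f3) (joint_contM t3 (joint_contM f1 f4)))).
Qed.

(** Since |u_x|^r = u_x m, every term carries the factor m, and its smallness far to the left makes
    the whole density small. *)
Lemma weak_density_le s f df h dh t x (e A A' B B' : R) :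
  `|signed_pow r (U 1%N t (x + s))| <= e ->
  `|f t| <= A -> `|df t| <= A' -> `|h x| <= B -> `|dh x| <= B' ->
  `|weak_density s f df h dh t x| <= e * (A' * B + M0 * (A * B') + r^-1 * M1 * (A * B)).
Proof.
rewrite /weak_density -(mul_signed_pow _ r0).
have := U0M t (x + s); have := U1M t (x + s).
move: (U 0%N t (x + s)) (U 1%N t (x + s)) => p0 p1; move: (signed_pow r p1) => m.
move: (f t) (df t) (h x) (dh x) => q1 q2 q3 q4 h1 h0 hm hA hA' hB hB'.
have nn (p P : R) : `|p| <= P -> 0 <= P by move=> ?; exact: le_trans (normr_ge0 p) _.
rewrite (_ : _ + _ = m * (q2 * q3 + p0 * (q1 * q4) + r^-1 * p1 * (q1 * q3))); last by ring.
rewrite normrM; apply: ler_pM => //.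
have pm (a b c d : R) : `|a| <= c -> `|b| <= d -> `|a * b| <= c * d.
  by move=> h2 h3; rewrite normrM; apply: ler_pM.
apply: le_trans (ler_normD _ _) _; apply: lerD.
  apply: le_trans (ler_normD _ _) _; apply: lerD; first exact: pm.
  by apply: (pm) => //; exact: pm.
apply: (pm); last exact: pm.
by apply: (pm) => //; rewrite ger0_norm // invr_ge0 ltW.
Qed.

(* A test function [eta] has [eta_x] of mean zero; taking [eta_x = f(t) (b(x) - b(x + L))] and
   letting [L] tend to infinity removes this constraint, since [u_x] decays at [-oo]. *)
Lemma weak_local (t0 x0 e : R) : 0 < e -> e < t0 -> e < T - t0 ->
  \int[mu]_(t in `[0, T]) \int[mu]_(x in `[x0 - e, x0 + e])
    weak_density 0 (bump t0 e) (derive1 (bump t0 e)) (bump x0 e) (derive1 (bump x0 e)) t x = 0.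
Proof.
move=> e0 et eT.
pose a := bump t0 e; pose b := bump x0 e.
have sa : smooth a by exact: smooth_bump.
have sb : smooth b by exact: smooth_bump.
have ca k : continuous (derive1n k a) by exact: bump_continuous.
have cb k : continuous (derive1n k b) by exact: bump_continuous.
pose Phi s := weak_density s a (derive1 a) b (derive1 b).
have jPhi s : joint_cont (Phi s) by exact: (weak_density_joint (ca 0%N) (ca 1%N) (cb 0%N) (cb 1%N)).
have ee : x0 - e <= x0 + e by lra.
have [pl ph ps pd] := prim_bump x0 e; rewrite -/b in pl ph ps pd.
have bo k (x : R) : x \notin `[x0 - e, x0 + e] -> derive1n k b x = 0.
  move=> h; apply: bump_derive_out; rewrite leNgt; apply: contra h.
  rewrite ltr_norml in_itv /= => /andP[h1 h2]; apply/andP; split; lra.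
have b0 (x : R) : x \notin `[x0 - e, x0 + e] -> b x = 0 by exact: (bo 0%N).
have b1 (x : R) : x \notin `[x0 - e, x0 + e] -> derive1 b x = 0 by exact: (bo 1%N).
have shifted L : 0 <= L -> \int[mu]_(t in `[0, T]) \int[mu]_(x in `[x0 - e, x0 + e]) Phi 0 t x =
    \int[mu]_(t in `[0, T]) \int[mu]_(x in `[x0 - e, x0 + e]) Phi (- L) t x.
  move=> L0.
  pose h x := prim b x + (-1) * prim b (1 * x + L).
  have s1 : smooth (fun x => prim b (1 * x + L)) by exact: smooth_affine.
  have s2 : smooth (fun x => (-1) * prim b (1 * x + L)) by exact: smoothZ.
  have sh : smooth h by exact: smoothD ps s2.
  have h0 x : `|x0| + e + L < `|x| -> h x = 0.
    rewrite /h => hx; have := ler_norm x0; have := ler_norm (- x0); rewrite normrN => n1 n2.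
    case: (leP 0 x) hx => [x_ge|x_lt].
      by rewrite (ger0_norm x_ge) => hx; rewrite !ph ?mulN1r ?subrr //; lra.
    by rewrite (ltr0_norm x_lt) => hx; rewrite !pl ?mulr0 ?addr0 //; lra.
  have dh (x : R) : is_derive x 1 h (b x - b (x + L)).
    have p1 (y : R) : is_derive y 1 (prim b) (b y).
      by rewrite -[in b y]pd; exact: (smooth_is_derive 0 y ps).
    have p2 := is_derive1_chain (is_derive1_affine 1 L x) (p1 (1 * x + L)).
    apply: is_derive1_eq (is_derive1D (p1 x) (is_derive1Z (-1) p2)) _ _ => //.
    by rewrite mul1r mulr1 mulN1r.
  have dh2 (x : R) : is_derive x 1 (fun x => b x - b (x + L)) (derive1 b x - derive1 b (x + L)).
    have p1 (y : R) : is_derive y 1 b (derive1 b y) by exact: (smooth_is_derive 0 y sb).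
    have p2 := is_derive1_chain (is_derive1_affine 1 L x) (p1 (1 * x + L)).
    apply: is_derive1_eq (is_derive1B (p1 x) p2) _ _ => [y|]; first by rewrite mul1r.
    by rewrite mul1r mulr1.
  have e1 : derive1 h = fun x => b x - b (x + L) by exact: is_derive1_fun.
  have e2 : derive1n 2 h = fun x => derive1 b x - derive1 b (x + L).
    by rewrite /= e1; exact: is_derive1_fun.
  have a0 t : t < t0 - e \/ t0 + e < t -> a t = 0.
    move=> ht; apply: bump_out; case: ht => ht; last by apply: le_trans (ler_norm _); lra.
    by rewrite -normrN opprB; apply: le_trans (ler_norm _); lra.
  have p1 : 0 < t0 - e by lra.
  have p2 : t0 + e < T by lra.
  have [ceta E] := C2c_tensor T0 sa sh p1 p2 a0 h0.
  have := weak ceta.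
  pose Psi t x := signed_pow r (U 1%N t x) *
      (derive1 a t * b (x + L) + U 0%N t x * (a t * derive1 b (x + L)))
      + r^-1 * `|U 1%N t x| `^ r * (a t * b (x + L)).
  have PhiE t x : Phi (- L) t (x + L) = Psi t x by rewrite /Phi /weak_density /Psi addrK.
  have in_t t : t \in `[0, T] -> \int[mu]_x
      (signed_pow r (U 1%N t x) * (Dt T (Dx (fun t x => a t * h x)) t x
         + U 0%N t x * Dx (Dx (fun t x => a t * h x)) t x)
       + r^-1 * `|U 1%N t x| `^ r * Dx (fun t x => a t * h x) t x) =
     \int[mu]_(x in `[x0 - e, x0 + e]) Phi 0 t x - \int[mu]_(x in `[x0 - e, x0 + e]) Phi (- L) t x.
    move=> tT.
    have pt x : signed_pow r (U 1%N t x) * (Dt T (Dx (fun t x => a t * h x)) t x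
         + U 0%N t x * Dx (Dx (fun t x => a t * h x)) t x)
       + r^-1 * `|U 1%N t x| `^ r * Dx (fun t x => a t * h x) t x = Phi 0 t x - Psi t x.
      have [-> -> ->] := E t x tT; rewrite e1 e2 /Phi /weak_density /Psi addr0.
      move: (signed_pow r _) (`|U 1%N t x| `^ r) (U 0%N t x) (a t) (derive1 a t) => q1 q2 q3 q4 q5.
      move: (b x) (b (x + L)) (derive1 b x) (derive1 b (x + L)) => q6 q7 q8 q9; ring.
    under eq_Rintegral => x _ do rewrite pt.
    have z1 (x : R) : x \notin `[x0 - e, x0 + e] -> Phi 0 t x = 0.
      by move=> xI; rewrite /Phi /weak_density addr0 (b0 x xI) (b1 x xI) !mulr0 !addr0 mulr0.
    have z2 (x : R) : x \notin `[(x0 - e) + - L, (x0 + e) + - L] -> Psi t x = 0.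
      move=> xI; have xI' : x + L \notin `[x0 - e, x0 + e].
        apply: contra xI; rewrite !in_itv /= => /andP[h1 h2]; apply/andP; split; lra.
      by rewrite /Psi (b0 _ xI') (b1 _ xI') !mulr0 !addr0 mulr0.
    have c1 : continuous (Phi 0 t) by exact: joint_cont_x (jPhi 0).
    have c2 : continuous (Psi t).
      have -> : Psi t = fun x => Phi (- L) t (x + L) by apply/funext => x; rewrite PhiE.
      have cc := joint_cont_x (t := t) (jPhi (- L)).
      move=> x; apply: (@continuous_comp _ _ _ (fun x => x + L) (Phi (- L) t)); last exact: cc.
      by apply: cvgD; [exact: cvg_id|exact: cvg_cst].
    rewrite int_B; [|exact: L1_support c1 z1|exact: L1_support c2 z2].
    rewrite (int_support z1) (int_support z2) (int_shift (- L) ee c2).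
    congr (_ - _); apply: eq_Rintegral => x _.
    by have := PhiE t (x - L); rewrite subrK => ->.
  rewrite (_ : \int[mu]_(t in `[0, T]) _ = \int[mu]_(t in `[0, T])
     (\int[mu]_(x in `[x0 - e, x0 + e]) Phi 0 t x - \int[mu]_(x in `[x0 - e, x0 + e]) Phi (- L) t x));
    last by apply: eq_Rintegral => t; rewrite mem_setE; exact: in_t.
  rewrite int_itvB; try exact: int_param_cont.
  by move/eqP; rewrite subr_eq0 => /eqP.
apply/eqP/negP => /negP n0.
pose q := `|\int[mu]_(t in `[0, T]) \int[mu]_(x in `[x0 - e, x0 + e]) Phi 0 t x|.
have q0 : 0 < q by rewrite normr_gt0.
pose A := \int[mu]_y `|derive1 a y|; pose A' := \int[mu]_y `|derive1 (derive1 a) y|.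
pose B := \int[mu]_y `|derive1 b y|; pose B' := \int[mu]_y `|derive1 (derive1 b) y|.
have na : nice a by exact: nice_bump.
have nb : nice b by exact: nice_bump.
pose c := A' * B + M0 * (A * B') + r^-1 * M1 * (A * B).
have c0 : 0 <= c.
  have M0' : 0 <= M0 by exact: le_trans (U0M 0 0).
  have M1' : 0 <= M1 by exact: le_trans (U1M 0 0).
  by rewrite !addr_ge0 // ?mulr_ge0 // ?mulr_ge0 ?int_ge0 // invr_ge0 ltW.
pose W := c * (x0 + e - (x0 - e)) * (T - 0).
have k0 : 0 < W + 1.
  by rewrite /W ltr_wpDl // !mulr_ge0 //; lra.
pose eps := q / 2 / (W + 1).
have eps0 : 0 < eps by rewrite !divr_gt0.
have [Y HY] := signed_pow_decay eps0.
pose L := `|x0 + e| + `|Y|.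
have L0 : 0 <= L by rewrite addr_ge0.
have h : q <= eps * W.
  rewrite /W !mulrA /q (shifted L L0); apply: int_rect_le => //; first exact: ltW.
  move=> t x tT; rewrite in_itv /= => /andP[_ xe].
  apply: weak_density_le.
  - apply: HY; have := ler_norm (x0 + e); have := ler_norm (- Y); rewrite normrN /L; lra.
  - exact: (nice_bound _ na).
  - exact: (nice_bound _ (nice_derive na)).
  - exact: (nice_bound _ nb).
  - exact: (nice_bound _ (nice_derive nb)).
have E2 : eps * (W + 1) = q / 2 by rewrite /eps divfK // gt_eqF.
rewrite mulrDr mulr1 in E2; move: (eps * W) E2 h => w E2 h; lra.
Qed.

(** Where u_x <> 0 the product m u is differentiable in space, so the term with b' can be integrated
    by parts; this brings the local weak equation to the form of [local_dubois]. *)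
Lemma weak_source (t0 x0 : R) : t0 \in `]0, T[ -> U 1%N t0 x0 != 0 -> rsrc r U V t0 x0 = 0.
Proof.
move=> t0T z0.
have [c c0 [d d0 Hd]] : exists2 c : R, 0 < c & exists2 d : R, 0 < d & forall t x : R,
    `|t - t0| < d -> `|x - x0| < d -> c <= `|U 1%N t x|.
  exact: bounded_away (jU (k := 1%N) isT) z0.
pose mx t x := (r - 1) * (cut_pow (r - 2) c (U 1%N t x) * U 2%N t x).
pose mt t x := (r - 1) * (cut_pow (r - 2) c (U 1%N t x) * V 1%N t x).
pose m t x := signed_pow r (U 1%N t x).
(* Near (t0, x0), where [mx] is m_x and m u_x = |u_x|^r, the equation m_t = n reads m_t + m_x u + (1
   - 1/r) |u_x|^r = 0, the vanishing of [rHS_integrated]. *)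
pose n t x := r^-1 * `|U 1%N t x| `^ r - (mx t x * U 0%N t x + m t x * U 1%N t x).
have jcut : joint_cont (fun t x => cut_pow (r - 2) c (U 1%N t x)).
  by apply: joint_cont_comp; [exact: cut_pow_continuous|exact: jU].
have jmx : joint_cont mx by exact: (joint_contZ (c := r - 1) (joint_contM jcut (jU (k := 2%N) isT))).
have jmt : joint_cont mt.
  exact: (joint_contZ (c := r - 1) (joint_contM jcut (ej_V J (k := 1%N) isT))).
have jn : joint_cont n.
  apply: (joint_contB (joint_contZ (c := r^-1) jab)).
  exact: (joint_contD (joint_contM jmx (jU (k := 0%N) isT)) (joint_contM jsp (jU (k := 1%N) isT))).
have zn t x : `|t - t0| < d -> `|x - x0| < d -> U 1%N t x != 0.
  by move=> ht hx; rewrite -normr_gt0 (lt_le_trans c0) // Hd.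
have [t00 t01] : 0 < t0 /\ t0 < T by move: t0T; rewrite in_itv /= => /andP.
pose d' := Num.min d (Num.min t0 (T - t0)).
have d'0 : 0 < d' by rewrite !lt_min d0 t00 subr_gt0.
have dm (t x : R) : `|t - t0| < d' -> `|x - x0| < d' -> is_derive t 1 (m ^~ x) (mt t x).
  rewrite !lt_min => /andP[td /andP[h1 h2]] /andP[xd _].
  have tI : t \in `]0, T[.
    by move: h1 h2; rewrite in_itv /= !ltr_norml => /andP[h1 h2] /andP[h3 h4]; apply/andP; split; lra.
  have tT : t \in `[0, T] by exact: subset_itv_oo_cc.
  apply: (has_dt_interior tI).
  have hd : has_dt T (fun s => U 1%N s x) t (V 1%N t x) by exact: (ej_dt J).
  have h := has_dt_comp tT hd (signed_pow_derive r (zn t x td xd)).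
  apply: (@has_dt_eq _ _ _ (m ^~ x) t _ (mt t x) tT h) => //.
  by rewrite /mt cut_powE ?mulrA // Hd.
have key := local_dubois jsp jmt jn t0T d'0 dm.
have : mt t0 x0 = n t0 x0.
  apply: key => e e0; rewrite !lt_min => /andP[ed /andP[et eT]] _ _.
  rewrite -[RHS](weak_local x0 e0 et eT); apply: eq_Rintegral => t _.
  pose a := bump t0 e; pose b := bump x0 e.
  (* Outside this range the time bump and its derivative vanish, and both integrands with them, so
     [w] need not be differentiable there. *)
  have [td|td] := ltP `|t - t0| d; last first.
    have te : e <= `|t - t0| by apply: le_trans td; exact: ltW.
    apply: eq_Rintegral => x _; rewrite /weak_density addr0.
    rewrite (bump_out te) (_ : derive1 (bump t0 e) t = 0) ?(bump_derive_out (e := e)) //.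
      by rewrite !mul0r !mulr0 !addr0 mulr0.
    exact: (@bump_derive_out _ t0 e t 1 te).
  pose w x := m t x * U 0%N t x.
  pose dw x := mx t x * U 0%N t x + m t x * U 1%N t x.
  have dW (x : R) : `|x - x0| < d -> is_derive x 1 w (dw x).
    move=> xd; have hx : is_derive x 1 (U 1%N t) (U 2%N t x) by exact: (ej_dx J).
    have h0 : is_derive x 1 (U 0%N t) (U 1%N t x) by exact: (ej_dx J).
    have h1 := is_derive1_chain hx (signed_pow_derive r (zn t x td xd)).
    apply: is_derive1_eq (is_derive1M h1 h0) _ _ => //.
    by rewrite /dw /mx cut_powE ?Hd // addrC [X in _ = X + _]mulrC !mulrA.
  have dQ := bump_mul_derive e0 ed dW.
  pose Q' x := derive1 b x * w x + b x * dw x.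
  have cb k : continuous (derive1n k b) by exact: bump_continuous.
  have cm (F : R -> R -> R) : joint_cont F -> continuous (F t) by move=> jF; exact: joint_cont_x jF.
  have cw : continuous w.
    by apply: (cm (fun t x => m t x * U 0%N t x)); exact: (joint_contM jsp (jU (k := 0%N) isT)).
  have cdw : continuous dw.
    apply: (cm (fun t x => mx t x * U 0%N t x + m t x * U 1%N t x)).
    exact: (joint_contD (joint_contM jmx (jU (k := 0%N) isT)) (joint_contM jsp (jU (k := 1%N) isT))).
  have cQ' : continuous Q'.
    move=> x; apply: cvgD.
      by apply: cvgM; [exact: (cb 1%N)|exact: cw].
    by apply: cvgM; [exact: (cb 0%N)|exact: cdw].
  have ee : x0 - e <= x0 + e by lra.
  have b0 x : e <= `|x - x0| -> b x = 0 by exact: bump_out.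
  have iQ : \int[mu]_(x in `[x0 - e, x0 + e]) (a t * Q' x) = 0.
    rewrite int_itvZ // (int_FTC ee dQ cQ') -/b !b0 ?mul0r ?subrr ?mulr0 //.
      by rewrite (_ : x0 - e - x0 = - e) ?normrN ?gtr0_norm //; ring.
    by rewrite (_ : x0 + e - x0 = e) ?gtr0_norm //; ring.
  have cW : continuous (weak_density 0 a (derive1 a) b (derive1 b) t).
    apply: (cm (weak_density 0 a (derive1 a) b (derive1 b))).
    apply: weak_density_joint; [exact: (@bump_continuous _ t0 e 0)|exact: (@bump_continuous _ t0 e 1)|
      exact: (cb 0%N)|exact: (cb 1%N)].
  rewrite -/a -/b -[RHS]subr0 -[X in _ = _ - X]iQ -int_itvB //; last first.
    by move=> x; apply: cvgM; [exact: cvg_cst|exact: cQ'].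
  apply: eq_Rintegral => x _; rewrite /weak_density addr0 /Q' /w /dw /n -/(m t x).
  move: (derive1 a t) (a t) (b x) (derive1 b x) (m t x) (mx t x) => p1 p2 p3 p4 p5 p6.
  move: (U 0%N t x) (U 1%N t x) (`|_| `^ r) => p7 p8 p9; ring.
have zz : U 1%N t0 x0 != 0 by exact: z0.
rewrite /mt /n /mx /m cut_powE; last by apply: Hd; rewrite subrr normr0.
rewrite /signed_pow (abs_powB2 r zz) /rsrc.
have p0 : `|U 1%N t0 x0| `^ (r - 2) != 0 by rewrite gt_eqF // powR_gt0 // normr_gt0.
have rm : r - 1 != 0 by rewrite subr_eq0 gt_eqF.
have rn : r != 0 by rewrite gt_eqF.
move: (U 0%N t0 x0) (U 2%N t0 x0) (V 1%N t0 x0) (U 1%N t0 x0) (`|U 1%N t0 x0| `^ (r - 2)) p0.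
move=> u0 u2 v1 u1 p p0 E.
have : (r - 1) * p * (v1 + u0 * u2 + r^-1 * u1 ^+ 2) = 0.
  rewrite (_ : _ * _ = (r - 1) * (p * v1) -
    (r^-1 * (u1 ^+ 2 * p) - ((r - 1) * (p * u2) * u0 + u1 * p * u1))); first by rewrite E subrr.
  by field; exact: rn.
by move/eqP; rewrite !mulf_eq0 (negbTE rm) (negbTE p0) /= => /eqP.
Qed.

End WeakLocal.

Section WeakRiccati.
Context {R : realType} (T : R) (C : nat -> R -> R -> R) (H : flow_data T C).
Context (r : R) (r1 : 1 < r) (phi : R -> R -> R).
Context (Hphi : forall t, t \in `[0, T] -> phi t = flow T C t).
Let T0 : 0 < T. Proof. exact: fd_T H. Qed.

(** Decay of z in particle coordinates gives decay of u_x in space, because the inverse flow moves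
    points by a bounded amount. *)
Lemma weak_riccati : rHS_weak T r (velocity T phi) -> riccati T C r.
Proof.
move=> W; apply: (riccati_of_nonzero H) => t y tI nz.
have Hu s : s \in `[0, T] -> velocity T phi s = eul T C 0 s by exact: (phi_velocity H Hphi).
have [M0 [_ HM0]] := cjet_bound T0 (fd_g H) (fd_d H) 1 0.
have [M1 [_ HM1]] := lg_bound H.
have [K [K0 HK]] : exists K : R, 0 < K /\ forall t x, `|iflow T C t x - x| <= K.
  by have [K K0 HK] := iflow_near H; exists K.
have HM0' s x : `|eul T C 0 s x| <= M0 by exact: HM0.
have HM1' s x : `|eul T C 1 s x| <= M1 by exact: HM1.
have W' eta : C2c T eta -> \int[lebesgue_measure]_(s in `[0, T]) \int[lebesgue_measure]_x
    (signed_pow r (eul T C 1 s x) * (Dt T (Dx eta) s x + eul T C 0 s x * Dx (Dx eta) s x)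
     + r^-1 * `|eul T C 1 s x| `^ r * Dx eta s x) = 0.
  move=> ceta; rewrite -[RHS](W eta ceta); apply: eq_Rintegral => s; rewrite mem_setE => sT.
  by rewrite (weak_inner_velocity H r1 Hphi).
have dec (e : R) : 0 < e -> exists A : R, forall t x, x <= A -> `|eul T C 1 t x| <= e.
  move=> e0; have [A [A0 HA]] := lg_decay H e0; exists (- A - K) => s x xA.
  apply: HA; have := HK s x; rewrite ler_norml => /andP[_ h]; lra.
have e1 : eul T C 1 t (flow T C t y) != 0.
  by rewrite (_ : eul T C 1 t _ = lg T C t (iflow T C t (flow T C t y))) // (iflowK H).
have := @weak_source R T r T0 r1 _ _ _ (eul_jet H Hu) M0 M1 HM0' HM1' dec W' t (flow T C t y) tI e1.
by rewrite rsrc_eul (iflowK H).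
Qed.

Lemma riccati_rHS_weak : rHS_weak T r (velocity T phi) <-> riccati T C r.
Proof. by split; [exact: weak_riccati|exact: (riccati_weak H r1 Hphi)]. Qed.

End WeakRiccati.

(** * Non-existence on Diff(R) *)

Section PowerInequalities.
Context {R : realType}.
Implicit Types (a r s c : R).

Lemma powR_gt1 a c : 0 < a -> 1 < c -> 1 < c `^ a.
Proof.
move=> a0 c1; have <- : 1 `^ a = 1 :> R by rewrite powR1.
apply: gt0_ltr_powR; rewrite ?nnegrE //.
exact: ltW (lt_trans ltr01 c1).
Qed.

Lemma powR_lt1 a c : 0 < a -> 0 < c -> c < 1 -> c `^ a < 1.
Proof.
move=> a0 c0 c1; have <- : 1 `^ a = 1 :> R by rewrite powR1.
apply: gt0_ltr_powR; rewrite ?nnegrE //.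
exact: ltW.
Qed.

(** The two factors have the same sign; the equality case is what later forces z_0 = 0. *)
Lemma mul_powR_sub1 a s : 0 < a -> 0 < s -> 0 <= (s - 1) * (s `^ a - 1) /\
  ((s - 1) * (s `^ a - 1) = 0 -> s = 1).
Proof.
move=> a0 s0; have [s1|s1|->] := ltrgtP s 1; last by rewrite subrr mul0r.
- have h := powR_lt1 a0 s0 s1.
  have p : 0 < (s - 1) * (s `^ a - 1) by rewrite nmulr_rgt0 subr_lt0.
  by split; [exact: ltW|move=> e; rewrite e ltxx in p].
- have h := powR_gt1 a0 s1.
  have p : 0 < (s - 1) * (s `^ a - 1) by rewrite mulr_gt0 // subr_gt0.
  by split; [exact: ltW|move=> e; rewrite e ltxx in p].
Qed.

(** The function s^r - r s has derivative r (s^{r-1} - 1), of the sign of s - 1, hence a strict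
    minimum at s = 1. *)
Lemma bernoulli_powR r s : 1 < r -> 0 < s -> 0 <= s `^ r - 1 - r * (s - 1) /\
  (s `^ r - 1 - r * (s - 1) = 0 -> s = 1).
Proof.
move=> r1 s0.
have rm : 0 < r - 1 by rewrite subr_gt0.
have r0 : 0 < r by exact: lt_trans ltr01 r1.
pose B (y : R) := y `^ r - r * y.
have dB (y : R) : 0 < y -> is_derive y 1 B (r * (y `^ (r - 1) - 1)).
  move=> y0; have h := is_derive1Z r (is_derive1_id y).
  apply: is_derive1_eq (is_derive1B (is_derive1_powR r y0) h) _ _ => //.
  by rewrite mulrBr.
have B1 : B 1 = 1 - r by rewrite /B powR1 mulr1.
have E : s `^ r - 1 - r * (s - 1) = B s - B 1 by rewrite B1 /B; move: (s `^ r) => p; ring.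
have cont (a b : R) : 0 < a -> {within `[a, b], continuous B}.
  move=> a0; apply: continuous_in_subspaceT => y.
  rewrite mem_setE in_itv /= => /andP[ay _].
  by apply: is_derive1_continuous (dB y _); exact: lt_le_trans ay.
have inI (a b : R) : 0 < a -> forall y, y \in `]a, b[ -> is_derive y 1 B (r * (y `^ (r - 1) - 1)).
  by move=> a0 y; rewrite in_itv /= => /andP[ay _]; apply: dB; exact: lt_trans ay.
rewrite E; have [s1|s1|->] := ltrgtP s 1; last by rewrite subrr.
- have [c cI e] := MVT s1 (inI s 1 s0) (cont s 1 s0).
  move: cI; rewrite in_itv /= => /andP[sc c1].
  have h := powR_lt1 rm (lt_trans s0 sc) c1.
  have p : 0 < B s - B 1.
    rewrite -opprB e oppr_gt0 pmulr_llt0 ?subr_gt0 //.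
    by rewrite pmulr_rlt0 // subr_lt0.
  by split; [exact: ltW|move=> e0; rewrite e0 ltxx in p].
- have [c cI e] := MVT s1 (inI 1 s ltr01) (cont 1 s ltr01).
  move: cI; rewrite in_itv /= => /andP[sc c1].
  have h := powR_gt1 rm sc.
  have p : 0 < B s - B 1.
    by rewrite e mulr_gt0 ?subr_gt0 // mulr_gt0 // subr_gt0.
  by split; [exact: ltW|move=> e0; rewrite e0 ltxx in p].
Qed.

Lemma nondecreasing_pinned (k dk : R -> R) : (forall y : R, is_derive y 1 k (dk y)) ->
  (forall y, 0 <= dk y) -> k y @[y --> -oo] --> (0 : R) -> k y @[y --> +oo] --> (0 : R) ->
  forall y, dk y = 0.
Proof.
move=> dK dk0 kN kP y.
have mono (a b : R) : a <= b -> k a <= k b.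
  move=> ab; have [c _ e] := MVT_le ab (fun x _ => dK x).
  by rewrite -subr_ge0 e mulr_ge0 // subr_ge0.
have k0 x : k x = 0.
  apply/eqP; rewrite eq_le; apply/andP; split.
    apply: (cvgr_to_ge kP); apply: filterS (nbhs_pinfty_ge (num_real x)) => z /=; exact: mono.
  apply: (cvgr_to_le kN); apply: filterS (nbhs_ninfty_le (num_real x)) => z /=; exact: mono.
have h : is_derive y 1 k 0 by apply: is_derive1_eq (is_derive1_cst 0 y) _ _ => // x; rewrite k0.
by rewrite -(is_derive1_derive1 h) (is_derive1_derive1 (dK y)).
Qed.

End PowerInequalities.

(** * Loss of decay at +oo for every nonzero initial velocity *)

Section NonExistence.
Context {R : realType} (T : R) (C : nat -> R -> R -> R) (H : flow_data T C).
Context (r : R) (r1 : 1 < r) (phi : R -> R -> R).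
Context (Hphi : forall t, t \in `[0, T] -> phi t = flow T C t).
Local Notation g := (cjet T C).
Local Notation P := (jac T C).
Local Notation z := (lg T C).
Let T0 : 0 < T. Proof. exact: fd_T H. Qed.
Let r0 : 0 < r. Proof. exact: lt_trans ltr01 r1. Qed.
Let i0 : 0 \in `[0, T]. Proof. by rewrite in_itv /= lexx ltW. Qed.

Lemma riccati_solution t y : riccati T C r -> t \in `[0, T] ->
  let s := 1 + t * z 0 y / r in
  [/\ 0 < s, P t y = P 0 y * s `^ r & g 1 1 t y = P 0 y * (z 0 y * s `^ (r - 1))].
Proof.
move=> ric tT s; have [e1 e2] := riccati_root H r1 y ric tT.
have p0 : 0 < P 0 y `^ r^-1 by rewrite powR_gt0 // (jac_gt0 H).
have pt : 0 < P t y `^ r^-1 by rewrite powR_gt0 // (jac_gt0 H).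
have s0 : 0 < s by move: pt; rewrite e2 pmulr_rgt0.
have back u : (P u y `^ r^-1) `^ r = P u y.
  by rewrite -powRrM mulVf ?gt_eqF // powRr1 // ltW // (jac_gt0 H).
have eP : P t y = P 0 y * s `^ r.
  by rewrite -(back t) e2 powRM ?back // ltW.
split => //; rewrite -(lg_jac H) eP -(mulr_powRB1 (ltW s0) r0).
have : z t y * s = z 0 y.
  move: e1; rewrite e2 -/s => e1.
  by apply: (mulfI (lt0r_neq0 p0)); rewrite mulrCA e1 mulrC.
by move=> <-; move: (s `^ (r - 1)) (z t y) (P 0 y) => a b c; ring.
Qed.

Context (u0 : R -> R) (Hu0 : velocity T phi 0 = u0) (Wu0 : Winf1 u0) (nz : exists x, u0 x <> 0).

Lemma velocity_flow t y : t \in `[0, T] -> velocity T phi t (flow T C t y) = g 1 0 t y.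
Proof. by move=> tT; rewrite (phi_velocity H Hphi tT) /= (iflowK H). Qed.

Lemma flow_y t : flow T C t y @[y --> +oo] --> +oo.
Proof. by have [K K0 HK] := flow_near H; exact: (ldiff_y (HK t)). Qed.

Lemma velocity_y t : t \in `[0, T] -> Winf1 (velocity T phi t) -> g 1 0 t y @[y --> +oo] --> (0 : R).
Proof.
move=> tT /Winf1_nice/nice_cvg0[_ h].
have -> : g 1 0 t = velocity T phi t \o flow T C t by apply/funext => y /=; rewrite velocity_flow.
exact: cvg_comp (flow_y t) h.
Qed.

Let v0_y : g 1 0 0 y @[y --> +oo] --> (0 : R).
Proof. by apply: velocity_y => //; rewrite Hu0. Qed.

(** Otherwise u_0 would be constant, and its decay at +oo would make it 0. *)
Lemma velocity_not_constant : ~ forall y, z 0 y = 0.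
Proof.
move=> z0; have [x []] := nz.
have d (y : R) : is_derive y 1 (g 1 0 0) (g 1 1 0 y) by exact: (cjet_dx T0 (fd_g H)).
have d0 y : g 1 1 0 y = 0 by rewrite -(lg_jac H) z0 mul0r.
have cst y : g 1 0 0 y = g 1 0 0 0.
  have D (w : R) : is_derive w 1 (g 1 0 0) 0 by apply: is_derive1_eq (d w) _ _.
  have [c e] := MVT_sym 0 y D.
  by move: e => [_ /eqP]; rewrite mul0r subr_eq0 => /eqP.
have e0 : g 1 0 0 0 = 0.
  move: cst; move: (g 1 0 0 0) => c cst.
  have E : g 1 0 0 = fun=> c by apply/funext => y; exact: cst.
  by have := v0_y; rewrite E => l; apply: (cvg_unique _ _ l) => //; exact: cvg_cst.
by rewrite -Hu0 -(flowK H 0 x) velocity_flow // cst.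
Qed.

Lemma riccati_not_Winf1 t : riccati T C r -> t \in `]0, T] -> ~ Winf1 (velocity T phi t).
Proof.
move=> ric; rewrite in_itv /= => /andP[t0 tT] W; apply: velocity_not_constant => y0.
have tI : t \in `[0, T] by rewrite in_itv /= ltW.
pose k y := g 1 0 t y - g 1 0 0 y.
pose dk y := g 1 1 t y - g 1 1 0 y.
have dK (y : R) : is_derive y 1 k (dk y).
  by apply: is_derive1B; exact: (cjet_dx T0 (fd_g H)).
(* With s = 1 + t z_0 / r one has z_0 = (r / t) (s - 1), which exposes the product of
   [mul_powR_sub1]. *)
have E y : dk y = P 0 y * (r / t) * ((1 + t * z 0 y / r - 1) * ((1 + t * z 0 y / r) `^ (r - 1) - 1)).
  have [s0 _ e] := riccati_solution y ric tI.
  rewrite /dk e -(lg_jac H); move: ((1 + t * z 0 y / r) `^ (r - 1)) (z 0 y) (P 0 y) => a b c; field.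
  by rewrite !gt_eqF.
have rm : 0 < r - 1 by rewrite subr_gt0.
have rt : 0 < r / t by rewrite divr_gt0.
have dk0 y : 0 <= dk y.
  have [s0 _ e] := riccati_solution y ric tI.
  rewrite E mulr_ge0 //; first by rewrite mulr_ge0 // ltW // (jac_gt0 H).
  by have [] := mul_powR_sub1 rm s0.
have kN : k y @[y --> -oo] --> (0 : R).
  by rewrite -[X in _ --> X](subrr 0); apply: cvgB; exact: (cjet_Ny T0 (fd_g H)).
have kP : k y @[y --> +oo] --> (0 : R).
  by rewrite -[X in _ --> X](subrr 0); apply: cvgB => //; exact: velocity_y.
have [s0 _ e] := riccati_solution y0 ric tI.
have /eqP := nondecreasing_pinned dK dk0 kN kP y0.
rewrite E !mulf_eq0 !invr_eq0 (gt_eqF (jac_gt0 H 0 y0)) (gt_eqF r0) (gt_eqF t0) /= -mulf_eq0 => /eqP h.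
have [_ /(_ h) s1] := mul_powR_sub1 rm s0.
have /eqP : t * z 0 y0 / r = 0 by apply: (addrI 1); rewrite addr0.
by move: (z 0 y0) => w; rewrite !mulf_eq0 invr_eq0 (gt_eqF r0) (gt_eqF t0) orbF /= => /eqP.
Qed.

(** Decay of the comparison function at +oo combines the two assumed memberships in [Diff], which
    control the displacements at times 0 and t, with the decay of u_0. *)
Lemma riccati_not_Diff t : riccati T C r -> t \in `]0, T] -> Diff (phi 0) -> ~ Diff (phi t).
Proof.
move=> ric; rewrite in_itv /= => /andP[t0 tT] [W0 _] [Wt _]; apply: velocity_not_constant => y0.
have tI : t \in `[0, T] by rewrite in_itv /= ltW.
pose k y := g 0 0 t y - g 0 0 0 y - t * g 1 0 0 y.
pose dk y := g 0 1 t y - g 0 1 0 y - t * g 1 1 0 y.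
have dK (y : R) : is_derive y 1 k (dk y).
  apply: is_derive1B; first by apply: is_derive1B; exact: (cjet_dx T0 (fd_g H)).
  by apply: is_derive1Z; exact: (cjet_dx T0 (fd_g H)).
(* Here t z_0 = r (s - 1), so the bracket is the remainder in the Bernoulli inequality for s^r. *)
have E y : dk y = P 0 y * ((1 + t * z 0 y / r) `^ r - 1 - r * (1 + t * z 0 y / r - 1)).
  have [s0 e _] := riccati_solution y ric tI.
  have -> : dk y = P t y - P 0 y - t * (z 0 y * P 0 y).
    by rewrite (lg_jac H) /dk /jac; move: (g 1 1 0 y) (g 0 1 t y) (g 0 1 0 y) => a b c; ring.
  rewrite e; move: ((1 + t * z 0 y / r) `^ r) (z 0 y) (P 0 y) => a b c; field.
  by rewrite !gt_eqF.
have dk0 y : 0 <= dk y.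
  have [s0 _ e] := riccati_solution y ric tI.
  rewrite E mulr_ge0 //; first by rewrite ltW // (jac_gt0 H).
  by have [] := bernoulli_powR r1 s0.
have kN : k y @[y --> -oo] --> (0 : R).
  rewrite -[X in _ --> X](subrr 0); apply: cvgB.
    by rewrite -[X in _ --> X](subrr 0); apply: cvgB; exact: (cjet_Ny T0 (fd_g H)).
  by rewrite -[X in _ --> X](mulr0 t); apply: cvgM; [exact: cvg_cst|exact: (cjet_Ny T0 (fd_g H))].
have disp u : u \in `[0, T] -> Winf1 (fun x => phi u x - x) -> g 0 0 u y @[y --> +oo] --> (0 : R).
  move=> uI; have -> : (fun x => phi u x - x) = g 0 0 u.
    by apply/funext => x; rewrite Hphi // /flow addrC addKr.
  by move=> /Winf1_nice/nice_cvg0[_].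
have kP : k y @[y --> +oo] --> (0 : R).
  rewrite -[X in _ --> X](subrr 0); apply: cvgB.
    by rewrite -[X in _ --> X](subrr 0); apply: cvgB; exact: disp.
  by rewrite -[X in _ --> X](mulr0 t); apply: cvgM; [exact: cvg_cst|exact: v0_y].
have [s0 _ e] := riccati_solution y0 ric tI.
have /eqP := nondecreasing_pinned dK dk0 kN kP y0.
rewrite E mulf_eq0 (gt_eqF (jac_gt0 H 0 y0)) /= => /eqP h.
have [_ /(_ h) s1] := bernoulli_powR r1 s0.
have /eqP : t * z 0 y0 / r = 0 by apply: (addrI 1); rewrite addr0.
by move: (z 0 y0) => w; rewrite !mulf_eq0 invr_eq0 (gt_eqF r0) (gt_eqF t0) orbF /= => /eqP.
Qed.

End NonExistence.

(** * The explicit solution *)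

Section PowerSpan.
Context {R : realType} (r tau : R) (v : R -> R).
Local Notation mu := (@lebesgue_measure R).
Context (r0 : 0 < r) (tau0 : 0 < tau) (nv : nice v).

Definition root_jac (t x : R) : R := 1 + t * v x / r.

Context (qJ : forall t x, t \in `]- tau, tau[ -> 1 / 2 <= root_jac t x <= 3 / 2).

Let q0 t x : t \in `]- tau, tau[ -> 0 < root_jac t x.
Proof. by move=> /(qJ x)/andP[h _]; lra. Qed.

(** A monomial with a space coefficient, a time factor and a real power of q = 1 + t v / r;
    differentiation in either variable returns a sum of such monomials. *)
Definition term (c f : R -> R) (p : R) (t x : R) : R := c x * (f t * root_jac t x `^ p).

(* All mixed derivatives of the explicit solution stay in this class, whose members are
   controlled by the integrable factor [c]. *)
Inductive span (S : (R -> R) -> Prop) : (R -> R -> R) -> Prop :=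
| span_term c f p : S c -> smooth f -> span S (term c f p)
| spanD F G : span S F -> span S G -> span S (fun t x => F t x + G t x).

Lemma term_dx c dc f p t (x : R) : t \in `]- tau, tau[ -> is_derive x 1 c dc ->
  is_derive x 1 (term c f p t)
    (dc * (f t * root_jac t x `^ p) + c x * (p / r) * derive1 v x * (f t * t * root_jac t x `^ (p - 1))).
Proof.
move=> tJ dC; have dv : is_derive x 1 v (derive1 v x) := nice_is_derive 0 x nv.
have dq : is_derive x 1 (root_jac t) (t / r * derive1 v x).
  apply: is_derive1_eq (is_derive1D (is_derive1_cst 1 x) (is_derive1Z (t / r) dv)) _ _ => [y|].
    by rewrite /root_jac mulrAC.
  by rewrite add0r.
have dp := is_derive1_chain dq (is_derive1_powR p (q0 x tJ)).
apply: is_derive1_eq (is_derive1M dC (is_derive1Z (f t) dp)) _ _ => //.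
move: (root_jac t x `^ p) (root_jac t x `^ (p - 1)) (c x) (f t) (derive1 v x) => a b d e g; field.
by rewrite gt_eqF.
Qed.

Lemma term_dt c f df p (t : R) x : t \in `]- tau, tau[ -> is_derive t 1 f df ->
  is_derive t 1 (term c f p ^~ x)
    (c x * (df * root_jac t x `^ p) + c x * (p / r) * v x * (f t * root_jac t x `^ (p - 1))).
Proof.
move=> tJ dF.
have dq : is_derive t 1 (root_jac ^~ x) (v x / r).
  apply: is_derive1_eq (is_derive1_affine (v x / r) 1 t) _ _ => // y.
  by rewrite /root_jac addrC; congr (_ + _); ring.
have dp := is_derive1_chain dq (is_derive1_powR p (q0 x tJ)).
apply: is_derive1_eq (is_derive1Z (c x) (is_derive1M dF dp)) _ _ => //.
move: (root_jac t x `^ p) (root_jac t x `^ (p - 1)) (c x) (f t) (v x) => a b d e g; field.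
by rewrite gt_eqF.
Qed.

(** Two coefficient classes are needed: phi_x - 1 = q^r - 1 is a sum of monomials with constant
    coefficients, which are smooth but not integrable, whereas all its time derivatives have [nice]
    coefficients. *)
Record span_class (S : (R -> R) -> Prop) : Prop := SpanClass {
  sc_der : forall c, S c -> der c /\ S (derive1 c);
  sc_v : forall c (k : R), S c -> S (fun x => c x * k * v x);
  sc_dv : forall c (k : R), S c -> S (fun x => c x * k * derive1 v x) }.

Lemma smooth_class : span_class smooth.
Proof.
have sv := nice_smooth nv; have [_ sdv] := smooth_derive sv.
have kc c (k : R) : smooth c -> smooth (fun x => c x * k).
  by move=> sc; have := @smoothZ _ k c sc; congr smooth; apply/funext => x; rewrite mulrC.
split => [c sc|c k sc|c k sc]; first exact: smooth_derive.
- by have := smoothM (kc c k sc) sv.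
- by have := smoothM (kc c k sc) sdv.
Qed.

Lemma nice_class : span_class nice.
Proof.
have [_ ndv] := nice_der nv.
have kc c (k : R) : nice c -> nice (fun x => c x * k).
  by move=> sc; have := @niceZ _ k c sc; congr nice; apply/funext => x; rewrite mulrC.
split => [c sc|c k sc|c k sc]; first exact: nice_der.
- by have := niceM (kc c k sc) nv.
- by have := niceM (kc c k sc) ndv.
Qed.

Lemma smooth_id : smooth (fun t : R => t).
Proof.
have d1 (t : R) : is_derive t 1 (fun t : R => t) 1 by exact: is_derive1_id.
apply: (smooth_coind (S := fun f => f = (fun t : R => t) \/ exists c : R, f = fun=> c)); last by left.
move=> f [->|[c ->]]; split.
- by move=> t; exact: is_derive1_derivable (d1 t).
- by right; exists 1; exact: is_derive1_fun.
- by move=> t; exact: is_derive1_derivable (is_derive1_cst c t).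
- by right; exists 0; apply: is_derive1_fun => t; exact: is_derive1_cst.
Qed.

(** A single [G] serves as the mixed derivative in both orders, so symmetry of second derivatives is
    built into the class. *)
Lemma span_closed S F : span_class S -> span S F ->
  exists Fx Ft G, [/\ span S Fx, span S Ft, span S G &
    forall (t x : R), t \in `]- tau, tau[ ->
    [/\ is_derive x 1 (F t) (Fx t x), is_derive t 1 (F ^~ x) (Ft t x),
        is_derive t 1 (Fx ^~ x) (G t x) & is_derive x 1 (Ft t) (G t x)]].
Proof.
move=> SC; elim=> {F} [c f p Sc sf|F1 F2 _ [X1 [T1 [G1 [sX1 sT1 sG1 D1]]]] _ [X2 [T2 [G2 [sX2 sT2 sG2 D2]]]]];
  last first.
  exists (fun t x => X1 t x + X2 t x), (fun t x => T1 t x + T2 t x), (fun t x => G1 t x + G2 t x).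
  split; try exact: spanD.
  move=> t x tJ; have [a1 a2 a3 a4] := D1 t x tJ; have [b1 b2 b3 b4] := D2 t x tJ.
  by split; exact: is_derive1D.
have [dc Sdc] := sc_der SC Sc.
have [df sdf] := smooth_derive sf.
pose f1 t := f t * t; pose df1 t := f t + t * derive1 f t.
have sf1 : smooth f1 by exact: smoothM sf smooth_id.
have sdf1 : smooth df1 by exact: (smoothD sf (smoothM smooth_id sdf)).
have dF (t : R) : is_derive t 1 f (derive1 f t) by exact: derivable_is_derive1.
have dF1 (t : R) : is_derive t 1 f1 (df1 t).
  by apply: is_derive1_eq (is_derive1M (dF t) (is_derive1_id t)) _ _ => //; rewrite mulr1.
have dC (x : R) : is_derive x 1 c (derive1 c x) by exact: derivable_is_derive1.
pose c1 x := c x * (p / r) * derive1 v x.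
pose c2 x := c x * (p / r) * v x.
have S1 : S c1 by apply: (sc_dv SC).
have S2 : S c2 by apply: (sc_v SC).
pose c3 x := derive1 c x * (p / r) * v x.
have S3 : S c3 by apply: (sc_v SC).
pose c4 x := c1 x * ((p - 1) / r) * v x.
have S4 : S c4 by apply: (sc_v SC).
exists (fun t x => term (derive1 c) f p t x + term c1 f1 (p - 1) t x).
exists (fun t x => term c (derive1 f) p t x + term c2 f (p - 1) t x).
exists (fun t x => (term (derive1 c) (derive1 f) p t x + term c3 f (p - 1) t x) +
                   (term c1 df1 (p - 1) t x + term c4 f1 (p - 1 - 1) t x)).
split; try by [do ?apply: spanD; apply: span_term].
move=> t x tJ.
have dv : is_derive x 1 v (derive1 v x) := nice_is_derive 0 x nv.
have dC2 : is_derive x 1 c2 (c x * (p / r) * derive1 v x + v x * (derive1 c x * (p / r))).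
  have h : is_derive x 1 (fun x => c x * (p / r)) (derive1 c x * (p / r)).
    by apply: is_derive1_eq (is_derive1Z (p / r) (dC x)) _ _ => [y|]; rewrite mulrC.
  exact: is_derive1M h dv.
split.
- exact: term_dx tJ (dC x).
- exact: term_dt tJ (dF t).
- apply: is_derive1_eq (is_derive1D (term_dt _ p x tJ (dF t)) (term_dt _ (p - 1) x tJ (dF1 t))) _ _ => //.
- apply: is_derive1_eq (is_derive1D (term_dx _ p tJ (dC x)) (term_dx _ (p - 1) tJ dC2)) _ _ => //.
  rewrite /term /c3 /c4 /df1 /f1 /c2 /c1.
  move: (root_jac t x `^ p) (root_jac t x `^ (p - 1)) (root_jac t x `^ (p - 1 - 1)) (derive1 c x) (c x) => a1 a2 a3 a4 a5.
  move: (derive1 f t) (f t) (derive1 v x) (v x) => a6 a7 a8 a9; field.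
  by rewrite gt_eqF.
Qed.

(** Induction on the order: passing to space derivatives preserves the hypothesis because the mixed
    derivatives coincide. *)
Lemma span_comm S F Ft : span_class S -> span S F -> span S Ft ->
  (forall t x : R, t \in `]- tau, tau[ -> is_derive t 1 (F ^~ x) (Ft t x)) ->
  forall k (t x : R), t \in `]- tau, tau[ ->
  is_derive t 1 (fun t => derive1n k (F t) x) (derive1n k (Ft t) x).
Proof.
move=> SC sF sFt dF k; elim: k F Ft sF sFt dF => [//|k IH] F Ft sF sFt dF t x tJ.
have [Fx [Ft' [G [sX sT sG D]]]] := span_closed SC sF.
have EX s : s \in `]- tau, tau[ -> derive1 (F s) = Fx s.
  by move=> sJ; apply: is_derive1_fun => y; have [] := D s y sJ.
have ET s : s \in `]- tau, tau[ -> Ft s = Ft' s.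
  move=> sJ; apply/funext => y; have [_ h _ _] := D s y sJ.
  by rewrite -(is_derive1_derive1 h) (is_derive1_derive1 (dF s y sJ)).
have EG : derive1 (Ft t) = G t.
  by rewrite ET //; apply: is_derive1_fun => y; have [] := D t y tJ.
rewrite -derive1nSr EG.
have h : is_derive t 1 (fun t => derive1n k (Fx t) x) (derive1n k (G t) x).
  by apply: IH => // s y sJ; have [] := D s y sJ.
apply: is_derive1_near h; near=> s.
rewrite -derive1nSr EX //; near: s.
exact: near_in_itvoo.
Unshelve. all: by end_near. Qed.

Lemma q_pow_bound p : exists K : R, 0 <= K /\ forall t x, t \in `]- tau, tau[ -> root_jac t x `^ p <= K.
Proof.
have h2 : (0 : R) < 1 / 2 by rewrite divr_gt0.
have [K [K0 HK]] := @rect_bound R (fun _ y => cut_pow p (1 / 2) y) 0 0 (1 / 2) (3 / 2)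
  (joint_cont_snd (@cut_pow_continuous R p (1 / 2) h2)).
exists K; split; first exact: ltW.
move=> t x tJ; have p0 := q0 x tJ; have /andP[h1 h3] := qJ x tJ.
have := HK 0 (root_jac t x); rewrite !in_itv /= lexx h1 h3 => /(_ isT isT).
by rewrite cut_powE (gtr0_norm p0) // (ger0_norm (powR_ge0 _ _)).
Qed.

Lemma span_bound F : span nice F ->
  exists b : R -> R, L1 b /\ forall t x, t \in `]- tau, tau[ -> `|F t x| <= b x.
Proof.
elim=> {F} [c f p nc sf|F1 F2 _ [b1 [L1_ H1]] _ [b2 [L2 H2]]]; last first.
  exists (fun x => b1 x + b2 x); split; first exact: L1D.
  move=> t x tJ; apply: le_trans (ler_normD _ _) _.
  by apply: lerD; [exact: H1|exact: H2].
have [K [K0 HK]] := q_pow_bound p.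
have [M [M0 HM]] := @rect_bound R (fun t _ => f t) (- tau) tau 0 0
  (joint_cont_fst (smooth_continuous (k := 0%N) sf)).
exists (fun x => (M * K) * `|c x|); split; first by apply/L1Z/L1_norm; have [] := nc 0%N.
move=> t x tJ; rewrite /term normrM mulrC ler_wpM2r // normrM ler_pM //.
  by apply: (HM t 0); [exact: subset_itv_oo_cc|rewrite in_itv /= lexx].
by rewrite ger0_norm ?powR_ge0 // HK.
Qed.

Lemma span_L1 F t : span nice F -> t \in `]- tau, tau[ -> L1 (F t).
Proof.
move=> sF tJ; have [b [Lb Hb]] := span_bound sF.
have [Fx [Ft [G [_ _ _ D]]]] := span_closed nice_class sF.
apply: L1_dominated Lb; last by move=> x; exact: Hb.
apply: continuous_measurable_fun => x; have [d _ _ _] := D t x tJ; exact: is_derive1_continuous d.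
Qed.

Lemma nice_coind (S : (R -> R) -> Prop) f :
  (forall f, S f -> [/\ der f, L1 f & S (derive1 f)]) -> S f -> nice f.
Proof.
move=> HS Sf k; elim: k f Sf => [|k IH] f Sf; have [d l s] := HS f Sf; first by split.
by rewrite -derive1nSr; exact: IH.
Qed.

Lemma span_nice F t : span nice F -> t \in `]- tau, tau[ -> nice (F t).
Proof.
move=> sF tJ; apply: (nice_coind (S := fun f => exists F, span nice F /\ f = F t)); last by exists F.
move=> f [G [sG ->]]; have [Gx [Gt [K [sX _ _ D]]]] := span_closed nice_class sG.
split; [|exact: span_L1|].
  by move=> x; have [d _ _ _] := D t x tJ; exact: is_derive1_derivable d.
by exists Gx; split => //; apply: is_derive1_fun => x; have [] := D t x tJ.
Qed.

Lemma span_jet_bound F k : span nice F ->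
  exists b : R -> R, L1 b /\ forall t x, t \in `]- tau, tau[ -> `|derive1n k (F t) x| <= b x.
Proof.
elim: k F => [|k IH] F sF; first exact: span_bound.
have [Fx [Ft [G [sX _ _ D]]]] := span_closed nice_class sF.
have [b [Lb Hb]] := IH Fx sX; exists b; split => // t x tJ.
rewrite -derive1nSr (_ : derive1 (F t) = Fx t); first exact: Hb.
by apply: is_derive1_fun => y; have [] := D t y tJ.
Qed.

End PowerSpan.

(** * Construction of the geodesic with a given initial velocity *)

Section Existence.
Context {R : realType} (r : R) (r1 : 1 < r) (u0 : R -> R) (nu : nice u0).
Local Notation mu := (@lebesgue_measure R).
Let r0 : 0 < r. Proof. exact: lt_trans ltr01 r1. Qed.

Definition slope : R -> R := derive1 u0.
Local Notation v := slope.
Let nv : nice v. Proof. exact: nice_derive. Qed.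

(** As |v| is bounded by the integral of |v'|, smaller times keep |t v / r| at most 1/2 and q within
    [1/2, 3/2]. The added 1 keeps the denominator positive even for v = 0. *)
Definition lifespan : R := r / (2 * (\int[mu]_x `|derive1 v x| + 1)).
Local Notation tau := lifespan.

Let I0 : 0 <= \int[mu]_x `|derive1 v x|. Proof. exact: int_ge0. Qed.

Lemma lifespan_gt0 : 0 < tau.
Proof. by rewrite divr_gt0 // mulr_gt0 // ltr_wpDl. Qed.

Lemma q_range t x : t \in `]- tau, tau[ -> 1 / 2 <= root_jac r v t x <= 3 / 2.
Proof.
rewrite in_itv /= -ltr_norml => tt.
have h : `|t * v x / r| <= 1 / 2.
  have k0 : 0 < 2 * (\int[mu]_x `|derive1 v x| + 1) by rewrite mulr_gt0 // ltr_wpDl.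
  rewrite normrM normfV (gtr0_norm r0) ler_pdivrMr // normrM.
  apply: (@le_trans _ _ (tau * (\int[mu]_x `|derive1 v x| + 1))).
    apply: ler_pM => //; first exact: ltW.
    by apply: le_trans (nice_bound x nv) _; rewrite lerDl.
  rewrite /lifespan; move: k0 r0; move: (\int[mu]_x `|derive1 v x| + 1) => k k0 r0'.
  rewrite invfM mulrA -mulrA mulVf ?mulr1 ?gt_eqF //; first by rewrite mulrC mul1r.
  by move: k0; rewrite pmulr_rgt0.
move: h; rewrite /root_jac; move: (t * v x / r) => w; rewrite ler_norml => /andP[h1 h2].
by apply/andP; split; lra.
Qed.

(** The coefficient of q^{r-m-1} in the time derivative of order m+1 of q^r, the first factor r / r
    being cancelled. *)
Fixpoint coef (m : nat) : R -> R :=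
  if m is m'.+1 then fun x => coef m' x * ((r - m%:R) / r) * v x else v.

(* [rate 0] is [phi_x - 1 = root_jac^r - 1] and [rate n] is its n-th time derivative. *)
Definition rate (n : nat) : R -> R -> R :=
  if n is m.+1 then term r v (coef m) (fun=> 1) (r - n%:R)
  else fun t x => term r v (fun=> 1) (fun=> 1) r t x + term r v (fun=> -1) (fun=> 1) 0 t x.

Lemma rate0 t x : rate 0 t x = root_jac r v t x `^ r - 1.
Proof. by rewrite /= /term powRr0 !mul1r mulr1. Qed.

Lemma smooth_cst (c : R) : smooth (fun _ : R => c).
Proof.
apply: (smooth_coind (S := fun f => exists c : R, f = fun=> c)); last by exists c.
move=> f [d ->]; split; first by move=> x; exact: is_derive1_derivable (is_derive1_cst d x).
by exists 0; apply: is_derive1_fun => x; exact: is_derive1_cst.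
Qed.

Lemma nice_coef m : nice (coef m).
Proof. by elim: m => [//|m IH]; exact: (sc_v (nice_class nv)). Qed.

Lemma rate_span n : span r v nice (rate n.+1).
Proof. by apply: span_term; [exact: nice_coef|exact: smooth_cst]. Qed.

Lemma rate_span_smooth n : span r v smooth (rate n).
Proof.
case: n => [|n]; first by apply: spanD; apply: span_term; exact: smooth_cst.
by apply: span_term; [apply: nice_smooth; exact: nice_coef|exact: smooth_cst].
Qed.

Lemma rate_dt n (t x : R) : t \in `]- tau, tau[ -> is_derive t 1 (rate n ^~ x) (rate n.+1 t x).
Proof.
move=> tJ; have d1 := is_derive1_cst 1 t.
have rn : r != 0 by rewrite gt_eqF.
case: n => [|n].
  apply: is_derive1_eq (is_derive1D (term_dt r0 q_range (fun=> 1) r x tJ d1)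
    (term_dt r0 q_range (fun=> -1) 0 x tJ d1)) _ _ => //.
  rewrite /rate /term /coef; move: (root_jac r v t x `^ r) (root_jac r v t x `^ 0) (root_jac r v t x `^ (0 - 1)).
  by move: (root_jac r v t x `^ (r - 1)) (v x) => a b c d e; field.
apply: is_derive1_eq (term_dt r0 q_range (coef n) (r - n.+1%:R) x tJ d1) _ _ => //.
rewrite /rate /term; have -> : r - n.+1%:R - 1 = r - n.+2%:R by rewrite -[n.+2%:R]natr1; ring.
rewrite /coef -/coef.
by move: (root_jac r v t x `^ _) (root_jac r v t x `^ _) (coef n x) => a b c; rewrite mul0r mulr0 add0r.
Qed.

Lemma rate_jet_dt n k (t x : R) : t \in `]- tau, tau[ ->
  is_derive t 1 (fun t => derive1n k (rate n t) x) (derive1n k (rate n.+1 t) x).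
Proof.
apply: (span_comm r0 nv q_range (smooth_class nv)); try exact: rate_span_smooth.
by move=> s y sJ; exact: rate_dt.
Qed.

Local Notation T := (tau / 2).
Let T0 : 0 < T. Proof. by rewrite divr_gt0 // lifespan_gt0. Qed.

Let inJ t : t \in `[0, T] -> t \in `]- tau, tau[.
Proof. by rewrite !in_itv /= => /andP[h1 h2]; apply/andP; split; have := lifespan_gt0; lra. Qed.

Let jet_has_dt n k x t : t \in `[0, T] ->
  has_dt T (fun t => derive1n k (rate n t) x) t (derive1n k (rate n.+1 t) x).
Proof. by move=> tT; apply: (has_dt_derive tT) (rate_jet_dt n k x (inJ tT)). Qed.

Lemma nice_cons (f : R -> R) : der f -> L1 f -> nice (derive1 f) -> nice f.
Proof. by move=> df lf nf [|k]; [split|rewrite -derive1nSr; exact: nf]. Qed.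

(** For n = 0 the two monomials of q^r - 1 are not integrable separately. Their sum vanishes at time
    0, so the mean value theorem in time bounds it by T times an integrable majorant of its time
    derivative. *)
Lemma rate_nice n t : t \in `[0, T] -> nice (rate n t).
Proof.
move=> tT; have tJ := inJ tT.
case: n => [|n]; last exact: (span_nice r0 nv q_range (rate_span n) tJ).
have dx (x : R) : is_derive x 1 (rate 0 t) (term r v (derive1 v) id (r - 1) t x).
  have c1 := is_derive1_cst 1 x; have c2 := is_derive1_cst (-1) x.
  apply: is_derive1_eq (is_derive1D (term_dx r0 nv q_range (fun=> 1) r tJ c1)
    (term_dx r0 nv q_range (fun=> 1) 0 tJ c2)) _ _ => //.
  rewrite /term; move: (root_jac r v t x `^ r) (root_jac r v t x `^ 0) (root_jac r v t x `^ (0 - 1)).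
  by move: (root_jac r v t x `^ (r - 1)) (derive1 v x) => a b c d e; field; rewrite gt_eqF.
have E : derive1 (rate 0 t) = term r v (derive1 v) id (r - 1) t by exact: is_derive1_fun.
apply: nice_cons.
- by move=> x; exact: is_derive1_derivable (dx x).
- have [b [Lb Hb]] := span_bound q_range (rate_span 0).
  apply: (L1_dominated (g := fun x => T * b x)); last exact: L1Z.
    by apply: continuous_measurable_fun => x; exact: is_derive1_continuous (dx x).
  move=> x; have i0 : 0 \in `[0, T] by rewrite in_itv /= lexx ltW.
  have [t_ge tle] : 0 <= t /\ t <= T by move: tT; rewrite in_itv /= => /andP.
  have [c cI e] := has_dt_MVT T0 (fun s sT => @jet_has_dt 0 0 x s sT) i0 tT t_ge.
  have z0 : rate 0 0 x = 0 by rewrite rate0 /root_jac !mul0r addr0 powR1 subrr.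
  have cJ : c \in `]- tau, tau[.
    apply: inJ; move: cI; rewrite !in_itv /= => /andP[-> h]; exact: le_trans tle.
  have {}e : rate 0 t x - rate 0 0 x = rate 1 c x * (t - 0) by [].
  move: e; rewrite z0 !subr0 => ->.
  by rewrite normrM (ger0_norm t_ge) mulrC ler_pM // Hb.
rewrite E; apply: (span_nice r0 nv q_range (F := term r v (derive1 v) id (r - 1)) _ tJ).
by apply: span_term; [exact: nice_derive|exact: smooth_id].
Qed.

Definition solution_jet (n : nat) (t : R) : R -> R := prim (rate n t).
Local Notation C := solution_jet.

Lemma solution_gminf n t : t \in `[0, T] -> gminf (C n t).
Proof. by move=> tT; have [] := nice_prim_gminf (rate_nice n tT). Qed.

Lemma solution_derive n t : t \in `[0, T] -> derive1 (C n t) = rate n t.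
Proof. by move=> tT; have [] := nice_prim_gminf (rate_nice n tT). Qed.

(** Two mean value theorems in time bound the error of the difference quotient by |s - t| times an
    integrable majorant of the next time derivative, for every order of space derivative; this is
    convergence in all seminorms. *)
Lemma solution_curve n : curve_derivative T (C n) (C n.+1).
Proof.
apply/curve_derivativeP => [t tT|t tT|t k e tT e0]; try exact: solution_gminf.
have [b [Lb Hb]] := span_jet_bound r0 nv q_range k (rate_span n.+1).
pose B := \int[mu]_x `|b x|.
have B0 : 0 <= B by exact: int_ge0.
have B1 : 0 < B + 1 by rewrite ltr_wpDl.
exists (e / (B + 1)); first by rewrite divr_gt0.
move=> s sd sT st.
rewrite -!derive1nSr !solution_derive //.
have L m u : u \in `[0, T] -> L1 (derive1n k (rate m u)).
  by move=> uT; have [] := rate_nice m uT k.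
have pt x : `|(s - t)^-1 * (derive1n k (rate n s) x - derive1n k (rate n t) x)
    - derive1n k (rate n.+1 t) x| <= `|s - t| * `|b x|.
  have [c [cT cs ->]] := has_dt_MVT_sym T0 (fun u uT => @jet_has_dt n k x u uT) tT sT.
  rewrite mulrCA mulVf ?subr_eq0 // mulr1.
  have [c' [cT' _ ->]] := has_dt_MVT_sym T0 (fun u uT => @jet_has_dt n.+1 k x u uT) tT cT.
  rewrite normrM mulrC ler_pM //.
  by apply: le_trans (Hb c' x (inJ cT')) _; exact: ler_norm.
apply: (@le_trans _ _ (\int[mu]_x (`|s - t| * `|b x|))).
  apply: int_le => //; last by apply: L1Z; exact: L1_norm.
  by apply: L1_norm; apply: L1B; [apply: L1Z; apply: L1B|]; exact: L.
rewrite int_Z; last exact: L1_norm.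
apply: (@le_trans _ _ (e / (B + 1) * B)); first by rewrite ler_wpM2r // ltW.
by rewrite -mulrA -[leRHS]mulr1 ler_wpM2l ?(ltW e0) // mulrC ler_pdivrMr // mul1r lerDl.
Qed.

Lemma rate0_gt t x : t \in `[0, T] -> -1 < rate 0 t x.
Proof.
move=> tT; rewrite rate0; have /andP[h _] := q_range x (inJ tT).
have : 0 < root_jac r v t x `^ r by rewrite powR_gt0 //; lra.
by move: (_ `^ r) => p; lra.
Qed.

Lemma solution_flow : flow_data T C.
Proof.
split; first exact: T0.
- by move=> n t; exact: solution_gminf.
- exact: solution_curve.
- by move=> t x tT; rewrite solution_derive // rate0_gt.
Qed.

Definition solution (t x : R) : R := x + C 0 t x.

Lemma solution_path : diffeo_path T solution.
Proof.
have E t : (fun x => solution t x - x) = C 0 t by apply/funext => x; rewrite /solution addrC addKr.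
split; last first.
  exists C; split; [by apply/funext => t; rewrite E| |exact: solution_curve].
  by move=> n t; exact: solution_gminf.
move=> t tT; rewrite /Diff_minf; split; rewrite E; first exact: solution_gminf.
by move=> x; rewrite solution_derive // rate0_gt.
Qed.

Lemma solution_flowE t : t \in `[0, T] -> solution t = flow T C t.
Proof. by move=> tT; apply/funext => x; rewrite /flow cjetE clamp_id. Qed.

Let i0 : 0 \in `[0, T]. Proof. by rewrite in_itv /= lexx ltW. Qed.

Lemma solution0 : solution 0 = id.
Proof.
apply/funext => x; rewrite /solution /solution_jet.
have -> : rate 0 0 = fun=> 0.
  by apply/funext => y; rewrite rate0 /root_jac !mul0r addr0 powR1 subrr.
rewrite prim_indic; rewrite (_ : \int[mu]_y _ = 0) ?addr0 //.
by rewrite -[RHS](mul0r (\int[mu]_(y in setT) (0 : R))) -int_Z; [apply: eq_Rintegral => y _; rewrite mulr0 mul0r|exact: L10].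
Qed.

Lemma solution_velocity0 : velocity T solution 0 = u0.
Proof.
have H := solution_flow.
have f0 x : iflow T C 0 x = x.
  by have := flowK H 0 x; rewrite -solution_flowE // solution0.
rewrite (phi_velocity H solution_flowE i0); apply/funext => x /=.
rewrite f0 cjetE clamp_id // /= /solution_jet.
have -> : rate 1 0 = derive1 u0.
  by apply/funext => y; rewrite /= /term /root_jac !mul0r addr0 powR1 !mulr1.
rewrite -(prim_repr0 (fun x => nice_is_derive 0 x nu)) //.
- exact: (nice_continuous (k := 1) nu).
- exact: (nice_L1 1 nu).
- by have [] := nice_cvg0 nu.
Qed.

(** For phi_y = q^r one has z = v / q and q_t = v / r, whence z_t = - z^2 / r. *)
Lemma solution_geodesic : geodesic_equation T r solution.
Proof.
have H := solution_flow.
apply/(geodesic_riccati H r1 solution_flowE) => t y tT.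
have J n : cjet T C n 1 t y = rate n t y by rewrite cjetE clamp_id //= solution_derive.
have P : jac T C t y = root_jac r v t y `^ r by rewrite /jac J rate0; move: (_ `^ r) => p; ring.
have /andP[h _] := q_range y (inJ tT); have q0 : 0 < root_jac r v t y by lra.
rewrite /lgt /lg P !J /rate /term /coef.
have e1 := mulr_powRB1 (ltW q0) r0.
have e2 : root_jac r v t y * root_jac r v t y `^ (r - 2) = root_jac r v t y `^ (r - 1).
  have rm : 0 < r - 1 by rewrite subr_gt0.
  by rewrite -(mulr_powRB1 (ltW q0) rm); congr (_ * _ `^ _); ring.
rewrite -e1 -[r - 1%:R]/(r - 1) -[r - 2%:R]/(r - 2) -e2.
have p0 : root_jac r v t y `^ (r - 2) != 0 by rewrite gt_eqF // powR_gt0.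
move: (root_jac r v t y `^ (r - 2)) (root_jac r v t y) (v y) p0 (lt0r_neq0 q0) => p w d p0 w0.
by field; rewrite p0 w0 gt_eqF.
Qed.

End Existence.

Theorem theorem2p1p1 (R : realType) (r : R) (hr : 1 < r) :
  (* the geodesic equation on Diff_{-oo}(R) *)
  (forall phi : R -> R -> R, diffeo_path 1 phi ->
     (euler_lagrange r phi <-> geodesic_equation 1 r phi))
  /\
  (* in Eulerian coordinates it is the r-Hunter--Saxton equation: in the sense
     of distributions for every path, classically whenever the equation makes
     sense classically, and pointwise wherever u_x <> 0 *)
  (forall (T : R) (phi : R -> R -> R), 0 < T -> diffeo_path T phi ->
     let u := velocity T phi in
     [/\ geodesic_equation T r phi <-> rHS_weak T r u,
         C2_on T (momentum r u) ->
           (geodesic_equation T r phi <->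
            forall t x, t \in `[0, T] -> rHS T r u t x = 0) &
         geodesic_equation T r phi ->
           forall t x, t \in `[0, T] -> Dx u t x != 0 ->
             rHS_defined T r u t x /\ rHS T r u t x = 0])
  /\
  (* equivalence with the Proudman--Johnson equation, lambda = 1/r *)
  [/\ 0 < r^-1 < 1,
      (forall (T : R) (u : R -> R -> R), 0 < T -> smooth_curve T u ->
         forall t x, t \in `[0, T] -> Dx u t x != 0 ->
           is_derive x 1 (rHS_integrated T r u t) (rHS T r u t x) /\
           is_derive x 1
             (fun y => rHS_integrated T r u t y / `|Dx u t y| `^ (r - 2))
             ((r - 1) * proudman_johnson T r^-1 u t x)) &
      (forall (T : R) (phi : R -> R -> R), 0 < T -> diffeo_path T phi ->
         let u := velocity T phi in
         rHS_weak T r u <->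
         forall t x, t \in `[0, T] -> proudman_johnson T r^-1 u t x = 0)]
  /\
  (* non-existence on Diff(R) *)
  (forall u0 : R -> R, Winf1 u0 -> (exists x, u0 x <> 0) ->
     (exists (T : R) (phi : R -> R -> R),
        [/\ 0 < T, diffeo_path T phi, phi 0 = id, velocity T phi 0 = u0 &
            geodesic_equation T r phi])
     /\
     (forall (T : R) (phi : R -> R -> R), 0 < T -> diffeo_path T phi ->
        velocity T phi 0 = u0 ->
        geodesic_equation T r phi \/ rHS_weak T r (velocity T phi) ->
        forall t, t \in `]0, T] ->
          ~ Winf1 (velocity T phi t) /\ (Diff (phi 0) -> ~ Diff (phi t)))).
Proof.
have r0 : 0 < r by exact: lt_trans ltr01 hr.
split; [|split; [|split]].
- move=> phi D; have [C [H Hphi]] := diffeo_path_flow ltr01 D.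
  split=> [EL|/(geodesic_riccati H hr Hphi) ric].
    by apply/(geodesic_riccati H hr Hphi); exact: (euler_lagrange_riccati hr H Hphi EL).
  exact: (riccati_euler_lagrange hr H Hphi ric).
- move=> T phi T0 D u; have [C [H Hphi]] := diffeo_path_flow T0 D.
  have Hu t : t \in `[0, T] -> u t = eul T C 0 t by exact: (phi_velocity H Hphi).
  have J := eul_jet H Hu.
  have G := geodesic_riccati H hr Hphi.
  split.
  + split=> [/G ric|W]; first exact: (riccati_weak H hr Hphi ric).
    by apply/G; exact: (weak_riccati H hr Hphi W).
  + by move=> c2; exact: (rHS_classical_geodesic H hr Hphi J c2).
  + by move=> geo; exact: (geodesic_rHS_nonzero H hr Hphi J geo).
- split.
  + by rewrite invr_gt0 r0 invf_lt1.
  + move=> T u T0 /(smooth_curve_jet T0)[U [V J]] t x tT nz.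
    have nz' : U 1%N t x != 0 by rewrite -(ej_Dx J tT).
    by have [_ d1 d2 _] := ej_main T0 hr J tT nz'.
  + move=> T phi T0 D u; have [C [H Hphi]] := diffeo_path_flow T0 D.
    have W := riccati_rHS_weak H hr Hphi; have PJ := proudman_riccati H r Hphi.
    by split=> [/W/PJ|/PJ/W].
- move=> u0 Wu0 nz; have nu := Winf1_nice Wu0; split.
    (* The explicit solution shows that the negative statement below is not vacuous: on the larger
       group a geodesic with this initial velocity exists. *)
    exists (lifespan r u0 / 2), (solution r u0); split.
    + by rewrite divr_gt0 // lifespan_gt0.
    + exact: solution_path.
    + exact: solution0.
    + exact: solution_velocity0.
    + exact: solution_geodesic.
  move=> T phi T0 D Hu0 eqn t tI; have [C [H Hphi]] := diffeo_path_flow T0 D.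
  have ric : riccati T C r.
    by case: eqn => [/(geodesic_riccati H hr Hphi)|/(riccati_rHS_weak H hr Hphi)].
  split; first exact: (riccati_not_Winf1 H hr Hphi Hu0 Wu0 nz ric tI).
  exact: (riccati_not_Diff H hr Hphi Hu0 Wu0 nz ric tI).
Qed.
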